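(* Let $H$ and $K$ be locally compact groups, let $\tau:H\to Aut(K)$ be a continuous homomorphism and let $G_\tau=H\ltimes_\tau K$. Then the right $\tau$-convolution $\stackrel{\tau_r}{\ast}$ makes $L^1(G_\tau)$ into a Banach algebra (i.e. it is a bilinear, associative product on $L^1(G_\tau)$ with $\|f\stackrel{\tau_r}{\ast}g\|_{L^1(G_\tau)}\le\|f\|_{L^1(G_\tau)}\|g\|_{L^1(G_\tau)}$).
   Context: $H,K$ have left Haar measures $dh$ (also written $dt$) and $dk$ (also $ds$). A homomorphism $\tau:H\to Aut(K)$, $h\mapsto\tau_h$, is called continuous if $(h,k)\mapsto\tau_h(k)$ is continuous from $H\times K$ to $K$. The semidirect product $G_\tau=H\ltimes_\tau K$ is the set $H\times K$ with the product topology and the operation $(h,k)\ltimes_\tau(h',k')=(hh',k\tau_h(k'))$. The continuous homomorphism $\delta:H\to(0,\infty)$ is given by $dk=\delta(h)\,d(\tau_h(k))$, i.e. $|E|=\delta(h)|\tau_h(E)|$ for Haar measure $|\cdot|$ on $K$; a left Haar measure of $G_\tau$ is $\delta(h)\,dh\,dk$, and $L^1(G_\tau)$ is taken with respect to it. For $f\in L^1(G_\tau)$ and $t\in H$ put $f_t(k)=f(t,k)$ (so $f_t\in L^1(K)$ for a.e. $t$). With $\ast$ the standard convolution on $L^1(K)$, the right $\tau$-convolution of $f,g\in L^1(G_\tau)$ is $$f\stackrel{\tau_r}{\ast}g(h,k)=\int_H f_h\ast g_t(k)\,\delta(t)\,dt .$$ *)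

(* Defs.v *)
From HB Require Import structures.
From mathcomp Require Import all_boot all_order all_algebra.
From mathcomp Require Import complex.
From mathcomp Require Import all_classical all_reals all_analysis.

Set Implicit Arguments.
Unset Strict Implicit.
Unset Printing Implicit Defensive.

Import Order.TTheory GRing.Theory Num.Theory.
Import numFieldNormedType.Exports.

Local Open Scope classical_set_scope.
Local Open Scope ring_scope.
Local Open Scope complex_scope.

(* Locally compact groups are Hausdorff, as usual in harmonic analysis. The    *)
(* distinguished point inherited from ptopologicalType plays no role; it is    *)
(* only needed to form the measurable type of Borel sets.                      *)
HB.mixin Record isLocallyCompactGroup (G : Type)
    of Group G & PointedTopological G := {
  lcg_mul_continuous : continuous (fun p : G * G => (p.1 * p.2)%g) ;
  lcg_inv_continuous : continuous (fun x : G => (x^-1)%g) ;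
  lcg_hausdorff : hausdorff_space G ;
  lcg_locally_compact : locally_compact [set: G]
}.

#[short(type="lcGroupType")]
HB.structure Definition LocallyCompactGroup :=
  {G of Group G & PointedTopological G & isLocallyCompactGroup G}.

Notation borel G := (g_sigma_algebraType (@open G)).

(* Regularity of Radon measures in the usual sense for Haar measures: outer    *)
(* regular on all Borel sets, inner regular on open sets. Neither G nor the    *)
(* measure is assumed to be sigma-compact or sigma-finite.                     *)
Definition radon (R : realType) (G : ptopologicalType)
    (mu : {measure set (borel G) -> \bar R}) : Prop :=
  [/\ forall C : set G, compact C -> (mu C < +oo)%E,
      forall E : set (borel G), measurable E ->
        mu E = ereal_inf [set mu U | U in [set U : set G | open U /\ E `<=` U]]
    & forall U : set G, open U ->
        mu U =
        ereal_sup [set mu C | C in [set C : set G | compact C /\ C `<=` U]] ].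

Definition left_haar (R : realType) (G : lcGroupType)
    (mu : {measure set (borel G) -> \bar R}) : Prop :=
  [/\ radon mu,
      mu [set: G] != 0%E
    & forall (x : G) (E : set (borel G)), measurable E ->
        mu [set (x * y)%g | y in (E : set G)] = mu E].

Definition topological_automorphism (K : lcGroupType) (f : K -> K) : Prop :=
  [/\ {morph f : x y / (x * y)%g},
      continuous f
    & exists g : K -> K, [/\ cancel f g, cancel g f & continuous g] ].

Record contHomAut (H K : lcGroupType) := ContHomAut {
  aut_of :> H -> K -> K ;
  aut_ofP : forall h, topological_automorphism (aut_of h) ;
  aut_ofM : forall h h', aut_of (h * h')%g = aut_of h \o aut_of h' ;
  aut_of_continuous : continuous (fun p : H * K => aut_of p.1 p.2)
}.

Section ContHomAutTheory.
Variables (H K : lcGroupType) (tau : contHomAut H K).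

Lemma aut_of_mul h : {morph tau h : x y / (x * y)%g}.
Proof. by have [] := aut_ofP tau h. Qed.

Lemma aut_of1 k : tau 1%g k = k.
Proof.
have [_ _ [g [fg _ _]]] := aut_ofP tau 1%g.
have /(congr1 (fun f => f k)) /= := aut_ofM tau 1%g 1%g.
by rewrite mulg1 => /(can_inj fg) /esym.
Qed.

Lemma aut_ofK h : cancel (tau h) (tau h^-1%g).
Proof.
move=> k; have /(congr1 (fun f => f k)) /= := aut_ofM tau h^-1%g h.
by rewrite mulVg aut_of1.
Qed.

Lemma aut_ofKV h : cancel (tau h^-1%g) (tau h).
Proof.
move=> k; have /(congr1 (fun f => f k)) /= := aut_ofM tau h h^-1%g.
by rewrite mulgV aut_of1.
Qed.

Lemma aut_of_one h : tau h 1%g = 1%g.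
Proof.
apply: (@mulgI _ (tau h 1%g)).
by rewrite -aut_of_mul !mulg1.
Qed.

End ContHomAutTheory.

(* A fresh name for H * K, so that it does not inherit the direct product law. *)
Definition semidirect (H K : lcGroupType) (tau : contHomAut H K) : Type :=
  (H * K)%type.

Section Semidirect.
Variables (H K : lcGroupType) (tau : contHomAut H K).
Local Notation G := (semidirect tau).

HB.instance Definition _ := Topological.copy G (H * K)%type.
HB.instance Definition _ := isPointed.Build G (1%g, 1%g).

Definition sdmul (x y : G) : G := ((x.1 * y.1)%g, (x.2 * tau x.1 y.2)%g).
Definition sdone : G := (1%g, 1%g).
Definition sdinv (x : G) : G := ((x.1^-1)%g, tau (x.1^-1)%g (x.2^-1)%g).

Lemma sdmulA : associative sdmul.
Proof.
move=> [a b] [c d] [e f]; rewrite /sdmul /=.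
by rewrite mulgA aut_of_mul aut_ofM /= mulgA.
Qed.

Lemma sdmul1 : left_id sdone sdmul.
Proof. by move=> [a b]; rewrite /sdmul /= !mul1g aut_of1. Qed.

Lemma sd1mul : right_id sdone sdmul.
Proof. by move=> [a b]; rewrite /sdmul /= aut_of_one !mulg1. Qed.

Lemma sdmulV : left_inverse sdone sdinv sdmul.
Proof.
by move=> [a b]; rewrite /sdmul /= -aut_of_mul mulVg mulVg aut_of_one.
Qed.

Lemma sdVmul : right_inverse sdone sdinv sdmul.
Proof. by move=> [a b]; rewrite /sdmul /= aut_ofKV !mulgV. Qed.

HB.instance Definition _ :=
  isGroup.Build G sdmulA sdmul1 sd1mul sdmulV sdVmul.

Lemma sdmul_continuous : continuous (fun p : G * G => (p.1 * p.2)%g).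
Proof.
have c1 : continuous (fun p : G * G => p.1.1 : H).
  by move=> p; apply: continuous_comp; exact: cvg_fst.
have c2 : continuous (fun p : G * G => p.1.2 : K).
  by move=> p; apply: (continuous_comp (f := fst)); [exact: cvg_fst|exact: cvg_snd].
have c3 : continuous (fun p : G * G => p.2.1 : H).
  by move=> p; apply: (continuous_comp (f := snd)); [exact: cvg_snd|exact: cvg_fst].
have c4 : continuous (fun p : G * G => p.2.2 : K).
  by move=> p; apply: continuous_comp; exact: cvg_snd.
have m1 : continuous (fun p : G * G => (p.1.1 * p.2.1)%g).
  move=> p; apply: (continuous_comp (f := fun p : G * G => (p.1.1, p.2.1) : H * H)
    (g := fun q : H * H => (q.1 * q.2)%g)).
    by apply: cvg_pair; [exact: c1|exact: c3].
  exact: lcg_mul_continuous.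
suff m2 : continuous (fun p : G * G => (p.1.2 * tau p.1.1 p.2.2)%g).
  by move=> p; exact: (cvg_pair (m1 p) (m2 p)).
move=> p; apply: (continuous_comp
  (f := fun p : G * G => (p.1.2, tau p.1.1 p.2.2) : K * K)
  (g := fun q : K * K => (q.1 * q.2)%g)); last exact: lcg_mul_continuous.
apply: cvg_pair; first exact: c2.
apply: (continuous_comp (f := fun p : G * G => (p.1.1, p.2.2) : H * K)
  (g := fun q : H * K => tau q.1 q.2)); last exact: aut_of_continuous.
by apply: cvg_pair; [exact: c1|exact: c4].
Qed.

Lemma sdinv_continuous : continuous (fun x : G => (x^-1)%g).
Proof.
have c1 : continuous (fun x : H * K => (x.1^-1)%g).
  move=> x; apply: (continuous_comp (f := fst) (g := fun y : H => (y^-1)%g)).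
    exact: cvg_fst.
  exact: lcg_inv_continuous.
have c2 : continuous (fun x : H * K => (x.2^-1)%g).
  move=> x; apply: (continuous_comp (f := snd) (g := fun y : K => (y^-1)%g)).
    exact: cvg_snd.
  exact: lcg_inv_continuous.
suff c3 : continuous (fun x : H * K => tau (x.1^-1)%g (x.2^-1)%g).
  by move=> x; exact: (cvg_pair (c1 x) (c3 x)).
move=> x; apply: (continuous_comp (f := fun x : H * K => ((x.1^-1)%g, (x.2^-1)%g) : H * K)
  (g := fun q : H * K => tau q.1 q.2)); last exact: aut_of_continuous.
by apply: cvg_pair; [exact: c1|exact: c2].
Qed.

Lemma semidirect_hausdorff : hausdorff_space G.
Proof.
move=> [p1 p2] [q1 q2] pq; congr pair.
  apply: lcg_hausdorff => A B Ap Bq.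
  have [||[a b] /= [[Aa _] [Ba _]]] := pq (A `*` setT) (B `*` setT);
    last by exists a.
    by exists (A, setT) => //; split => //; exact: filterT.
  by exists (B, setT) => //; split => //; exact: filterT.
apply: lcg_hausdorff => A B Ap Bq.
have [||[a b] /= [[_ Ab] [_ Bb]]] := pq (setT `*` A) (setT `*` B);
  last by exists b.
  by exists (setT, A) => //; split => //; exact: filterT.
by exists (setT, B) => //; split => //; exact: filterT.
Qed.

Lemma semidirect_locally_compact : locally_compact [set: G].
Proof.
have lcN (L : lcGroupType) (x : L) :
    exists2 A, nbhs x A & compact A /\ closed A.
  have [A Ax cA] := @lcg_locally_compact L x I.
  exists A => //; move: Ax; rewrite /within /=.
  by apply: (@filterS _ (nbhs x)) => y; exact.
move=> [h k] _; have [A Ah [cA clA]] := lcN H h.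
have [B Bk [cB clB]] := lcN K k.
exists (A `*` B); last split.
- apply: (@filterS _ (nbhs ((h, k) : H * K)) _ (A `*` B)) => //.
  by exists (A, B).
- exact: (@compact_setX H K).
- rewrite (_ : A `*` B = fst @^-1` A `&` snd @^-1` B)//.
  by apply: (@closedI (H * K)%type); apply: closed_comp => //= x _;
    [exact: cvg_fst|exact: cvg_snd].
Qed.

HB.instance Definition _ := isLocallyCompactGroup.Build G
  sdmul_continuous sdinv_continuous
  semidirect_hausdorff semidirect_locally_compact.

Lemma semidirect_mulE (x y : G) :
  (x * y)%g = ((x.1 * y.1)%g, (x.2 * tau x.1 y.2)%g).
Proof. by []. Qed.

End Semidirect.

(* delta is the continuous homomorphism H -> (0, oo) such that                 *)
(* |E| = delta h |tau_h E| for every Borel subset E of K.                      *)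
Definition tau_modulus (R : realType) (H K : lcGroupType)
    (tau : contHomAut H K) (muK : {measure set (borel K) -> \bar R})
    (delta : H -> R) : Prop :=
  [/\ forall h, 0 < delta h,
      {morph delta : h h' / (h * h')%g >-> h * h'},
      continuous delta
    & forall (h : H) (E : set (borel K)), measurable E ->
        muK E = ((delta h)%:E * muK [set tau h k | k in (E : set K)])%E ].

(* The Radon measure delta(h) dh dk is the one representing the iterated       *)
(* integral on compactly supported continuous functions; the library's product *)
(* measure is not used because the Haar measures need not be sigma-finite and  *)
(* the Borel sets of H * K may exceed the product of the Borel sigma-algebras. *)
Definition semidirect_haar (R : realType) (H K : lcGroupType)
    (tau : contHomAut H K) (muH : {measure set (borel H) -> \bar R})
    (muK : {measure set (borel K) -> \bar R}) (delta : H -> R)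
    (muG : {measure set (borel (semidirect tau)) -> \bar R}) : Prop :=
  left_haar muG /\
  forall phi : semidirect tau -> R,
    continuous phi -> compact (closure [set x | phi x != 0]) ->
    (\int[muG]_x (phi x)%:E =
     \int[muH]_h ((delta h)%:E * \int[muK]_k (phi (h, k))%:E))%E.

Section ComplexL1.
Context d (T : measurableType d) (R : realType).
Variable mu : {measure set T -> \bar R}.
Implicit Types f g : T -> R[i].

Definition cmeasurable f : Prop :=
  measurable_fun setT (fun x => complex.Re (f x)) /\
  measurable_fun setT (fun x => complex.Im (f x)).

Definition L1norm f : \bar R := (\int[mu]_x (Normc.normc (f x))%:E)%E.

(* The functions whose classes modulo almost everywhere equality form L^1(mu). *)
Definition inL1 f : Prop := cmeasurable f /\ (L1norm f < +oo)%E.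

Definition cintegral f : R[i] :=
  (\int[mu]_x complex.Re (f x)) +i* (\int[mu]_x complex.Im (f x)).

Definition aeq f g : Prop := {ae mu, forall x, f x = g x}.

End ComplexL1.

Section Convolution.
Variables (R : realType) (K : lcGroupType).
Variable muK : {measure set (borel K) -> \bar R}.

Definition conv_integrand (f g : K -> R[i]) (k y : K) : R[i] :=
  f y * g (y^-1 * k)%g.

Definition conv (f g : K -> R[i]) (k : K) : R[i] :=
  cintegral muK (conv_integrand f g k).

End Convolution.

Section TauConvolution.
Variables (R : realType) (H K : lcGroupType) (tau : contHomAut H K).
Variables (muH : {measure set (borel H) -> \bar R}).
Variables (muK : {measure set (borel K) -> \bar R}) (delta : H -> R).
Local Notation G := (semidirect tau).

Definition slice (f : G -> R[i]) (t : H) : K -> R[i] := fun k => f (t, k).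

Definition rtconv_integrand (f g : G -> R[i]) (x : G) (t : H) : R[i] :=
  conv muK (slice f x.1) (slice g t) x.2 * (delta t)%:C.

Definition rtconv (f g : G -> R[i]) (x : G) : R[i] :=
  cintegral muH (rtconv_integrand f g x).

(* Both integrals in the definition of the right tau-convolution at x converge *)
(* absolutely (integrals are total functions with junk values otherwise).      *)
Definition rtconv_defined (f g : G -> R[i]) (x : G) : Prop :=
  {ae muH, forall t : H,
    inL1 muK (conv_integrand (slice f x.1) (slice g t) x.2)} /\
  inL1 muH (rtconv_integrand f g x).

End TauConvolution.

(* Main.v *)
(** An integrable function vanishes outside a countable union of compact sets, by
    regularity of the Haar measure, so finitely many functions on [G] live on a
    product [OH * OK] of clopen sigma-compact subgroups, and all measures may be
    restricted to these. The restricted measures are sigma-finite and, by inner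
    regularity on open sets, additive along directed unions of open sets
    (tau-additive). Tau-additivity gives Tonelli's theorem for Borel functions
    on a product, although the Borel sigma-algebra may exceed the product of the
    Borel sigma-algebras, and identifies the restriction of [muG] with
    [delta dh dk]. Then [f * g] at [(h, k)] is the integral over [G] of
    [f (h, y) g (t, y^-1 k)] in [(t, y)]; Tonelli and left invariance show that
    the convolution of [|f|] and [|g|] has integral [L1norm f * L1norm g], and that
    convolution is associative on nonnegative functions, from which the complex
    case follows by linearity. *)
Require Import Defs.
From HB Require Import structures.
From mathcomp Require Import all_boot all_order all_algebra.
From mathcomp Require Import finmap complex.
From mathcomp Require Import all_classical all_reals all_analysis.
From mathcomp Require Import measurable_realfun.
From mathcomp Require Import ring.

Set Implicit Arguments.
Unset Strict Implicit.
Unset Printing Implicit Defensive.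

Import Order.TTheory GRing.Theory Num.Theory.
Import numFieldNormedType.Exports.

Local Open Scope classical_set_scope.
Local Open Scope ring_scope.
Local Open Scope complex_scope.

(** * Borel functions *)

(** Restriction has to come before any integral identity. For [H] the real line and [K] the discrete
    real line, the diagonal has one iterated measure infinite and the other zero, and iterated
    integration differs from [muG] on a vertical line. The subgroups are open, which keeps the
    restricted measures tau-additive, and closed, so that the null complement can be added to an
    open exhaustion. The product multiplies only in [K], and [tau] acts on it only through [delta]:
    [OH] and [OK] are generated separately from the projections of the supports, without stability
    of [OK] under [tau]. That [OK] is a subgroup keeps [y^-1 k] inside it and makes the restricted
    measure invariant under its translations. Nonnegative functions take values in the extended
    reals, where Tonelli holds without integrability. Complex identities are read off at the points
    where the convolution of the absolute values is finite, hence almost everywhere. Compatibility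
    with almost everywhere equality then follows from linearity and the norm inequality. *)

HB.instance Definition _ (X Y : ptopologicalType) :=
  Topological.on (X * Y)%type.

Section nonnegative_induction.
Context d (T : measurableType d) (R : realType).
Variable P : (T -> \bar R) -> Prop.
Local Open Scope ereal_scope.

Hypothesis P_indic : forall A, measurable A -> P (fun x => (\1_A x)%:E).
Hypothesis P_scale : forall (c : R) (f : T -> \bar R), (0 <= c)%R ->
  measurable_fun setT f -> (forall x, 0 <= f x) -> P f ->
  P (fun x => c%:E * f x).
Hypothesis P_add : forall f g : T -> \bar R,
  measurable_fun setT f -> (forall x, 0 <= f x) -> P f ->
  measurable_fun setT g -> (forall x, 0 <= g x) -> P g ->
  P (fun x => f x + g x).
Hypothesis P_lim : forall f : nat -> T -> \bar R,
  (forall n, measurable_fun setT (f n)) -> (forall n x, 0 <= f n x) ->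
  (forall x, nondecreasing_seq (f ^~ x)) -> (forall n, P (f n)) ->
  P (fun x => limn (f ^~ x)).

Import HBNNSimple.

(** Approximation by simple functions, each a finite sum of multiples of indicators of its level
    sets. Measurability and nonnegativity of the partial sums are carried through the induction
    because [P_add] asks for them. *)
Lemma ge0_measurable_ind F :
  measurable_fun setT F -> (forall x, 0 <= F x) -> P F.
Proof.
move=> mF F0; pose g := nnsfun_approx measurableT mF.
have -> : F = (fun x => limn ((fun n y => (g n y)%:E) ^~ x)).
  apply/funext => x; apply/esym/cvg_lim => //.
  exact: (cvg_nnsfun_approx measurableT mF).
apply: P_lim => [n|n x|x m n mn|n].
- exact/measurable_EFinP/measurable_funP.
- by rewrite lee_fin.
- by rewrite lee_fin; exact/lefP/nd_nnsfun_approx.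
pose t y x : \bar R := y%:E * (\1_(g n @^-1` [set y]) x)%:E.
have mt y : measurable_fun setT (t y).
  by apply: measurable_funeM; apply/measurable_EFinP/measurable_indic.
have H (s : seq R) : (forall y, y \in s -> 0 <= y)%R ->
    [/\ P (fun x => \sum_(y <- s) t y x),
        measurable_fun setT (fun x => \sum_(y <- s) t y x)
      & forall x, 0 <= \sum_(y <- s) t y x].
  elim: s => [_|y s IH ys].
    split => [||x]; last by rewrite big_nil.
      have := P_indic measurable0; congr P; apply/funext => x.
      by rewrite big_nil indic0.
    by under eq_fun do rewrite big_nil; exact: measurable_cst.
  have y0 : (0 <= y)%R by apply: ys; rewrite mem_head.
  have [Ps ms s0] := IH (fun z zs => ys z (mem_behead (s := y :: s) zs)).
  have t0 x : 0 <= t y x by rewrite mule_ge0 ?lee_fin.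
  split => [||x]; last by rewrite big_cons adde_ge0.
    under eq_fun do rewrite big_cons; apply: P_add => //.
    apply: P_scale => //; last exact: P_indic.
    exact/measurable_EFinP/measurable_indic.
  by under eq_fun do rewrite big_cons; exact: emeasurable_funD.
have fin : finite_set (range (g n)) by exact: fimfunP.
have [] := H (fset_set (range (g n))) => [y|].
  by rewrite in_fset_set// inE => -[x _ <-].
move=> + _ _; congr P; apply/funext => x.
by rewrite fimfunE fsbig_finite//= -sumEFin.
Qed.

End nonnegative_induction.

Section borel_measurability.
Context (R : realType).

Lemma open_borel (X : ptopologicalType) (U : set X) :
  open U -> measurable (U : set (borel X)).
Proof. by move=> oU; apply: sub_sigma_algebra. Qed.

Lemma closed_borel (X : ptopologicalType) (U : set X) :
  closed U -> measurable (U : set (borel X)).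
Proof.
by move=> cU; rewrite -(setCK U); apply: measurableC; apply: open_borel;
  exact: closed_openC.
Qed.

Lemma continuous_borel (X Y : ptopologicalType) (f : X -> Y) :
  continuous f -> measurable_fun setT (f : borel X -> borel Y).
Proof.
move=> cf; apply: (@measurability _ _ (borel X) (borel Y) setT f (@open Y)) => //.
move=> _ [U oU <-]; rewrite setTI; apply: open_borel.
by move/continuousP : cf; apply.
Qed.

Lemma continuous_real_borel (X : ptopologicalType) (f : X -> R) :
  continuous f -> measurable_fun setT (f : borel X -> R).
Proof.
move=> cf; apply: (measurability _ (RGenOpens.measurableE R)).
move=> _ [_ [a [b ->]] <-]; rewrite setTI; apply: open_borel.
by move/continuousP : cf; apply; exact: interval_open.
Qed.

End borel_measurability.

(** * Tau-additive measures *)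

Definition directed_family (I X : Type) (D : set I) (U : I -> set X) :=
  D !=set0 /\ forall i j, D i -> D j -> exists2 k, D k & U i `|` U j `<=` U k.

(** Near-covering compactness, applied to the filter of index sets that contain every [j] in [D]
    whose [U j] contains some fixed [U i]; directedness makes it stable under intersection.
    Evaluating the outcome at that [i] gives the single set. *)
Lemma compact_directed (X : topologicalType) (C : set X) (I : Type) (D : set I)
    (U : I -> set X) :
  compact C -> directed_family D U -> (forall i, D i -> open (U i)) ->
  C `<=` \bigcup_(i in D) U i -> exists2 i, D i & C `<=` U i.
Proof.
move=> /compact_near_coveringP cC [[i0 Di0] dir] oU CU.
pose F : set_system I := [set S | exists2 i, D i &
  forall j, D j -> U i `<=` U j -> S j].
have FF : Filter F.
  split; first by exists i0.
  - move=> P Q [i Di iP] [j Dj jQ]; have [k Dk ijk] := dir _ _ Di Dj.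
    exists k => // l Dl kl; split.
      by apply: iP => //; apply: subset_trans kl => x ix; apply: ijk; left.
    by apply: jQ => //; apply: subset_trans kl => x ix; apply: ijk; right.
  - by move=> P Q PQ [i Di iP]; exists i => // j Dj ij; apply/PQ/iP.
have [|i Di iP] := cC I F (fun j x => D j -> U j x) FF.
  move=> x Cx; have [i Di Uix] := CU x Cx.
  exists (U i, [set j | D j -> U i `<=` U j]) => /=.
    split; first by apply: open_nbhs_nbhs; split => //; exact: oU.
    by exists i => // j _ ij _.
  by move=> [y j] /= [Uiy ij] Dj; exact: (ij Dj).
by exists i => // x Cx; exact: (iP i Di (fun _ => id)).
Qed.

Section tau_additive.
Context (R : realType).
Local Open Scope ereal_scope.

(** This is the inequality that regularity has to provide; the converse is monotonicity. An upper
    bound [c] stands for the supremum of the [m (U i)]. *)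
Definition tau_additive (X : ptopologicalType)
    (m : {measure set (borel X) -> \bar R}) :=
  forall (I : Type) (D : set I) (U : I -> set X),
    directed_family D U -> (forall i, D i -> open (U i)) ->
    forall c, (forall i, D i -> m (U i) <= c) -> m (\bigcup_(i in D) U i) <= c.

(** By [compact_directed] a compact subset of the union already lies in one [U i]. *)
Lemma inner_regular_tau_additive (X : ptopologicalType)
    (m : {measure set (borel X) -> \bar R}) :
  hausdorff_space X ->
  (forall U : set X, open U -> m U =
    ereal_sup [set m C | C in [set C : set X | compact C /\ C `<=` U]]) ->
  tau_additive m.
Proof.
move=> hX ir I D U dir oU c Uc.
rewrite ir; last exact: bigcup_open.
apply: ge_ereal_sup => _ [C [cC CU] <-].
have [i Di CUi] := compact_directed cC dir oU CU.
apply: le_trans (Uc i Di); apply: le_measure; rewrite ?inE//.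
  by apply: closed_borel; exact: compact_closed.
by apply: open_borel; exact: oU.
Qed.

Lemma tau_additive_mrestr (X : ptopologicalType)
    (m : {measure set (borel X) -> \bar R}) (O : set X)
    (mO : measurable (O : set (borel X))) :
  open O -> tau_additive m ->
  tau_additive (mrestr m mO : {measure set (borel X) -> \bar R}).
Proof.
move=> oO tm I D U [D0 dir] oU c Uc.
rewrite /= /mrestr setI_bigcupl.
apply: tm => //; last by move=> i Di; exact: openI (oU _ Di) _.
split=> // i j Di Dj; have [k Dk ijk] := dir _ _ Di Dj; exists k => //.
by rewrite -setIUl; exact: setSI.
Qed.

(** Induction on [N]. With the last set frozen at an index [j], the induction hypothesis bounds the
    first [N] unions by [c - m (A j N)]; moved across, this bounds [m (A j N)] uniformly in [j], and
    tau-additivity applies to the last set. The subtractions are the reason for setting aside an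
    infinite [c]. *)
Lemma tau_additive_sum (X : ptopologicalType)
    (m : {measure set (borel X) -> \bar R}) (I : Type) (D : set I)
    (A : I -> nat -> set X) :
  tau_additive m -> D !=set0 ->
  (forall i j, D i -> D j -> exists2 k, D k & forall n, A i n `|` A j n `<=` A k n) ->
  (forall i n, D i -> open (A i n)) ->
  forall N c, (forall i, D i -> \sum_(n < N) m (A i n) <= c) ->
  \sum_(n < N) m (\bigcup_(i in D) A i n) <= c.
Proof.
move=> tm D0 dir oA; elim=> [c Ac|N IH c Ac].
  by have [i Di] := D0; have := Ac i Di; rewrite !big_ord0.
have mA i n : D i -> measurable (A i n : set (borel X)).
  by move=> Di; apply: open_borel; exact: oA.
have mB n : measurable (\bigcup_(i in D) A i n : set (borel X)).
  by apply: open_borel; apply: bigcup_open => i Di; exact: oA.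
have [->|coo] := eqVneq c +oo; first by rewrite leey.
have c0 : 0 <= c.
  have [i Di] := D0; apply: le_trans (Ac i Di).
  by apply: sume_ge0 => n _; exact: measure_ge0.
have cfin : c \is a fin_num by rewrite ge0_fin_numE// ltey.
have Afin j : D j -> m (A j N) \is a fin_num.
  move=> Dj; rewrite ge0_fin_numE; last exact: measure_ge0.
  apply: le_lt_trans (_ : c < +oo); last by rewrite ltey.
  apply: le_trans (Ac j Dj); rewrite big_ord_recr/= leeDr//.
  by apply: sume_ge0 => n _; exact: measure_ge0.
have step j : D j -> \sum_(n < N) m (\bigcup_(i in D) A i n) <= c - m (A j N).
  move=> Dj; apply: IH => i Di; rewrite leeBrDr ?Afin//.
  have [k Dk ijk] := dir _ _ Di Dj; apply: le_trans (Ac k Dk).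
  rewrite big_ord_recr/=; apply: leeD; last first.
    apply: le_measure; rewrite ?inE; [exact: mA|exact: mA|].
    by move=> x Ax; apply: ijk; right.
  apply: lee_sum => n _; apply: le_measure; rewrite ?inE; [exact: mA|exact: mA|].
  by move=> x Ax; apply: ijk; left.
have Mfin : \sum_(n < N) m (\bigcup_(i in D) A i n) \is a fin_num.
  rewrite ge0_fin_numE; last by apply: sume_ge0 => n _; exact: measure_ge0.
  have [j Dj] := D0; apply: le_lt_trans (step j Dj) _.
  by rewrite ltey_eq fin_numB cfin Afin.
rewrite big_ord_recr/= addeC -leeBrDr//.
apply: tm => [||j Dj].
- split=> // i j Di Dj; have [k Dk ijk] := dir _ _ Di Dj; exists k => //.
- by move=> i Di; exact: oA.
- by rewrite leeBrDr// addeC -leeBrDr ?Afin//; exact: step.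
Qed.

(** A discrete layer cake: it counts the integers from 1 to [N] strictly below [v]. The strict
    inequality gives open level sets when [v] is a lower semicontinuous function. *)
Definition layers (v : \bar R) (N : nat) : R :=
  (\sum_(k < N) ((k.+1%:R)%:E < v)%E%:R)%R.

Lemma layers_max v N : (layers v N <= N%:R)%R.
Proof.
rewrite /layers; elim: N => [|N IH]; first by rewrite big_ord0.
rewrite big_ord_recr/= -[in leRHS]natr1 lerD//.
by case: (_ < _).
Qed.

Lemma layers_le v N : 0 <= v -> (layers v N)%:E <= v.
Proof.
move=> v0; elim: N => [|N IH]; first by rewrite /layers big_ord0.
have [Nv|Nv] := boolP ((N.+1%:R)%:E < v).
  by apply: le_trans (ltW Nv); rewrite lee_fin layers_max.
by rewrite /layers big_ord_recr/= (negbTE Nv) addr0.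
Qed.

Lemma layers_ge v N : Order.min v (N.+1%:R)%:E <= (1 + layers v N)%:E.
Proof.
elim: N => [|N IH].
  by rewrite /layers big_ord0 addr0 ge_min lexx orbT.
rewrite /layers big_ord_recr/= -/(layers v N); case: ltP => [Nv|vN]/=.
  move: IH; rewrite min_r ?(ltW Nv)// lee_fin => IH.
  apply: (@le_trans _ _ (N.+2%:R)%:E); first by rewrite ge_min lexx orbT.
  by rewrite lee_fin addrA -natr1 lerD2r.
move: IH; rewrite min_l// addr0; apply: le_trans.
by rewrite ge_min lexx.
Qed.

(** With mesh 1/(n+1) and (n+1)^2 layers, the truncation height n+1 tends to infinity while rounding
    loses at most 1/(n+1) below it. At an infinite [v] every layer counts and the value is n+1. *)
Lemma layers_cvg (v : \bar R) : 0 <= v ->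
  (fun n => ((n.+1%:R)^-1 * layers (n.+1%:R%:E * v) (n.+1 ^ 2))%:E) @ \oo --> v.
Proof.
case: v => [v|_|//]; last first.
  rewrite (_ : (fun n => _) = (fun n => (n.+1%:R)%:E)); last first.
    apply/funext => n; congr EFin.
    rewrite gt0_muley ?lte_fin ?ltr0n// /layers.
    under eq_bigr do rewrite ltry.
    by rewrite sumr_const card_ord natrX expr2 mulKf.
  apply/cvgeryP/cvgryPge => A; near=> n.
  by rewrite -natr1 (le_trans (_ : A <= n%:R)%R) ?lerDl//; near: n; exact: nbhs_infty_ger.
rewrite lee_fin => v0.
have nv n : (n.+1%:R%:E * v%:E = (n.+1%:R * v)%:E) by rewrite EFinM.
have up n : ((n.+1%:R)^-1 * layers (n.+1%:R%:E * v%:E) (n.+1 ^ 2) <= v)%R.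
  rewrite mulrC ler_pdivrMr ?ltr0n// mulrC -lee_fin EFinM.
  by apply: layers_le; rewrite -EFinM lee_fin mulr_ge0.
apply: cvg_EFin; first by near=> n.
apply: (@squeeze_cvgr _ _ _ _ (fun n => v - n.+1%:R^-1)%R (fun=> v)); last 2 first.
- rewrite -[X in _ --> X]subr0; apply: cvgB; first exact: cvg_cst.
  exact: cvg_harmonic.
- exact: cvg_cst.
near=> n; rewrite /= up andbT.
have vn : (v <= n%:R)%R by near: n; exact: nbhs_infty_ger.
rewrite -(@ler_pM2l _ n.+1%:R) ?ltr0n// mulrBr divff ?pnatr_eq0//.
rewrite mulVKf ?pnatr_eq0// lerBlDl -lee_fin.
have := layers_ge (n.+1%:R%:E * v%:E) (n.+1 ^ 2).
rewrite nv min_l ?lee_fin// (@le_trans _ _ ((n.+1 ^ 2)%N%:R))//.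
  by rewrite natrX expr2 ler_pM2l ?ltr0n// (le_trans vn)// ler_nat.
by rewrite ler_nat.
Unshelve. all: by end_near.
Qed.

Definition lsc_nonneg (X : ptopologicalType) (psi : X -> \bar R) :=
  (forall x, 0 <= psi x) /\
  forall r : R, (0 <= r)%R -> open [set x | r%:E < psi x].

Definition layer_fun (X : Type) (psi : X -> \bar R) n (x : X) : \bar R :=
  ((n.+1%:R)^-1 * layers (n.+1%:R%:E * psi x) (n.+1 ^ 2))%:E.

Lemma layer_funE (X : ptopologicalType) (psi : X -> \bar R) n :
  layer_fun psi n = (fun x => (n.+1%:R)^-1%:E *
    \sum_(k < n.+1 ^ 2) (\1_[set y : X | ((k.+1%:R / n.+1%:R)%:E < psi y)%E] x)%:E).
Proof.
apply/funext => x; rewrite /layer_fun /layers EFinM; congr (_ * _).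
rewrite -sumEFin; apply: eq_bigr => k _; rewrite indicE; congr (_%:R%:E).
transitivity ((k.+1%:R / n.+1%:R)%:E < psi x).
  by rewrite mulrC EFinM lte_pdivrMl ?ltr0n.
by case: (boolP (_ < psi x)) => h;
  [rewrite mem_set|rewrite memNset//; exact/negP].
Qed.

Lemma layer_fun_ge0 (X : Type) (psi : X -> \bar R) n x : 0 <= layer_fun psi n x.
Proof. by rewrite lee_fin mulr_ge0// /layers sumr_ge0. Qed.

Lemma measurable_layer_fun (X : ptopologicalType) (psi : X -> \bar R) n :
  lsc_nonneg psi -> measurable_fun setT (layer_fun psi n : borel X -> \bar R).
Proof.
move=> [_ ol]; rewrite layer_funE; apply: measurable_funeM.
apply: emeasurable_sum => k; apply/measurable_EFinP/measurable_indic.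
by apply: open_borel; apply: ol; rewrite divr_ge0.
Qed.

Lemma integral_layer_fun (X : ptopologicalType) (psi : X -> \bar R)
    (m : {measure set (borel X) -> \bar R}) n :
  lsc_nonneg psi -> \int[m]_x layer_fun psi n x =
  (n.+1%:R)^-1%:E *
    \sum_(k < n.+1 ^ 2) m [set x | (k.+1%:R / n.+1%:R)%:E < psi x].
Proof.
move=> [_ ol]; rewrite layer_funE.
have mA k : measurable ([set x | (k.+1%:R / n.+1%:R)%:E < psi x] : set (borel X)).
  by apply: open_borel; apply: ol; rewrite divr_ge0.
have mi k : measurable_fun setT (fun x : borel X =>
    (\1_[set y : X | ((k.+1%:R / n.+1%:R)%:E < psi y)%E] x)%:E : \bar R).
  by apply/measurable_EFinP/measurable_indic; exact: mA.
rewrite ge0_integralZl ?lee_fin ?invr_ge0//; last 2 first.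
- exact: emeasurable_sum.
- by move=> x _; apply: sume_ge0 => k _; rewrite lee_fin.
rewrite ge0_integral_sum//; congr (_ * _).
by apply: eq_bigr => k _; rewrite integral_indic ?setIT//; exact: mA.
Qed.

Lemma layer_fun_cvg (X : ptopologicalType) (psi : X -> \bar R) x :
  0 <= psi x -> layer_fun psi ^~ x @ \oo --> psi x.
Proof. exact: layers_cvg. Qed.

Lemma layer_fun_le (X : ptopologicalType) (psi : X -> \bar R) n x :
  0 <= psi x -> layer_fun psi n x <= psi x.
Proof.
move=> psi0; rewrite /layer_fun EFinM lee_pdivrMl ?ltr0n//.
by apply: layers_le; rewrite mule_ge0// lee_fin.
Qed.

Lemma measurable_lsc (X : ptopologicalType) (psi : X -> \bar R) :
  lsc_nonneg psi -> measurable_fun setT (psi : borel X -> \bar R).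
Proof.
move=> lpsi; apply: (@emeasurable_fun_cvg _ (borel X) R setT (layer_fun psi) psi).
  by move=> n; exact: measurable_layer_fun.
by move=> x _; apply: layer_fun_cvg; exact: lpsi.1.
Qed.

(* [psi] is the limit of [1/n] times the sum of the indicators of
   [psi > k/n], [k <= n ^ 2], and tau-additivity applies to finite sums of
   indicators of directed unions of open sets; Fatou's lemma concludes. *)
Lemma tau_additive_integral (X : ptopologicalType)
    (m : {measure set (borel X) -> \bar R}) (I : Type) (D : set I)
    (psi_ : I -> X -> \bar R) (psi : X -> \bar R) :
  tau_additive m -> D !=set0 ->
  (forall i j, D i -> D j -> exists2 k, D k &
    forall x, psi_ i x <= psi_ k x /\ psi_ j x <= psi_ k x) ->
  (forall i, D i -> lsc_nonneg (psi_ i)) ->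
  (forall x, 0 <= psi x) ->
  (forall x (r : R), (0 <= r)%R ->
    r%:E < psi x <-> exists2 i, D i & r%:E < psi_ i x) ->
  forall c, (forall i, D i -> \int[m]_x psi_ i x <= c) -> \int[m]_x psi x <= c.
Proof.
move=> tm D0 dir lpsi_ psi0 psiE c Ic.
have lev r : (0 <= r)%R ->
    [set x | r%:E < psi x] = \bigcup_(i in D) [set x | r%:E < psi_ i x].
  move=> r0; apply/seteqP; split => x /=; first by move=> /(psiE _ _ r0) [i Di ri]; exists i.
  by move=> [i Di ri]; apply/(psiE _ _ r0); exists i.
have lpsi : lsc_nonneg psi.
  split=> // r r0; rewrite lev//; apply: bigcup_open => i Di.
  exact: (lpsi_ i Di).2.
(* The meshes 1/(n+1) are not nested, so [layer_fun psi n] is not monotone in [n]; a lower limit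
   replaces monotone convergence. *)
have -> : \int[m]_x psi x = \int[m]_x limn_einf (layer_fun psi ^~ x).
  apply: eq_integral => x _; apply/esym.
  by have [] := cvg_limn_einf_sup (layer_fun_cvg (psi0 x)).
apply: le_trans (fatou m _ _ _) _ => //.
- by move=> n; exact: measurable_layer_fun.
- by move=> n x _; exact: layer_fun_ge0.
have Hn n : \int[m]_x layer_fun psi n x <= c.
  rewrite integral_layer_fun// lee_pdivrMl ?ltr0n//.
  under eq_bigr do rewrite lev ?divr_ge0//.
  apply: (@tau_additive_sum _ _ _ _ (fun i k => [set x | (k.+1%:R / n.+1%:R)%:E < psi_ i x])) => //.
  - move=> i j Di Dj; have [k Dk ijk] := dir _ _ Di Dj; exists k => // l x /=.
    by have [ik jk] := ijk x; case=> h; [exact: lt_le_trans ik|exact: lt_le_trans jk].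
  - by move=> i l Di; apply: (lpsi_ i Di).2; rewrite divr_ge0.
  - move=> i Di; rewrite -lee_pdivrMl ?ltr0n// -integral_layer_fun; last exact: lpsi_.
    apply: le_trans (Ic i Di); apply: ge0_le_integral => //.
    + by move=> x _; exact: layer_fun_ge0.
    + by apply: measurable_layer_fun; exact: lpsi_.
    + by apply: measurable_lsc; exact: lpsi_.
    + by move=> x _; apply: layer_fun_le; exact: (lpsi_ i Di).1.
rewrite limn_einf_lim; apply: lime_le; first exact: is_cvg_einfs.
apply: nearW => n; apply: le_trans (Hn n).
by apply: ereal_inf_lbound; exists n => /=.
Qed.

End tau_additive.

(** * Tonelli's theorem for tau-additive measures *)

Section product_measure.
Context (R : realType).
Local Open Scope ereal_scope.

Definition exhausted (X : ptopologicalType)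
    (m : {measure set (borel X) -> \bar R}) (D : nat -> set X) :=
  [/\ forall n, open (D n), nondecreasing_seq D, \bigcup_n D n = setT
    & forall n, m (D n) < +oo].

Definition tau_sigma_finite (X : ptopologicalType)
    (m : {measure set (borel X) -> \bar R}) :=
  tau_additive m /\ exists D, exhausted m D.

Lemma measurable_borel_comp (X Y : ptopologicalType) d (T : measurableType d)
    (F : X -> T) (f : Y -> X) :
  measurable_fun setT (F : borel X -> T) -> continuous f ->
  measurable_fun setT ((fun y => F (f y)) : borel Y -> T).
Proof.
move=> mF cf.
by apply: (measurableT_comp (f := F : borel X -> T)) => //; exact: continuous_borel.
Qed.

Lemma continuous_pairl (X Y : topologicalType) (x : X) :
  continuous (fun y : Y => (x, y)).
Proof. by move=> y; apply: cvg_pair; [exact: cvg_cst|exact: cvg_id]. Qed.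

Lemma continuous_pairr (X Y : topologicalType) (y : Y) :
  continuous (fun x : X => (x, y)).
Proof. by move=> x; apply: cvg_pair; [exact: cvg_id|exact: cvg_cst]. Qed.

Lemma measurable_xsection_borel (X Y : ptopologicalType) (E : set (X * Y)) x :
  measurable (E : set (borel (X * Y)%type)) ->
  measurable (xsection E x : set (borel Y)).
Proof.
move=> mE; rewrite xsectionE -[_ @^-1` _]setTI.
exact: (@continuous_borel Y (X * Y)%type _ (@continuous_pairl X Y x) measurableT).
Qed.

Lemma open_xsection (X Y : topologicalType) (W : set (X * Y)) x :
  open W -> open (xsection W x).
Proof.
move=> oW; rewrite xsectionE.
by have /continuousP := @continuous_pairl X Y x; apply.
Qed.

Lemma open_setX (X Y : topologicalType) (A : set X) (B : set Y) :
  open A -> open B -> open (A `*` B).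
Proof.
move=> oA oB; rewrite (_ : A `*` B = fst @^-1` A `&` snd @^-1` B)//.
apply: openI; first by apply: open_comp => // x _; exact: cvg_fst.
by apply: open_comp => // x _; exact: cvg_snd.
Qed.

(** Splits a strict inequality on a product into one on [v] and one on [w], each an open condition
    on the point when [v] is lower semicontinuous and [w] continuous. The separating [c] is the
    midpoint of [r / w] and [v], or [r / w + 1] when [v] is infinite. *)
Lemma gt_mule_approx (r w : R) (v : \bar R) : (0 <= r)%R -> (0 <= w)%R ->
  0 <= v -> r%:E < w%:E * v ->
  exists c : R, [/\ (0 <= c)%R, c%:E < v & (r < w * c)%R].
Proof.
move=> r0; rewrite le_eqVlt => /predU1P[<- _|w0].
  by rewrite mul0e lte_fin ltNge r0.
case: v => [v| |//] v0.
  rewrite -EFinM lte_fin => rwv; exists ((r / w + v) / 2)%R.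
  have rv : (r / w < v)%R by rewrite ltr_pdivrMr// mulrC.
  rewrite lte_fin ?midf_lt//; split => //.
    by rewrite divr_ge0// addr_ge0// divr_ge0// ltW.
  by rewrite mulrC -ltr_pdivrMr// midf_lt.
move=> _; exists (r / w + 1)%R; split; rewrite ?ltry//.
  by rewrite addr_ge0// divr_ge0// ltW.
by rewrite mulrDr mulr1 mulrCA divff ?gt_eqF// mulr1 ltrDl.
Qed.

Lemma lt_mule_lower (r w c : R) (v : \bar R) : (0 <= w)%R ->
  c%:E < v -> (r < w * c)%R -> r%:E < w%:E * v.
Proof.
move=> w0 cv rwc; apply: (@lt_le_trans _ _ (w%:E * c%:E)).
  by rewrite -EFinM lte_fin.
by rewrite lee_wpmul2l// ?lee_fin// ltW.
Qed.

Lemma lsc_nonneg_scale (X : ptopologicalType) (w : X -> R) (psi : X -> \bar R) :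
  continuous w -> (forall x, 0 <= w x)%R -> lsc_nonneg psi ->
  lsc_nonneg (fun x => (w x)%:E * psi x).
Proof.
move=> cw w0 [psi0 opsi]; split=> [x|r r0]; first by rewrite mule_ge0 ?lee_fin.
rewrite openE => x /= /(gt_mule_approx r0 (w0 x) (psi0 x))[c [c0 cpsi rwc]].
have cwc : continuous (fun y => w y * c)%R.
  by move=> y; apply: cvgMl; exact: cw.
have o1 : open [set y | r < w y * c]%R.
  rewrite (_ : [set _ | _] = (fun y => w y * c)%R @^-1` [set z | r < z]%R)//.
  by move/continuousP : cwc; apply; exact: open_gt.
have : open ([set y | r < w y * c]%R `&` [set y | c%:E < psi y]).
  by apply: openI => //; exact: opsi.
move=> oI; apply: (filterS _ (open_nbhs_nbhs (conj oI _))); last by split.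
by move=> y /= [rwcy cpsiy]; exact: lt_mule_lower cpsiy rwcy.
Qed.

(** The section at [x0] is the directed union of the open [V] for which some neighbourhood [N] of
    [x0] has N x V inside [W]. If its measure exceeds [r], tau-additivity gives one such [V] of
    measure above [r], and [V] stays inside the sections at all points of [N]. *)
Lemma lsc_xsection (X Y : ptopologicalType)
    (mY : {measure set (borel Y) -> \bar R}) (W : set (X * Y)) :
  tau_additive mY -> open W -> lsc_nonneg (fun x => mY (xsection W x)).
Proof.
move=> tY oW; split=> [x|r r0]; first exact: measure_ge0.
rewrite openE => x0 /= rW.
pose D := [set V : set Y | open V /\
  exists2 N : set X, open_nbhs x0 N & N `*` V `<=` W].
have : ~ (mY (\bigcup_(V in D) V) <= r%:E).
  apply/negP; rewrite -ltNge; congr (_ < mY _) : rW.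
  apply/seteqP; split => y; rewrite -/(xsection W x0 y).
    move=> /xsectionP Wy; move: oW; rewrite openE => /(_ _ Wy)/=.
    move=> [[N V]] /= []; rewrite !nbhsE => -[N' N'x N'N] [V' [oV' V'y] V'V] NVW.
    exists V' => //; split=> //; exists N' => // -[a b]/= [N'a V'b].
    by apply: NVW; split; [exact: N'N|exact: V'V].
  by move=> [V [oV [N [oN Nx] NVW]] Vy]; apply/xsectionP; exact: NVW.
move=> nle.
have [V [oV [N Nx NVW]] rV] : exists2 V, D V & r%:E < mY V.
  apply: contrapT => nex; apply: nle; apply: tY => [|V [] //|V DV].
    split; first by exists set0; split; [exact: open0|exists setT;
      [split; [exact: openT|]|by move=> [a b] []]].
    move=> U V [oU [N [oN Nx] NU]] [oV [M [oM Mx] MV]]; exists (U `|` V) => //.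
    split; first exact: openU.
    exists (N `&` M); first by split; [exact: openI|].
    by move=> [a b]/= [[Na Ma] [Ub|Vb]]; [exact: NU|exact: MV].
  by rewrite leNgt; apply/negP => rV; apply: nex; exists V.
apply: (filterS _ (open_nbhs_nbhs Nx)) => x Nx'/=.
apply: lt_le_trans rV _; apply: le_measure; rewrite ?inE.
- exact: open_borel.
- by apply: open_borel; exact: open_xsection.
- by move=> y Vy; apply/xsectionP; exact: NVW.
Qed.

(** Dynkin induction from the open sets, where the slice measure is lower semicontinuous.
    Complements require a subtraction, so it runs inside one [D n] of finite measure; the limit in
    [n] comes last. *)
Lemma measurable_slice_measure (X Y : ptopologicalType)
    (mY : {measure set (borel Y) -> \bar R}) (E : set (X * Y)) :
  tau_sigma_finite mY -> measurable (E : set (borel (X * Y)%type)) ->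
  measurable_fun setT (fun x : borel X => mY (xsection E x)).
Proof.
move=> [tY [D [oD ndD UD Dfin]]] mE.
have mD n : measurable (D n : set (borel Y)) by exact: open_borel.
have key n : measurable_fun setT (fun x : borel X => mY (xsection E x `&` D n)).
  move: E mE.
  apply: (@dynkin_induction _ (borel (X * Y)%type) (@open (X * Y)%type)
    [set E | measurable_fun setT (fun x : borel X => mY (xsection E x `&` D n))]) => //=.
  - exact: openI.
  - rewrite (_ : (fun _ => _) = cst (mY (D n)))//; apply/funext => x/=.
    by rewrite xsectionE preimage_setT setTI.
  - move=> W oW; apply: measurable_lsc.
    rewrite (_ : (fun _ => _) = (fun x => mY (xsection (W `&` (setT `*` D n)) x))).
      by apply: lsc_xsection => //; apply: openI => //; apply: open_setX => //; exact: openT.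
    apply/funext => x; congr (mY _); apply/seteqP; split => y.
      by move=> [/xsectionP Wy Dy]; apply/xsectionP.
    by move=> /xsectionP[Wy [_ Dy]]; split => //; apply/xsectionP.
  - move=> S mS mS'.
    rewrite (_ : (fun _ => _) = (fun x => mY (D n) - mY (xsection S x `&` D n))).
      by apply: emeasurable_funB => //; exact: measurable_cst.
    apply/funext => x; rewrite setIC [in RHS]setIC -measureD//; last 2 first.
      exact: measurable_xsection_borel.
      exact: Dfin.
    congr (mY _); apply/seteqP; split => y.
      by move=> [Dy /xsectionP Sy]; split => // /xsectionP.
    by move=> [Dy Sy]; split => //; apply/xsectionP => /xsectionP.
  - move=> F mF tF IH.
    rewrite (_ : (fun _ => _) = (fun x => \sum_(k <oo) mY (xsection (F k) x `&` D n))).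
      by apply: ge0_emeasurable_sum => // k x _ _; exact: measure_ge0.
    apply/funext => x; rewrite xsection_bigcup setI_bigcupl measure_semi_bigcup//.
    + move=> k; apply: measurableI => //; exact: measurable_xsection_borel.
    + by apply: trivIset_setIr; exact: trivIset_xsection.
    + apply: bigcupT_measurable => k; apply: measurableI => //.
      exact: measurable_xsection_borel.
apply: (@emeasurable_fun_cvg _ (borel X) R setT
  (fun n x => mY (xsection E x `&` D n))) => // x _.
have -> : xsection E x = \bigcup_n (xsection E x `&` D n).
  by rewrite -setI_bigcupr UD setIT.
rewrite [X in X @ _ --> _](_ : _ = mY \o (fun n => xsection E x `&` D n)); last first.
  by apply/funext => n /=; rewrite -setI_bigcupr UD setIT.
apply: nondecreasing_cvg_mu.
- by move=> n; apply: measurableI => //; exact: measurable_xsection_borel.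
- by apply: bigcupT_measurable => n; apply: measurableI => //; exact: measurable_xsection_borel.
- by move=> n k nk; apply/subsetPset; apply: setIS; apply/subsetPset; exact: ndD.
Qed.

End product_measure.

(** * Measures defined by slices, and exchange of iterated integrals *)

Section iterated_integrals.
Context (R : realType).
Local Open Scope ereal_scope.

Lemma pushforward_measure_exists d1 d2 (T1 : measurableType d1)
    (T2 : measurableType d2) (mu : {measure set T1 -> \bar R}) (f : T1 -> T2) :
  measurable_fun setT f ->
  exists nu : {measure set T2 -> \bar R},
    (forall A, nu A = mu (f @^-1` A)) /\
    forall F, measurable_fun setT F -> (forall x, 0 <= F x) ->
      \int[nu]_x F x = \int[mu]_x F (f x).
Proof.
move=> mf.
exists (measure_function_pushforward__canonical__measure_function_Measure mu mf).
split=> // F mF F0.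
by rewrite (ge0_integral_pushforward mf)//= preimage_setT.
Qed.

Lemma int_indic_xsection (X Y : ptopologicalType)
    (mY : {measure set (borel Y) -> \bar R}) (E : set (X * Y)) x :
  measurable (E : set (borel (X * Y)%type)) ->
  \int[mY]_y (\1_E (x, y))%:E = mY (xsection E x).
Proof.
move=> mE; rewrite -(setIT (xsection E x)) -integral_indic//;
  last exact: measurable_xsection_borel.
by apply: eq_integral => y _; rewrite !indicE mem_xsection.
Qed.

Lemma measurable_pairl (X Y : ptopologicalType) d (T : measurableType d)
    (F : X * Y -> T) x :
  measurable_fun setT (F : borel (X * Y)%type -> T) ->
  measurable_fun setT (fun y : borel Y => F (x, y)).
Proof.
by move=> mF; apply: (@measurable_borel_comp _ Y _ _ F (pair x) mF); exact: continuous_pairl.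
Qed.

Lemma measurable_pairr (X Y : ptopologicalType) d (T : measurableType d)
    (F : X * Y -> T) y :
  measurable_fun setT (F : borel (X * Y)%type -> T) ->
  measurable_fun setT (fun x : borel X => F (x, y)).
Proof.
by move=> mF; apply: (@measurable_borel_comp _ X _ _ F (pair^~ y) mF); exact: continuous_pairr.
Qed.

Lemma measurable_slice_integral (X Y : ptopologicalType)
    (mY : {measure set (borel Y) -> \bar R}) (F : X * Y -> \bar R) :
  tau_sigma_finite mY ->
  measurable_fun setT (F : borel (X * Y)%type -> \bar R) -> (forall z, 0 <= F z) ->
  measurable_fun setT (fun x : borel X => \int[mY]_y F (x, y)).
Proof.
move=> rY; move: F.
apply: (@ge0_measurable_ind _ (borel (X * Y)%type) R (fun F =>
  measurable_fun setT (fun x : borel X => \int[mY]_y F (x, y)))).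
- move=> E mE.
  under eq_fun do rewrite int_indic_xsection//.
  exact: measurable_slice_measure.
- move=> c f c0 mf f0 mif.
  rewrite (_ : (fun _ => _) = (fun x => c%:E * \int[mY]_y f (x, y))).
    exact: measurable_funeM.
  apply/funext => x; rewrite ge0_integralZl//; exact: measurable_pairl.
- move=> f g mf f0 mif mg g0 mig.
  rewrite (_ : (fun _ => _) = (fun x => \int[mY]_y f (x, y) + \int[mY]_y g (x, y))).
    exact: emeasurable_funD.
  by apply/funext => x; rewrite ge0_integralD//; exact: measurable_pairl.
- move=> f mf f0 ndf mif.
  apply: (@emeasurable_fun_cvg _ (borel X) R setT (fun n x => \int[mY]_y f n (x, y))) => // x _.
  apply: (@cvg_monotone_convergence _ _ _ mY setT measurableT (fun n y => f n (x, y))).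
  + by move=> n; exact: measurable_pairl.
  + by move=> n y _.
  + by move=> y _ n k nk; exact: ndf.
Qed.

(** This builds [w dx dy] on all Borel sets of the product space. Countable additivity comes from
    integrating a series of nonnegative functions, and the integral formula spreads from indicators
    by [ge0_measurable_ind]. *)
Lemma slice_measure_exists (X Y : ptopologicalType)
    (mX : {measure set (borel X) -> \bar R})
    (mY : {measure set (borel Y) -> \bar R}) (w : X -> R) :
  tau_sigma_finite mY -> measurable_fun setT (w : borel X -> R) ->
  (forall x, 0 <= w x)%R ->
  exists nu : {measure set (borel (X * Y)%type) -> \bar R},
    (forall E, measurable E ->
      nu E = \int[mX]_x ((w x)%:E * mY (xsection E x))) /\
    forall F, measurable_fun setT F -> (forall z, 0 <= F z) ->
      \int[nu]_z F z = \int[mX]_x ((w x)%:E * \int[mY]_y F (x, y)).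
Proof.
move=> rY mw w0.
pose nu (E : set (borel (X * Y)%type)) := \int[mX]_x ((w x)%:E * mY (xsection E x)).
have nu0 : nu set0 = 0.
  by apply: integral0_eq => x _; rewrite xsection0 measure0 mule0.
have nu_ge0 E : 0 <= nu E.
  by apply: integral_ge0 => x _; rewrite mule_ge0// lee_fin.
have mwE : measurable_fun setT (fun x : borel X => (w x)%:E) by exact/measurable_EFinP.
have nu_sigma : semi_sigma_additive nu.
  move=> F mF tF mUF.
  rewrite [X in _ --> X](_ : _ = \sum_(n <oo) nu (F n)).
    have : cvgn (fun n => \sum_(0 <= i < n) nu (F i)).
      by apply: is_cvg_nneseries => n _ _; exact: nu_ge0.
    by [].
  rewrite /nu -integral_nneseries//.
  - apply: eq_integral => x _; rewrite nneseriesZl//.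
    congr (_ * _); rewrite xsection_bigcup measure_semi_bigcup//.
    + by move=> n; exact: measurable_xsection_borel.
    + exact: trivIset_xsection.
    + apply: bigcupT_measurable => n; exact: measurable_xsection_borel.
  - move=> n; apply: emeasurable_funM => //; exact: measurable_slice_measure.
  - by move=> n x _; rewrite mule_ge0// lee_fin.
pose nuM : {measure set (borel (X * Y)%type) -> \bar R} :=
  HB.pack nu (isMeasure.Build _ _ _ nu nu0 nu_ge0 nu_sigma).
exists nuM; split=> //.
apply: ge0_measurable_ind.
- move=> E mE; rewrite integral_indic// setIT.
  by apply: eq_integral => x _; rewrite int_indic_xsection.
- move=> c f c0 mf f0 IH; rewrite ge0_integralZl// IH -ge0_integralZl//.
  + apply: eq_integral => x _; rewrite ge0_integralZl//; last exact: measurable_pairl.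
    by rewrite muleCA.
  + by apply: emeasurable_funM => //; exact: measurable_slice_integral.
  + by move=> x _; rewrite mule_ge0 ?lee_fin// integral_ge0.
- move=> f g mf f0 IHf mg g0 IHg; rewrite ge0_integralD// IHf IHg -ge0_integralD//.
  + apply: eq_integral => x _.
    have mfx := measurable_pairl x mf; have mgx := measurable_pairl x mg.
    by rewrite ge0_integralD//; apply/esym/ge0_muleDr; apply: integral_ge0.
  + by move=> x _; rewrite mule_ge0 ?lee_fin// integral_ge0.
  + by apply: emeasurable_funM => //; exact: measurable_slice_integral.
  + by move=> x _; rewrite mule_ge0 ?lee_fin// integral_ge0.
  + by apply: emeasurable_funM => //; exact: measurable_slice_integral.
- move=> f mf f0 ndf IH; rewrite (@monotone_convergence _ _ _ nuM _ measurableT _ mf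
    (fun n z _ => f0 n z) (fun z _ => ndf z)).
  under eq_fun do rewrite IH.
  have ndi x : {homo (fun n => \int[mY]_y f n (x, y)) : n m / (n <= m)%N >-> n <= m}.
    move=> n k nk; apply: ge0_le_integral => //.
    + exact: measurable_pairl.
    + exact: measurable_pairl.
    + by move=> y _; exact: ndf.
  rewrite -monotone_convergence//; last 3 first.
  + by move=> n; apply: emeasurable_funM => //; exact: measurable_slice_integral.
  + by move=> n x _; rewrite mule_ge0 ?lee_fin// integral_ge0.
  + by move=> x _ n k nk; rewrite lee_wpmul2l ?lee_fin//; exact: ndi.
  apply: eq_integral => x _.
  rewrite limeMl//; last by apply: ereal_nondecreasing_is_cvgn; exact: ndi.
  congr (_ * _).
  apply: esym; apply: (@monotone_convergence _ _ _ mY _ measurableT (fun n y => f n (x, y))) => //.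
  by move=> n; exact: measurable_pairl.
Qed.

(** Tau-additivity of [mY] makes the slice measure of the union the pointwise supremum of those of
    the [U i]. These are lower semicontinuous and stay so after multiplication by [w], so
    [tau_additive_integral] applies in the variable [x]. *)
Lemma slice_measure_tau_additive (X Y : ptopologicalType)
    (mX : {measure set (borel X) -> \bar R})
    (mY : {measure set (borel Y) -> \bar R}) (w : X -> R)
    (I : Type) (D : set I) (U : I -> set (X * Y)) :
  tau_additive mX -> tau_additive mY -> continuous w -> (forall x, 0 <= w x)%R ->
  directed_family D U -> (forall i, D i -> open (U i)) ->
  forall c, (forall i, D i -> \int[mX]_x ((w x)%:E * mY (xsection (U i) x)) <= c) ->
  \int[mX]_x ((w x)%:E * mY (xsection (\bigcup_(i in D) U i) x)) <= c.
Proof.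
move=> tX tY cw w0 [D0 dir] oU c Uc.
apply: (@tau_additive_integral _ _ _ _ D
  (fun i x => (w x)%:E * mY (xsection (U i) x))) => //.
- move=> i j Di Dj; have [k Dk ijk] := dir _ _ Di Dj; exists k => // x.
  split; rewrite lee_wpmul2l ?lee_fin//; apply: le_measure; rewrite ?inE;
    try by [apply: open_borel; apply: open_xsection; exact: oU].
    by apply: le_xsection => z Uz; apply: ijk; left.
  by apply: le_xsection => z Uz; apply: ijk; right.
- move=> i Di; apply: lsc_nonneg_scale => //; apply: lsc_xsection => //; exact: oU.
- by move=> x; rewrite mule_ge0 ?lee_fin.
- move=> x r r0; split; last first.
    move=> [i Di]; move/lt_le_trans; apply.
    rewrite lee_wpmul2l ?lee_fin//; apply: le_measure; rewrite ?inE.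
    + by apply: open_borel; apply: open_xsection; exact: oU.
    + by apply: open_borel; apply: open_xsection; exact: bigcup_open.
    + by apply: le_xsection => z Uz; exists i.
  move=> /(gt_mule_approx r0 (w0 x) (measure_ge0 _ _)) [c' [c'0 c'lt rwc]].
  apply: contrapT => nex; move: c'lt; rewrite ltNge => /negP; apply.
  rewrite (_ : xsection _ x = \bigcup_(i in D) xsection (U i) x); last first.
    apply/seteqP; split => y; first by move=> /xsectionP[i Di Uy]; exists i => //; apply/xsectionP.
    by move=> [i Di /xsectionP Uy]; apply/xsectionP; exists i.
  apply: tY => [|i Di|i Di].
  + split=> // i j Di Dj; have [k Dk ijk] := dir _ _ Di Dj; exists k => // y.
    by move=> [|] /xsectionP Uy; apply/xsectionP; apply: ijk; [left|right].
  + by apply: open_xsection; exact: oU.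
  + rewrite leNgt; apply/negP => h; apply: nex; exists i => //.
    exact: lt_mule_lower h rwc.
Qed.

(** Repackages the measure for Fubini's theorem on the product of the two Borel sigma-algebras,
    where [iterated_measure_open_le] starts. *)
Lemma tau_sigma_finite_sigma_finite (X : ptopologicalType)
    (m : {measure set (borel X) -> \bar R}) :
  tau_sigma_finite m ->
  exists m' : {sigma_finite_measure set (borel X) -> \bar R},
    (m' : set (borel X) -> \bar R) = m.
Proof.
move=> [_ [D [oD ndD UD Dfin]]].
have sf : sigma_finite setT m.
  by exists D => [|n]; rewrite ?UD//; split; [exact: open_borel|exact: Dfin].
have sfin := sfinite_measure_sigma_finite sf.
pose m' : {sigma_finite_measure set (borel X) -> \bar R} :=
  HB.pack (Measure.sort m) (Measure.class m)
    (isSFinite.Build _ _ _ (Measure.sort m) sfin)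
    (isSigmaFinite.Build _ _ _ (Measure.sort m) sf).
by exists m'.
Qed.

Definition pair_swap (X Y : Type) (z : X * Y) : Y * X := (z.2, z.1).

Lemma continuous_pair_swap (X Y : topologicalType) :
  continuous (@pair_swap X Y).
Proof. by move=> z; apply: cvg_pair; [exact: cvg_snd|exact: cvg_fst]. Qed.

Lemma measurable_pair_swap (X Y : ptopologicalType) :
  measurable_fun setT
    (@pair_swap X Y : borel (X * Y)%type -> borel (Y * X)%type).
Proof. exact: (@continuous_borel (X * Y)%type (Y * X)%type _ (@continuous_pair_swap X Y)). Qed.

Lemma xsection_pair_swap (X Y : Type) (E : set (X * Y)) y :
  xsection (@pair_swap Y X @^-1` E) y = ysection E y.
Proof. by apply/seteqP; split => x /=; rewrite -[xsection _ _ _]/(is_true _)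
  -[ysection _ _ _]/(is_true _) !inE. Qed.

Lemma measurable_pair_swap_preimage (X Y : ptopologicalType) (E : set (X * Y)) :
  measurable (E : set (borel (X * Y)%type)) ->
  measurable ((@pair_swap Y X @^-1` E) : set (borel (Y * X)%type)).
Proof.
move=> mE; rewrite -[_ @^-1` _]setTI.
exact: (@measurable_pair_swap Y X measurableT _ mE).
Qed.

Lemma measurable_slice_measure_y (X Y : ptopologicalType)
    (mX : {measure set (borel X) -> \bar R}) (E : set (X * Y)) :
  tau_sigma_finite mX -> measurable (E : set (borel (X * Y)%type)) ->
  measurable_fun setT (fun y : borel Y => mX (ysection E y)).
Proof.
move=> rX mE; under eq_fun do rewrite -xsection_pair_swap.
by apply: measurable_slice_measure => //; exact: measurable_pair_swap_preimage.
Qed.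

(* The open subsets of [W] that are measurable for the product of the Borel
   sigma-algebras are directed with union [W]; Fubini's theorem applies to each
   of them, and tau-additivity passes to the union. *)
Lemma iterated_measure_open_le (X Y : ptopologicalType)
    (mX : {measure set (borel X) -> \bar R})
    (mY : {measure set (borel Y) -> \bar R}) (W : set (X * Y)) :
  tau_sigma_finite mX -> tau_sigma_finite mY -> open W ->
  \int[mX]_x mY (xsection W x) <= \int[mY]_y mX (ysection W y).
Proof.
move=> rX rY oW.
pose D := [set V : set (X * Y) | [/\ open V, V `<=` W &
  measurable (V : set (borel X * borel Y)%type)]].
have WD : W = \bigcup_(V in D) V.
  apply/seteqP; split => [[x y] Wxy|z [V [_ VW _] Vz]]; last exact: VW.
  move: oW; rewrite openE => /(_ _ Wxy)/= [[A B]] /= [].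
  rewrite !nbhsE => -[A' [oA' A'x] A'A] [B' [oB' B'y] B'B] ABW.
  exists (A' `*` B') => //; split; first exact: open_setX.
    by move=> [a b] [/= /A'A ? /B'B ?]; exact: ABW.
  by apply: measurableX; exact: open_borel.
have dirD : directed_family D id.
  split; first by exists set0; split => //; exact: open0.
  move=> U V [oU UW mU] [oV VW mV]; exists (U `|` V) => //; split.
  - exact: openU.
  - by rewrite subUset.
  - exact: measurableU.
have -> : \int[mX]_x mY (xsection W x) =
    \int[mX]_x ((1%R)%:E * mY (xsection (\bigcup_(V in D) V) x)).
  by rewrite -WD; apply: eq_integral => x _; rewrite mul1e.
apply: (slice_measure_tau_additive (w := fun=> 1%R)) => //.
- exact: rX.1.
- exact: rY.1.
- by move=> x; exact: cvg_cst.
- by move=> V [].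
- move=> V [oV VW mV].
  under eq_integral do rewrite mul1e.
  have [mX' mX'E] := tau_sigma_finite_sigma_finite rX.
  have [mY' mY'E] := tau_sigma_finite_sigma_finite rY.
  have := indic_fubini_tonelli mX' mY' mV.
  rewrite indic_fubini_tonelli_FE// indic_fubini_tonelli_GE//.
  rewrite mX'E mY'E => ->.
  apply: ge0_le_integral => //.
  + by apply: measurable_slice_measure_y => //; exact: open_borel.
  + by apply: measurable_slice_measure_y => //; exact: open_borel.
  + move=> y _; rewrite -!xsection_pair_swap.
    have mx (U : set (X * Y)) : open U ->
        measurable (xsection (@pair_swap Y X @^-1` U) y : set (borel X)).
      move=> oU; apply: (@measurable_xsection_borel Y X _ y).
      by apply: measurable_pair_swap_preimage; exact: open_borel.
    apply: le_measure; rewrite ?inE; [exact: mx|exact: mx|].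
    by move=> x /xsectionP Vx; apply/xsectionP; exact: VW.
Qed.

(** The two orders of integration define measures [nu1] and [nu3] on the Borel sets of the product.
    They agree on open sets, by [iterated_measure_open_le] used in both directions; open sets are
    closed under intersection and the open rectangles DX n x DY n of finite measure exhaust the
    space, so the measures coincide. *)
Lemma tonelli (X Y : ptopologicalType)
    (mX : {measure set (borel X) -> \bar R})
    (mY : {measure set (borel Y) -> \bar R}) (F : X * Y -> \bar R) :
  tau_sigma_finite mX -> tau_sigma_finite mY ->
  measurable_fun setT (F : borel (X * Y)%type -> \bar R) -> (forall z, 0 <= F z) ->
  \int[mX]_x \int[mY]_y F (x, y) = \int[mY]_y \int[mX]_x F (x, y).
Proof.
move=> rX rY mF F0.
have [nu1 [nu1E nu1F]] := @slice_measure_exists X Y mX mY (fun=> 1%R) rY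
  (@measurable_cst _ _ _ _ _ _) (fun=> ler01).
have [nu2 [nu2E nu2F]] := @slice_measure_exists Y X mY mX (fun=> 1%R) rX
  (@measurable_cst _ _ _ _ _ _) (fun=> ler01).
have [nu3 [nu3E nu3F]] := pushforward_measure_exists nu2 (@measurable_pair_swap Y X).
have [DX [oDX ndDX UDX DXfin]] := rX.2.
have [DY [oDY ndDY UDY DYfin]] := rY.2.
have nu13 E : measurable E -> nu1 E = nu3 E.
  apply: (@measure_unique _ R (borel (X * Y)%type) (@open (X * Y)%type)
    (fun n => DX n `*` DY n)) => //.
  - exact: openI.
  - by move=> n; exact: open_setX.
  - apply/seteqP; split => // -[x y] _.
    have [n _ DXx] : (\bigcup_n DX n) x by rewrite UDX.
    have [k _ DYy] : (\bigcup_n DY n) y by rewrite UDY.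
    exists (maxn n k) => //; split => /=.
      by move: DXx; apply/subsetPset; apply: ndDX; exact: leq_maxl.
    by move: DYy; apply/subsetPset; apply: ndDY; exact: leq_maxr.
  - move=> W oW; have mW := open_borel oW.
    rewrite nu1E// nu3E nu2E; last exact: measurable_pair_swap_preimage.
    under eq_integral do rewrite mul1e.
    under [RHS]eq_integral do rewrite mul1e xsection_pair_swap.
    apply/eqP; rewrite eq_le iterated_measure_open_le//=.
    have oW' : open (@pair_swap Y X @^-1` W).
      by have /continuousP := @continuous_pair_swap Y X; apply.
    have := iterated_measure_open_le rY rX oW'.
    by under eq_integral do rewrite xsection_pair_swap.
  - move=> n; rewrite nu1E; last by apply: open_borel; exact: open_setX.
    rewrite (_ : \int[mX]_x _ = \int[mX]_x (mY (DY n) * (\1_(DX n) x)%:E)).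
      rewrite ge0_integralZl//; last first.
        by apply/measurable_EFinP/measurable_indic; exact: open_borel.
      rewrite integral_indic//; last exact: open_borel.
      by rewrite setIT lte_mul_pinfty// ge0_fin_numE.
    apply: eq_integral => x _; rewrite mul1e indicE.
    case: (boolP (x \in DX n)) => xD.
      by rewrite in_xsectionX// mule1.
    by rewrite notin_xsectionX// measure0 mule0.
transitivity (\int[nu1]_z F z).
  by rewrite nu1F//; apply: eq_integral => x _; rewrite mul1e.
rewrite (eq_measure_integral nu3); last by move=> A mA _; exact: nu13.
rewrite nu3F// nu2F//;
  last exact: (measurable_borel_comp (X := (X * Y)%type) (Y := (Y * X)%type) mF
  (@continuous_pair_swap Y X)).
by apply: eq_integral => x _; rewrite mul1e.
Qed.

End iterated_integrals.

(** * Locally compact groups and sigma-compact clopen subgroups *)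

Section locally_compact_spaces.
Context (R : realType) (T : topologicalType).
Hypotheses (hT : hausdorff_space T) (lcT : locally_compact [set: T]).

Lemma compact_nbhs (x : T) : exists2 A, nbhs x A & compact A /\ closed A.
Proof.
have [A Ax cA] := lcT (x := x) I.
exists A => //; move: Ax; rewrite /within /=.
by apply: (@filterS _ (nbhs x)) => y; exact.
Qed.

Lemma compact_nbhs_in (W : set T) (x : T) : open W -> W x ->
  exists V Q : set T, [/\ open V, V x, compact Q, V `<=` Q & Q `<=` W].
Proof.
move=> oW Wx; have [A Ax [cA clA]] := compact_nbhs x.
have Wn : nbhs x W by exact: open_nbhs_nbhs.
have creg : regular_space T.
  by apply: (@completely_regular_regular R); exact: locally_compact_completely_regular.
have [B Bx BW] := creg x W Wn.
exists (A `&` B)°, (A `&` closure B); split.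
- exact: open_interior.
- exact: filterI.
- have clAB : closed (A `&` closure B) by apply: closedI => //; exact: closed_closure.
  by apply: (subclosed_compact clAB cA) => y [].
- by move=> y /interior_subset[Ay By]; split => //; exact: subset_closure.
- by move=> y [_ /BW].
Qed.

(** These are test functions of [semidirect_haar]. The closed support is compact, but only the
    vanishing of [phi] off [U] is recorded, so the support may touch the boundary of [U]. *)
Definition bump_in (U : set T) (phi : T -> R) :=
  [/\ continuous phi, forall x, 0 <= phi x,
      compact (closure [set x | phi x != 0]) & forall x, ~ U x -> phi x = 0].

Lemma bump_at (U : set T) (x : T) : open U -> U x ->
  exists2 phi, bump_in U phi & phi x = 1.
Proof.
move=> oU Ux; have [V [Q [oV Vx cQ VQ QU]]] := compact_nbhs_in oU Ux.
have nx : ~ (~` V) x by [].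
have := @locally_compact_completely_regular T R lcT hT _ _ (open_closedC oV) nx.
move=> /(@uniform_separatorP _ R)[f [cf f01 f0 f1]].
have f1V y : ~ V y -> f y = 1 by move=> Vy; apply: f1; exists y.
exists (fun y => 1 - f y); last by rewrite (f0 (f x)) ?subr0//; exists x.
have suppV : [set y | 1 - f y != 0] `<=` V.
  by move=> y /= /eqP fy; apply: contrapT => /f1V fy1; apply: fy; rewrite fy1 subrr.
split.
- by move=> y; apply: cvgB; [exact: cvg_cst|exact: cf].
- move=> y; have : `[0, 1]%classic (f y) by apply: f01; exists y.
  by rewrite /= in_itv/= subr_ge0 => /andP[].
- apply: (@subclosed_compact _ _ Q) => //; first exact: closed_closure.
  have /closure_id -> : closed Q by exact: compact_closed.
  by apply: closure_subset => y /suppV /VQ.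
- by move=> y Uy; rewrite f1V ?subrr// => /VQ/QU.
Qed.

Lemma bumpD (U : set T) f g : bump_in U f -> bump_in U g ->
  bump_in U (fun x => f x + g x).
Proof.
move=> [cf f0 sf Uf] [cg g0 sg Ug]; split.
- by move=> x; apply: cvgD; [exact: cf|exact: cg].
- by move=> x; rewrite addr_ge0.
- apply: (@subclosed_compact _ _
    (closure [set x | f x != 0] `|` closure [set x | g x != 0])).
  + exact: closed_closure.
  + exact: compactU.
  + rewrite -closureU; apply: closure_subset => x /=.
    apply: contraPP => /not_orP[/negP] ; rewrite !negbK => /eqP -> /negP.
    by rewrite negbK => /eqP ->; rewrite addr0 eqxx.
- by move=> x Ux; rewrite Uf// Ug// addr0.
Qed.

(** Sums of bumps are bumps, so the sets where a bump exceeds 1/2 form a directed open family; it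
    covers [C] because some bump equals 1 at any given point of [U]. One bump thus exceeds 1/2 on
    all of [C], and doubling it and cutting at 1 finishes. *)
Lemma compact_bump (C U : set T) : compact C -> open U -> C `<=` U ->
  exists phi : T -> R, [/\ bump_in U phi, forall x, phi x <= 1
    & forall x, C x -> phi x = 1].
Proof.
move=> cC oU CU.
have [phi Uphi Cphi] : exists2 phi, bump_in U phi & C `<=` [set x | 1 / 2 < phi x].
  apply: (@compact_directed _ _ _ (bump_in U) (fun phi => [set x | 1 / 2 < phi x])) => //.
  - split.
      exists (fun=> 0); split => //; first by move=> x; exact: cvg_cst.
      rewrite (_ : [set _ | _] = set0) ?closure0; first exact: compact0.
      by apply/seteqP; split => // x /=; rewrite eqxx.
    move=> f g fU gU; exists (fun x => f x + g x); first exact: bumpD.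
    have [_ f0 _ _] := fU; have [_ g0 _ _] := gU.
    by move=> x /= [h|h]; apply: (lt_le_trans h); rewrite ?lerDl// lerDr.
  - move=> f [cf _ _ _].
    rewrite (_ : [set _ | _] = f @^-1` [set z | 1 / 2 < z])//.
    by move/continuousP : cf; apply; exact: open_gt.
  - move=> x /CU Ux; have [phi phiU phix] := bump_at oU Ux.
    by exists phi => //=; rewrite phix ltr_pdivrMr// mul1r ltr1n.
have [cphi phi0 sphi phiU0] := Uphi.
exists (fun x => Num.min 1 (2 * phi x)); split.
- split.
  + move=> x; apply: (@continuous_min R T (fun=> 1) (fun x => 2 * phi x) x).
      exact: cvg_cst.
    by apply: cvgMr; exact: cphi.
  + by move=> x; rewrite le_min ler01 mulr_ge0.
  + apply: (subclosed_compact _ sphi); first exact: closed_closure.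
    apply: closure_subset => x /=; apply: contra_neq => ->.
    by rewrite mulr0 min_r.
  + by move=> x /phiU0 ->; rewrite mulr0 min_r.
- by move=> x; rewrite ge_min lexx.
- move=> x /Cphi /= h; apply: min_l.
  by rewrite -ler_pdivrMl// mulrC ltW// -[2^-1]mul1r.
Qed.

End locally_compact_spaces.

Section locally_compact_groups.
Context (L : lcGroupType).

Lemma continuous_mulgl (a : L) : continuous (fun x => (a * x)%g).
Proof.
move=> x; apply: (continuous_comp (f := fun x => (a, x)) (g := fun p : L * L => (p.1 * p.2)%g)).
  exact: continuous_pairl.
exact: lcg_mul_continuous.
Qed.

Lemma open_mulgl (a : L) (U : set L) : open U -> open [set (a * x)%g | x in U].
Proof.
move=> oU; rewrite (_ : [set _ | _ in _] = (fun x => (a^-1 * x)%g) @^-1` U).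
  by have /continuousP := @continuous_mulgl a^-1%g; apply.
apply/seteqP; split => x /=; first by move=> [y Uy <-]; rewrite mulKg.
by move=> Ux; exists (a^-1 * x)%g => //; rewrite mulVKg.
Qed.

Definition setmul (A B : set L) : set L := [set (p.1 * p.2)%g | p in A `*` B].
Definition setdiv (A B : set L) : set L := [set (p.1^-1 * p.2)%g | p in A `*` B].

Lemma continuous_div : continuous (fun p : L * L => (p.1^-1 * p.2)%g).
Proof.
move=> p; apply: (continuous_comp (f := fun p : L * L => ((p.1)^-1%g, p.2))
  (g := fun p : L * L => (p.1 * p.2)%g)).
  apply: cvg_pair; last exact: cvg_snd.
  by apply: (continuous_comp (f := fst) (g := fun x : L => x^-1%g));
    [exact: cvg_fst|exact: lcg_inv_continuous].
exact: lcg_mul_continuous.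
Qed.

Lemma compact_setmul A B : compact A -> compact B -> compact (setmul A B).
Proof.
move=> cA cB; apply: continuous_compact; last exact: compact_setX.
by apply: continuous_subspaceT; exact: lcg_mul_continuous.
Qed.

Lemma compact_setdiv A B : compact A -> compact B -> compact (setdiv A B).
Proof.
move=> cA cB; apply: continuous_compact; last exact: compact_setX.
by apply: continuous_subspaceT; exact: continuous_div.
Qed.

Lemma open_setmul A B : open B -> open (setmul A B).
Proof.
move=> oB; rewrite (_ : setmul A B = \bigcup_(a in A) [set (a * x)%g | x in B]).
  by apply: bigcup_open => a _; exact: open_mulgl.
apply/seteqP; split => x; first by move=> [[a b] [/= Aa Bb] <-]; exists a => //; exists b.
by move=> [a Aa [b Bb <-]]; exists (a, b).
Qed.

Lemma open_setdiv A B : open B -> open (setdiv A B).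
Proof.
move=> oB; rewrite (_ : setdiv A B = \bigcup_(a in A) [set (a^-1 * x)%g | x in B]).
  by apply: bigcup_open => a _; exact: open_mulgl.
apply/seteqP; split => x; first by move=> [[a b] [/= Aa Bb] <-]; exists a => //; exists b.
by move=> [a Aa [b Bb <-]]; exists (a, b).
Qed.

Lemma lcg_compact_nbhs (x : L) : exists2 A, nbhs x A & compact A /\ closed A.
Proof. by apply: compact_nbhs; exact: lcg_locally_compact. Qed.

Lemma compact_open_hull (P : set L) : compact P ->
  exists A Q : set L, [/\ open A, compact Q, P `<=` A & A `<=` Q].
Proof.
move=> cP; have [V V1 [cV clV]] := lcg_compact_nbhs 1%g.
exists (setmul P V°), (setmul P V); split.
- by apply: open_setmul; exact: open_interior.
- exact: compact_setmul.
- by move=> x Px; exists (x, 1%g) => /=; rewrite ?mulg1//; split => //; exact: nbhs_singleton.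
- by move=> _ [[a b] [/= Pa /interior_subset Vb] <-]; exists (a, b).
Qed.

(** For [x] in the closure, the neighbourhood x V meets [C] at some x v, and x is then the product
    of x v and v^-1. *)
Lemma closure_setmul (C V : set L) : nbhs 1%g V ->
  closure C `<=` setmul C [set x^-1%g | x in V].
Proof.
move=> V1 x Cx.
have : nbhs x [set (x * v)%g | v in V].
  rewrite (_ : [set _ | _ in _] = (fun y => (x^-1 * y)%g) @^-1` V); last first.
    apply/seteqP; split => y /=; first by move=> [z Vz <-]; rewrite mulKg.
    by move=> Vy; exists (x^-1 * y)%g => //; rewrite mulVKg.
  by apply: (continuous_mulgl (a := x^-1%g)); rewrite mulVg.
move=> /Cx[y [Cy [v Vv xvy]]].
rewrite -xvy in Cy.
by exists ((x * v)%g, v^-1%g); rewrite /= ?mulgK//; split => //; exists v.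
Qed.

Lemma compact_inv (V : set L) : compact V -> compact [set x^-1%g | x in V].
Proof.
move=> cV; apply: continuous_compact => //; apply: continuous_subspaceT.
exact: lcg_inv_continuous.
Qed.

(** The open sets [D n] supply the exhaustion and the compact sets [Q n] above them make its
    measures finite. [es_div] is the subgroup condition written with one operation. *)
Record exhausted_subgroup (O : set L) (D Q : nat -> set L) : Prop := {
  es_div : forall a b, O a -> O b -> O (a^-1 * b)%g;
  es_clopen : clopen O;
  es_open : forall n, open (D n);
  es_nd : nondecreasing_seq D;
  es_cover : \bigcup_n D n = O;
  es_compact : forall n, compact (Q n);
  es_sub : forall n, D n `<=` Q n
}.

(** Stage n+1 consists of all a^-1 b with a and b in stage n enlarged by an open hull of [P n]. The
    identity lies in every stage, so stages increase, and quotients of elements of the union fall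
    into a later stage. The same recursion on compact hulls gives [Q]. *)
Lemma exhausted_subgroup_exists (P : nat -> set L) : (forall n, compact (P n)) ->
  exists O D Q, exhausted_subgroup O D Q /\ forall n, P n `<=` O.
Proof.
move=> cP.
(* Compactness is a premise inside the chosen type, so the choice exists for every set and can enter
   a recursion. *)
have hull (P' : set L) : {AQ : set L * set L | compact P' ->
    [/\ open AQ.1, compact AQ.2, P' `<=` AQ.1 & AQ.1 `<=` AQ.2]}.
  apply: cid; have [cP'|ncP'] := pselect (compact P').
    by have [A [Q h]] := compact_open_hull cP'; exists (A, Q).
  by exists (set0, set0).
pose step n (DQ : set L * set L) : set L * set L :=
  let AQ := sval (hull (P n)) in
  let D' := DQ.1 `|` AQ.1 in let Q' := DQ.2 `|` AQ.2 in
  (setdiv D' D', setdiv Q' Q').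
have [A0 [Q0 [oA0 cQ0 A01 AQ0]]] := compact_open_hull (@compact_set1 L 1%g).
pose DQ := fix DQ n := if n is n'.+1 then step n' (DQ n') else (A0, Q0).
pose D n := (DQ n).1; pose Q n := (DQ n).2.
have hullP n := svalP (hull (P n)) (cP n).
have DS n : D n.+1 = setdiv (D n `|` (sval (hull (P n))).1) (D n `|` (sval (hull (P n))).1) by [].
have QS n : Q n.+1 = setdiv (Q n `|` (sval (hull (P n))).2) (Q n `|` (sval (hull (P n))).2) by [].
have oD n : open (D n).
  elim: n => [//|n IH]; rewrite DS; apply: open_setdiv; apply: openU => //.
  by have [] := hullP n.
have cQ n : compact (Q n).
  elim: n => [//|n IH]; rewrite QS; apply: compact_setdiv; apply: compactU => //;
  by have [] := hullP n.
have DsubQ n : D n `<=` Q n.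
  elim: n => [//|n IH]; rewrite DS QS => _ [[a b] [/= Da Db] <-].
  have [_ _ _ sub] := hullP n.
  exists (a, b) => //; split.
    by case: Da => [/IH|/sub]; [left|right].
  by case: Db => [/IH|/sub]; [left|right].
have D1 n : D n 1%g.
  elim: n => [|n IH]; first exact: A01.
  by rewrite DS; exists (1%g, 1%g); rewrite /= ?invg1 ?mulg1//; split; left.
have DSub n : D n `<=` D n.+1.
  by move=> x Dx; rewrite DS; exists (1%g, x); rewrite /= ?invg1 ?mul1g//; split; left.
have ndD : nondecreasing_seq D.
  by apply/nondecreasing_seqP => n; apply/subsetPset.
pose O := \bigcup_n D n.
have Odiv a b : O a -> O b -> O (a^-1 * b)%g.
  move=> [n _ Da] [k _ Db]; exists (maxn n k).+1 => //; rewrite DS.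
  exists (a, b) => //; split; left.
    by move: Da; apply/subsetPset; apply: ndD; exact: leq_maxl.
  by move: Db; apply/subsetPset; apply: ndD; exact: leq_maxr.
have oO : open O by apply: bigcup_open.
have O1 : O 1%g by exists 0%N.
have OV a : O a -> O a^-1%g by move=> Oa; rewrite -[_^-1%g]mulg1; exact: Odiv.
have OM a b : O a -> O b -> O (a * b)%g.
  by move=> Oa Ob; rewrite -[a]invgK; apply: Odiv => //; exact: OV.
exists O, D, Q; split.
  split=> //; split=> //.
  (* An open subgroup is closed: a point [x] outside it has the whole open coset x O outside. *)
  rewrite -(setCK O); apply: open_closedC.
  rewrite openE => x Ox.
  have : open_nbhs x [set (x * d)%g | d in O].
    by split; [exact: open_mulgl|exists 1%g; rewrite ?mulg1].
  move/open_nbhs_nbhs; apply: filterS => _ [d Od <-] Oxd; apply: Ox.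
  by rewrite -(mulgK d x); apply: OM => //; exact: OV.
move=> n x Px; exists n.+1 => //; rewrite DS.
exists (1%g, x); rewrite /= ?invg1 ?mul1g//; split; first by left.
by right; have [_ _ sub _] := hullP n; exact: sub.
Qed.

End locally_compact_groups.

(** * Haar measures *)

Section haar_measures.
Context (R : realType).
Local Open Scope ereal_scope.

Lemma integral_mrestr d (T : measurableType d) (mu : {measure set T -> \bar R})
    (O : set T) (mO : measurable O) (F : T -> \bar R) :
  (forall x, ~ O x -> F x = 0) -> \int[mrestr mu mO]_x F x = \int[mu]_x F x.
Proof.
move=> F0.
have FO : F = F \_ O.
  apply/funext => x; rewrite patchE; case: (boolP (x \in O)) => // /negP xO.
  by rewrite F0// => Ox; apply: xO; rewrite inE.
rewrite FO -!integral_mkcond; apply: eq_measure_integral => A mA AO.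
by rewrite /= /mrestr setIidl.
Qed.

Lemma ae_imp d (T : measurableType d) (mu : {measure set T -> \bar R})
    (P Q : T -> Prop) : (forall x, P x -> Q x) ->
  {ae mu, forall x, P x} -> {ae mu, forall x, Q x}.
Proof. by move=> PQ; apply: filterS. Qed.

Lemma ae_imp2 d (T : measurableType d) (mu : {measure set T -> \bar R})
    (P Q S : T -> Prop) : (forall x, P x -> Q x -> S x) ->
  {ae mu, forall x, P x} -> {ae mu, forall x, Q x} -> {ae mu, forall x, S x}.
Proof. by move=> PQS; apply: filterS2. Qed.

Lemma ae_mrestr d (T : measurableType d) (mu : {measure set T -> \bar R})
    (O : set T) (mO : measurable O) (P : T -> Prop) :
  (forall x, ~ O x -> P x) ->
  {ae mrestr mu mO, forall x, P x} <-> {ae mu, forall x, P x}.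
Proof.
move=> nOP; split=> [] [A [mA A0 AP]].
  exists (A `&` O); split => //; first exact: measurableI.
  move=> x /= nPx; split; first exact: AP.
  by apply: contrapT => /nOP.
exists A; split => //; apply/eqP; rewrite eq_le measure_ge0 andbT.
rewrite -A0 /= /mrestr; apply: le_measure; rewrite ?inE//.
exact: measurableI.
Qed.

Lemma ae_in_mrestr d (T : measurableType d) (mu : {measure set T -> \bar R})
    (O : set T) (mO : measurable O) (P : T -> Prop) :
  (forall x, O x -> P x) -> {ae mrestr mu mO, forall x, P x}.
Proof.
move=> OP; exists (~` O); split; first exact: measurableC.
  by rewrite /= /mrestr setICl measure0.
by move=> x /= nPx Ox; apply/nPx/OP.
Qed.

Section one_group.
Variables (L : lcGroupType) (mu : {measure set (borel L) -> \bar R}).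
Hypothesis haar : left_haar mu.

Lemma haar_tau_additive : tau_additive mu.
Proof.
have [[_ _ ir] _ _] := haar.
by apply: inner_regular_tau_additive => //; exact: lcg_hausdorff.
Qed.

(** Translates of a nonempty null open set would cover the group. Null open sets are directed, so
    every compact set would lie in one of them, and inner regularity would make the whole group
    null. *)
Lemma haar_open_pos (U : set L) : open U -> mu U = 0 -> U = set0.
Proof.
move=> oU U0; apply/seteqP; split => // u Uu; exfalso.
have [[_ _ ir] /negP + inv] := haar; apply.
rewrite eq_le measure_ge0 andbT ir; last exact: openT.
apply: ge_ereal_sup => _ [C [cC _] <-].
pose D := [set V : set L | open V /\ mu V = 0].
have [|||V [oV V0] CV] := @compact_directed L C _ D id cC.
- split; first by exists set0; split; [exact: open0|exact: measure0].
  move=> V W [oV V0] [oW W0]; exists (V `|` W) => //; split; first exact: openU.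
  apply/eqP; rewrite eq_le measure_ge0 andbT.
  apply: le_trans (measureU2 _ _ _) _; [exact: open_borel|exact: open_borel|].
  by rewrite [X in X + _]V0 [X in _ + X]W0 adde0.
- by move=> V [].
- move=> x Cx; exists [set ((x * u^-1) * y)%g | y in U]; last first.
    by exists u => //; rewrite -mulgA mulVg mulg1.
  split; first exact: open_mulgl.
  by rewrite inv//; exact: open_borel.
- rewrite -V0; apply: le_measure; rewrite ?inE//.
    by apply: closed_borel; apply: compact_closed => //; exact: lcg_hausdorff.
  exact: open_borel.
Qed.

(** Compact subsets [C n] of [U] exhaust its measure up to 1/(n+1). The part of [U] outside the
    closure of their union is open and null, hence empty. That closure need not be sigma-compact,
    but [closure_setmul] puts it inside the union of the compact sets C n V^-1. *)
Lemma haar_finite_open (U : set L) : open U -> mu U < +oo ->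
  exists2 C : nat -> set L, (forall n, compact (C n)) & U `<=` \bigcup_n C n.
Proof.
move=> oU Ufin; have [[_ _ ir] _ _] := haar.
have mU := open_borel oU.
have Uf : mu U \is a fin_num by rewrite ge0_fin_numE.
have /choice[C CP] n : exists C : set L,
    [/\ compact C, C `<=` U & mu U - (n.+1%:R^-1)%:E < mu C].
  have [||_ [C [cC CU] <-] h] := @ub_ereal_sup_adherent R
      [set mu C | C in [set C : set L | compact C /\ C `<=` U]] n.+1%:R^-1.
  - by rewrite invr_gt0.
  - by rewrite -ir.
  - by exists C; split => //; rewrite ir.
have mC n : measurable (C n : set (borel L)).
  apply: closed_borel; apply: compact_closed; first exact: lcg_hausdorff.
  by have [] := CP n.
pose W := U `\` closure (\bigcup_n C n).
have oW : open W by apply: openI => //; apply: closed_openC; exact: closed_closure.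
have W0 : W = set0.
  apply: haar_open_pos => //; apply/eqP; rewrite eq_le measure_ge0 andbT.
  apply/lee_addgt0Pr => e e0; rewrite add0e.
  pose n := Num.bound e^-1.
  have ne : (n.+1%:R^-1 <= e)%R.
    rewrite invf_ple ?posrE//; apply: ltW; apply: (lt_trans (archi_boundP _)).
      by rewrite invr_ge0 ltW.
    by rewrite ltr_nat.
  apply: (@le_trans _ _ (n.+1%:R^-1)%:E); last by rewrite lee_fin.
  have [cCn CnU lt] := CP n.
  apply: (@le_trans _ _ (mu (U `\` C n))).
    apply: le_measure; rewrite ?inE//; first exact: open_borel.
      exact: measurableD.
    by move=> x [Ux nx]; split => // Cx; apply: nx; apply: subset_closure; exists n.
  rewrite measureD// (setIidr CnU).
  have Cf : mu (C n) \is a fin_num.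
    rewrite ge0_fin_numE//; apply: le_lt_trans Ufin.
    by apply: le_measure; rewrite ?inE.
  by rewrite leeBlDr// addeC -leeBlDr// ltW.
have [V V1 [cV clV]] := lcg_compact_nbhs (1%g : L).
exists (fun n => setmul (C n) [set x^-1%g | x in V]).
  move=> n; apply: compact_setmul; first by have [] := CP n.
  exact: compact_inv.
move=> x Ux.
have : closure (\bigcup_n C n) x.
  by apply: contrapT => ncx; rewrite -[False]/(set0 x) -W0.
move=> /(closure_setmul V1)[[a b] [/= [n _ Ca] Vb] <-].
by exists n => //; exists (a, b).
Qed.

(** Each level set of [f] at height 1/(n+1) has finite measure, hence by outer regularity lies in an
    open set of finite measure, to which [haar_finite_open] applies. Pairs of indices are then coded
    by one integer. *)
Lemma haar_integrable_support (f : L -> \bar R) :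
  measurable_fun setT (f : borel L -> \bar R) -> (forall x, 0 <= f x) ->
  \int[mu]_x f x < +oo ->
  exists2 C : nat -> set L, (forall n, compact (C n)) &
    forall x, f x != 0 -> (\bigcup_n C n) x.
Proof.
move=> mf f0 fi; have [[_ outer _] _ _] := haar.
have /choice[C CP] n : exists C : nat -> set L, (forall k, compact (C k)) /\
    [set x | (n.+1%:R^-1)%:E <= f x] `<=` \bigcup_k C k.
  pose E := [set x | (n.+1%:R^-1)%:E <= f x].
  have mE : measurable (E : set (borel L)).
    rewrite /E -[X in measurable X]setTI.
    by apply: emeasurable_fun_c_infty.
  have : mu E < +oo.
    have h : (n.+1%:R^-1)%:E * mu E <= \int[mu]_x f x.
      rewrite -{1}(setIT E) -integral_indic// -ge0_integralZl//; last first.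
        exact/measurable_EFinP/measurable_indic.
      apply: ge0_le_integral => //.
      - by apply: measurable_funeM; exact/measurable_EFinP/measurable_indic.
      - move=> x _; rewrite indicE; case: (boolP (x \in E)); rewrite ?inE => xE.
          by rewrite mule1.
        by rewrite mule0.
    have := le_lt_trans h fi.
    by rewrite -lte_pdivlMl ?invr_gt0// invrK gt0_muley// lte_fin.
  rewrite outer// => /ereal_inf_lt[_ [U [oU EU] <-] Ufin].
  have [C cC UC] := haar_finite_open oU Ufin.
  by exists C; split => //; exact: subset_trans UC.
pose P k := if choice.unpickle k is Some (i, j) then C i j else set0.
exists P => [k|x fx].
  rewrite /P; case: choice.unpickle => [[i j]|]; last exact: compact0.
  by have [] := CP i.
have fx0 : 0 < f x by rewrite lt_neqAle eq_sym fx f0.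
have [n nf] : exists n, (n.+1%:R^-1)%:E <= f x.
  case: (f x) fx0 => [r| |//]; last by exists 0%N; rewrite leey.
  rewrite lte_fin => r0; exists (Num.bound r^-1).
  rewrite lee_fin invf_ple ?posrE//; apply: ltW; apply: (lt_trans (archi_boundP _)).
    by rewrite invr_ge0 ltW.
  by rewrite ltr_nat.
have [_ /(_ x nf)[k _ Ck]] := CP n.
by exists (choice.pickle (n, k)) => //; rewrite /P choice.pickleK.
Qed.

Section restriction.
Variables (O : set L) (D Q : nat -> set L).
Hypothesis OD : exhausted_subgroup O D Q.
Variable mO : measurable (O : set (borel L)).
Let m : {measure set (borel L) -> \bar R} := mrestr mu mO.

(** The restricted measure does not see the complement of [O]. Adding this open set to [D n] costs
    nothing and lets the exhaustion cover the whole group. *)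
Lemma haar_mrestr_finite n : m (D n `|` ~` O) < +oo.
Proof.
have [[cfin _ _] _ _] := haar.
apply: (@le_lt_trans _ _ (mu (Q n))); last by apply: cfin; exact: es_compact OD n.
have oO : open (~` O) by apply: closed_openC; exact: (es_clopen OD).2.
rewrite /= /mrestr; apply: le_measure; rewrite ?inE.
- apply: measurableI => //; apply: open_borel; apply: openU => //; exact: es_open OD n.
- by apply: closed_borel; apply: compact_closed; [exact: lcg_hausdorff|exact: es_compact OD n].
- by move=> x [[/(es_sub OD)//|nO] Ox]; exfalso.
Qed.

Lemma haar_mrestr_exhausted : exhausted m (fun n => D n `|` ~` O).
Proof.
split.
- move=> n; apply: openU; first exact: es_open OD n.
  by apply: closed_openC; exact: (es_clopen OD).2.
- move=> n k nk; apply/subsetPset; apply: setSU; apply/subsetPset; exact: es_nd OD _ _ nk.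
- apply/seteqP; split => // x _; have [Ox|nOx] := pselect (O x); last by exists 0%N => //; right.
  by move: Ox; rewrite -{1}(es_cover OD) => -[n _ Dx]; exists n => //; left.
- exact: haar_mrestr_finite.
Qed.

Lemma haar_mrestr_tau_sigma_finite : tau_sigma_finite m.
Proof.
split; last by exists (fun n => D n `|` ~` O); exact: haar_mrestr_exhausted.
apply: tau_additive_mrestr; first exact: (es_clopen OD).1.
exact: haar_tau_additive.
Qed.

(** Translation by an element of the subgroup maps [O] onto itself, so it commutes with the
    restriction. *)
Lemma haar_mrestr_invariant (a : L) (F : L -> \bar R) : O a ->
  measurable_fun setT (F : borel L -> \bar R) -> (forall x, 0 <= F x) ->
  \int[m]_x F (a^-1 * x)%g = \int[m]_x F x.
Proof.
move=> Oa mF F0.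
have mt : measurable_fun setT ((fun x => a^-1 * x)%g : borel L -> borel L).
  by apply: continuous_borel; exact: continuous_mulgl.
have [nu [nuE nuF]] := pushforward_measure_exists m mt.
rewrite -nuF//; apply: eq_measure_integral => A mA _.
rewrite nuE /= /mrestr.
have [_ _ inv] := haar.
rewrite -(inv a (A `&` O)); last exact: measurableI.
have Odiv := es_div OD.
have O1 : O 1%g by rewrite -(mulVg a); exact: Odiv.
have OV b : O b -> O b^-1%g by move=> Ob; rewrite -[_^-1%g]mulg1; exact: Odiv.
congr (mu _); apply/seteqP; split => x /=.
  move=> [Ax Ox]; exists (a^-1 * x)%g; last by rewrite mulVKg.
  by split => //; exact: Odiv.
move=> [y [Ay Oy] <-]; rewrite mulKg; split => //.
by rewrite -[a]invgK; apply: Odiv => //; exact: OV.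
Qed.

End restriction.
End one_group.
End haar_measures.

(** * The Haar measure of the semidirect product *)

Section semidirect_integration.
Context (R : realType) (H K : lcGroupType) (tau : contHomAut H K).
Variables (muH : {measure set (borel H) -> \bar R}).
Variables (muK : {measure set (borel K) -> \bar R}) (delta : H -> R).
Variable muG : {measure set (borel (semidirect tau)) -> \bar R}.
Hypotheses (haarH : left_haar muH) (haarK : left_haar muK).
Hypothesis modulus : tau_modulus tau muK delta.
Hypothesis haarG : semidirect_haar muH muK delta muG.
Local Notation G := (semidirect tau).
Local Open Scope ereal_scope.

Variables (OH : set H) (DH QH : nat -> set H) (OK : set K) (DK QK : nat -> set K).
Hypotheses (esH : exhausted_subgroup OH DH QH) (esK : exhausted_subgroup OK DK QK).

Lemma borel_OH : measurable (OH : set (borel H)).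
Proof. by apply: open_borel; exact: (es_clopen esH).1. Qed.

Lemma borel_OK : measurable (OK : set (borel K)).
Proof. by apply: open_borel; exact: (es_clopen esK).1. Qed.

Lemma open_OG : open (OH `*` OK : set G).
Proof.
by apply: (@open_setX H K); [exact: (es_clopen esH).1|exact: (es_clopen esK).1].
Qed.

Lemma borel_OG : measurable ((OH `*` OK) : set (borel G)).
Proof. by apply: open_borel; exact: open_OG. Qed.

Let mH : {measure set (borel H) -> \bar R} := mrestr muH borel_OH.
Let mK : {measure set (borel K) -> \bar R} := mrestr muK borel_OK.
Let mG : {measure set (borel G) -> \bar R} := mrestr muG borel_OG.

Let rH : tau_sigma_finite mH := haar_mrestr_tau_sigma_finite haarH esH borel_OH.
Let rK : tau_sigma_finite mK := haar_mrestr_tau_sigma_finite haarK esK borel_OK.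

Lemma delta_ge0 h : (0 <= delta h)%R.
Proof. by have [d0 _ _ _] := modulus; exact: ltW. Qed.

Lemma borel_delta : measurable_fun setT (delta : borel H -> R).
Proof. by have [_ _ cd _] := modulus; exact: continuous_real_borel. Qed.

Lemma integral_bump (W : set G) (phi : G -> R) :
  W `<=` OH `*` OK -> bump_in W phi ->
  \int[muG]_x (phi x)%:E =
  \int[mH]_h ((delta h)%:E * \int[mK]_k (phi (h, k))%:E).
Proof.
move=> WO [cphi phi0 sphi phiW]; rewrite haarG.2//.
have phiO h k : ~ (OH h /\ OK k) -> phi (h, k) = 0%R.
  by move=> nO; apply: phiW => /WO.
rewrite integral_mrestr; last first.
  move=> h nOh; rewrite integral0_eq ?mule0// => k _.
  by rewrite phiO// => -[].
apply: eq_integral => h _; rewrite integral_mrestr// => k nOk.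
by rewrite phiO// => -[].
Qed.

(** [G] and [H * K] have the same open sets but are distinct names; the identity carries
    measurability to the type in which the product lemmas are stated. *)
Lemma measurable_pair_id : measurable_fun setT (id : borel G -> borel (H * K)%type).
Proof. by apply: (@continuous_borel G (H * K)%type) => x; exact: cvg_id. Qed.

Lemma measurable_id_pair d (T : measurableType d) (F : G -> T) :
  measurable_fun setT (F : borel G -> T) ->
  measurable_fun setT (F : borel (H * K)%type -> T).
Proof.
move=> mF; apply: (@measurable_borel_comp G (H * K)%type _ _ F id mF).
by move=> x; exact: cvg_id.
Qed.

Lemma semidirect_bump_le (W : set (H * K)) (phi : G -> R) :
  open W -> bump_in (W `&` (OH `*` OK) : set G) phi -> (forall x, phi x <= 1)%R ->
  \int[muG]_x (phi x)%:E <= \int[mH]_h ((delta h)%:E * mK (xsection W h)).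
Proof.
move=> oW bphi phi1; rewrite (integral_bump _ bphi); last by move=> x [].
have [cphi phi0 _ phiW] := bphi.
have mphi : measurable_fun setT ((fun z => (phi z)%:E) : borel (H * K)%type -> \bar R).
  apply/measurable_EFinP; apply: (@continuous_real_borel R (H * K)%type phi).
  exact: cphi.
have mW := open_borel oW.
have mdE : measurable_fun setT (fun x : borel H => (delta x)%:E).
  by apply/measurable_EFinP; exact: borel_delta.
have d0 h : 0 <= (delta h)%:E by rewrite lee_fin delta_ge0.
apply: ge0_le_integral => //.
- by move=> h _; rewrite mule_ge0// integral_ge0// => k _; rewrite lee_fin.
- apply: emeasurable_funM => //.
  by apply: (measurable_slice_integral rK mphi) => z; rewrite lee_fin.
- by apply: emeasurable_funM => //; exact: measurable_slice_measure.
- move=> h _; rewrite lee_wpmul2l//.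
  rewrite -(int_indic_xsection _ _ mW); apply: ge0_le_integral => //.
  + by move=> k _; rewrite lee_fin.
  + exact: (measurable_pairl h mphi).
  + apply: (@measurable_pairl H K _ _ (fun z => (\1_W z)%:E) h).
    exact/measurable_EFinP/measurable_indic.
  + move=> k _; rewrite lee_fin indicE.
    case: (boolP (_ \in W)) => [_|nW]; first exact: phi1.
    rewrite phiW// => -[Wx _]; move/negP: nW; apply; exact: mem_set.
Qed.

Lemma semidirect_exhausted :
  exhausted mG (fun n => (DH n `|` ~` OH) `*` (DK n `|` ~` OK) : set G).
Proof.
have [[[cfin _ _] _ _] _] := haarG.
have [oDH ndDH UDH _] := haar_mrestr_exhausted haarH esH borel_OH.
have [oDK ndDK UDK _] := haar_mrestr_exhausted haarK esK borel_OK.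
have oD n : open ((DH n `|` ~` OH) `*` (DK n `|` ~` OK) : set (H * K)).
  exact: open_setX.
split => //.
- move=> n l nl; apply/subsetPset => -[h k] [/= hD kD]; split => /=.
    by move/subsetPset: (ndDH n l nl) => /(_ h hD).
  by move/subsetPset: (ndDK n l nl) => /(_ k kD).
- apply/seteqP; split => // -[h k] _.
  have [n _ nh] : (\bigcup_n (DH n `|` ~` OH)) h by rewrite UDH.
  have [l _ lk] : (\bigcup_n (DK n `|` ~` OK)) k by rewrite UDK.
  exists (maxn n l) => //; split => /=.
    by move/subsetPset: (ndDH n (maxn n l) (leq_maxl n l)) => /(_ h nh).
  by move/subsetPset: (ndDK l (maxn n l) (leq_maxr n l)) => /(_ k lk).
- move=> n.
  have cQQ : compact (QH n `*` QK n : set G).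
    by apply: (@compact_setX H K); [exact: es_compact esH n|exact: es_compact esK n].
  apply: (@le_lt_trans _ _ (muG (QH n `*` QK n))); last exact: cfin.
  rewrite /mG /= /mrestr; apply: le_measure; rewrite ?inE.
  + apply: open_borel; apply: openI; [exact: oD|exact: open_OG].
  + by apply: closed_borel; apply: compact_closed => //; exact: lcg_hausdorff.
  + move=> [h k] [[/= hD kD] [/= Oh Ok]]; split => /=.
      by case: hD => // /(es_sub esH).
    by case: kD => // /(es_sub esK).
Qed.

Lemma semidirect_tau_sigma_finite : tau_sigma_finite mG.
Proof.
split; last by eexists; exact: semidirect_exhausted.
apply: tau_additive_mrestr; first exact: open_OG.
exact: haar_tau_additive haarG.1.
Qed.

(** Both sides integrate [F] against a measure on H x K, and by uniqueness the two measures need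
    only agree on open sets. Bump functions link them, since [semidirect_haar] speaks of these
    alone: inner regularity of [muG] gives one inequality, tau-additivity of the slice measure the
    other. *)
Lemma semidirect_integral (F : G -> \bar R) :
  measurable_fun setT (F : borel G -> \bar R) -> (forall x, 0 <= F x) ->
  \int[mG]_x F x = \int[mH]_h ((delta h)%:E * \int[mK]_k F (h, k)).
Proof.
move=> mF F0.
have [nu [nuE nuF]] := slice_measure_exists mH rK borel_delta delta_ge0.
have [nu' [nu'E nu'F]] := pushforward_measure_exists mG measurable_pair_id.
have mF' := measurable_id_pair mF.
rewrite -nuF// -nu'F//; apply: eq_measure_integral => A mA _.
have [[[_ _ ir] _ _] bumpE] := haarG.
pose D n : set (H * K) := (DH n `|` ~` OH) `*` (DK n `|` ~` OK).
have [oD _ UD Dfin] := semidirect_exhausted.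
apply: (@measure_unique _ R (borel (H * K)%type) (@open (H * K)%type) D) => //.
- exact: openI.
- move=> W oW; rewrite nu'E nuE; last exact: open_borel.
  pose W1 : set G := W `&` (OH `*` OK).
  have oW1 : open W1 by apply: openI => //; exact: open_OG.
  apply/eqP; rewrite eq_le; apply/andP; split.
    rewrite /mG /= /mrestr preimage_id -/W1 ir//.
    apply: ge_ereal_sup => _ [C [cC CW] <-].
    have [phi [bphi phi1 phiC]] := compact_bump R (@lcg_hausdorff G)
      (@lcg_locally_compact G) cC oW1 CW.
    apply: le_trans (semidirect_bump_le oW bphi phi1).
    have mC : measurable (C : set (borel G)).
      by apply: closed_borel; apply: compact_closed => //; exact: lcg_hausdorff.
    rewrite -(setIT C) -integral_indic//; apply: ge0_le_integral => //.
    + exact/measurable_EFinP/measurable_indic.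
    + apply/measurable_EFinP; apply: continuous_real_borel.
      by have [] := bphi.
    + move=> x _; rewrite lee_fin indicE; case: (boolP (x \in C)).
        by rewrite inE => /phiC ->.
      by have [_ phi0 _ _] := bphi.
  (* [mH] sees only points of [OH], and there [mK] ignores what lies outside [OK], so [W] may be cut
     down to [W1]. *)
  have -> : \int[mH]_h ((delta h)%:E * mK (xsection W h)) =
      \int[mH]_h ((delta h)%:E * mK (xsection W1 h)).
    have mxs (V : set (H * K)) : open V ->
        measurable_fun setT (fun h : borel H => (delta h)%:E * mK (xsection V h)).
      move=> oV; apply: emeasurable_funM; first by apply/measurable_EFinP; exact: borel_delta.
      by apply: measurable_slice_measure => //; exact: open_borel.
    apply: ge0_ae_eq_integral => //; [exact: mxs|exact: mxs| | |].
    - by move=> h _; rewrite mule_ge0// lee_fin delta_ge0.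
    - by move=> h _; rewrite mule_ge0// lee_fin delta_ge0.
    - apply: ae_in_mrestr => h OHh _; congr (_ * _); rewrite /mK /= /mrestr.
      congr (muK _); apply/seteqP; split => k [/xsectionP].
        by move=> Wx OKk; split => //; apply/xsectionP.
      by move=> [Wx _] OKk; split => //; apply/xsectionP.
  (* Each such [V] sits under a bump equal to 1 on [Q] and vanishing off [W1], so its slice measure
     is at most the [muG]-measure of [W1]. By local compactness these sets fill [W1]. *)
  pose DD := [set V : set (H * K) | open V /\
    exists Q : set G, [/\ compact Q, V `<=` Q & Q `<=` W1]].
  have W1E : W1 = \bigcup_(V in DD) V.
    apply/seteqP; split => x; last first.
      by move=> [V [_ [Q [_ VQ QW]]] /VQ/QW].
    move=> W1x; have [V [Q [oV Vx cQ VQ QW]]] := compact_nbhs_in R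
      (@lcg_hausdorff G) (@lcg_locally_compact G) oW1 W1x.
    by exists V => //; split => //; exists Q.
  rewrite W1E; apply: slice_measure_tau_additive => //.
  + exact: rH.1.
  + exact: rK.1.
  + by have [] := modulus.
  + exact: delta_ge0.
  + split; first by exists set0; split; [exact: open0|exists set0; split => //; exact: compact0].
    move=> U V [oU [Q [cQ UQ QW]]] [oV [Q' [cQ' VQ' QW']]].
    exists (U `|` V) => //; split; first exact: openU.
    exists (Q `|` Q'); split; first exact: compactU.
      by apply: setUSS.
    by rewrite subUset.
  + by move=> V [].
  + move=> V [oV [Q [cQ VQ QW]]].
    have [phi [bphi phi1 phiQ]] := compact_bump R (@lcg_hausdorff G)
      (@lcg_locally_compact G) cQ oW1 QW.
    have [cphi phi0 _ phiW1] := bphi.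
    apply: (@le_trans _ _ (\int[muG]_x (phi x)%:E)).
      rewrite (integral_bump _ bphi); last by move=> x [].
      have mphi : measurable_fun setT ((fun z => (phi z)%:E) : borel (H * K)%type -> \bar R).
        apply/measurable_EFinP; apply: (@continuous_real_borel R (H * K)%type phi).
        exact: cphi.
      have mdE : measurable_fun setT (fun x : borel H => (delta x)%:E).
        by apply/measurable_EFinP; exact: borel_delta.
      have mV := open_borel oV.
      apply: ge0_le_integral => //.
      - by move=> h _; rewrite mule_ge0// lee_fin delta_ge0.
      - by apply: emeasurable_funM => //; exact: measurable_slice_measure.
      - apply: emeasurable_funM => //.
        by apply: (measurable_slice_integral rK mphi) => z; rewrite lee_fin.
      - move=> h _; rewrite lee_wpmul2l ?lee_fin ?delta_ge0//.
        rewrite -(int_indic_xsection _ _ mV); apply: ge0_le_integral => //.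
        + apply: (@measurable_pairl H K _ _ (fun z => (\1_V z)%:E) h).
          exact/measurable_EFinP/measurable_indic.
        + exact: (measurable_pairl h mphi).
        + move=> k _; rewrite lee_fin indicE; case: (boolP (_ \in V)).
            by rewrite inE => /VQ/phiQ ->.
          by rewrite phi0.
    rewrite /mG /= /mrestr preimage_id -/W1.
    rewrite -(setIT W1) -integral_indic//; last exact: open_borel.
    apply: ge0_le_integral => //.
    + by move=> x _; rewrite lee_fin.
    + by apply/measurable_EFinP; exact: continuous_real_borel.
    + by apply/measurable_EFinP/measurable_indic; exact: open_borel.
    + move=> x _; rewrite lee_fin indicE; case: (boolP (x \in W1)) => [_|nW].
        exact: phi1.
      by rewrite phiW1// => Wx; move/negP: nW; apply; exact: mem_set.
- by move=> n; rewrite nu'E; exact: Dfin.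
Qed.

End semidirect_integration.

(** * Complex integrals *)

Section complex_functions.
Context (R : realType).
Local Notation normc := (@Normc.normc R).
Implicit Types z w : R[i].

Lemma ler_Re_normc z : `|complex.Re z| <= normc z.
Proof.
by case: z => a b /=; rewrite -sqrtr_sqr ler_wsqrtr// lerDl sqr_ge0.
Qed.

Lemma ler_Im_normc z : `|complex.Im z| <= normc z.
Proof.
by case: z => a b /=; rewrite -sqrtr_sqr ler_wsqrtr// lerDr sqr_ge0.
Qed.

Lemma normc_le_ReIm z : normc z <= `|complex.Re z| + `|complex.Im z|.
Proof.
case: z => a b /=; rewrite -[leRHS]ger0_norm ?addr_ge0// -sqrtr_sqr ler_wsqrtr//.
by rewrite sqrrD !real_normK ?num_real// -addrA lerD2l lerDr mulrn_wge0// mulr_ge0.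
Qed.

Lemma normc_ge0 z : 0 <= normc z.
Proof. by case: z => a b; rewrite sqrtr_ge0. Qed.

Lemma sqr_normcE z : normc z ^+ 2 = complex.Re z ^+ 2 + complex.Im z ^+ 2.
Proof. by case: z => a b /=; rewrite sqr_sqrtr// addr_ge0// sqr_ge0. Qed.

Lemma Re_mul z w : complex.Re (z * w) =
  complex.Re z * complex.Re w - complex.Im z * complex.Im w.
Proof. by case: z => a b; case: w. Qed.

Lemma Im_mul z w : complex.Im (z * w) =
  complex.Re z * complex.Im w + complex.Im z * complex.Re w.
Proof. by case: z => a b; case: w. Qed.

Lemma Re_add z w : complex.Re (z + w) = complex.Re z + complex.Re w.
Proof. by case: z => a b; case: w. Qed.

Lemma Im_add z w : complex.Im (z + w) = complex.Im z + complex.Im w.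
Proof. by case: z => a b; case: w. Qed.

Lemma eq_complexRI z w :
  complex.Re z = complex.Re w -> complex.Im z = complex.Im w -> z = w.
Proof. by case: z => a b; case: w => c e /= -> ->. Qed.

Lemma normc_real (r : R) : normc r%:C = `|r|.
Proof. by rewrite /= expr0n addr0 sqrtr_sqr. Qed.

Section measurability.
Context d (T : measurableType d).
Implicit Types f g : T -> R[i].

Lemma cmeasurableM f g : cmeasurable f -> cmeasurable g ->
  cmeasurable (fun x => f x * g x).
Proof.
move=> [fr fi] [gr gi]; split.
  under eq_fun do rewrite Re_mul.
  by apply: measurable_funB; exact: measurable_funM.
under eq_fun do rewrite Im_mul.
by apply: measurable_funD; exact: measurable_funM.
Qed.

Lemma cmeasurable_cst (a : R[i]) : cmeasurable (fun _ : T => a).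
Proof. by split; exact: measurable_cst. Qed.

Lemma cmeasurable_real (r : T -> R) : measurable_fun setT r ->
  cmeasurable (fun x => (r x)%:C).
Proof. by split => //; exact: measurable_cst. Qed.

Lemma measurable_normc f : cmeasurable f -> measurable_fun setT (fun x => normc (f x)).
Proof.
move=> [fr fi].
have ms : measurable_fun setT (@Num.sqrt R).
  by apply: continuous_measurable_fun; exact: sqrt_continuous.
rewrite (_ : (fun x => _) = fun x =>
    Num.sqrt (complex.Re (f x) ^+ 2 + complex.Im (f x) ^+ 2)).
  apply: measurableT_comp => //; apply: measurable_funD; exact: measurable_funX.
by apply/funext => x; case: (f x).
Qed.

Lemma measurable_EFin_normc f : cmeasurable f ->
  measurable_fun setT (fun x => (normc (f x))%:E).
Proof. by move=> mf; apply/measurable_EFinP; exact: measurable_normc. Qed.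

End measurability.

Lemma cmeasurable_comp d1 d2 (T1 : measurableType d1) (T2 : measurableType d2)
    (f : T2 -> R[i]) (phi : T1 -> T2) :
  cmeasurable f -> measurable_fun setT phi -> cmeasurable (fun x => f (phi x)).
Proof.
move=> [fr fi] mphi; split.
  exact: (measurableT_comp (f := fun x => complex.Re (f x))).
exact: (measurableT_comp (f := fun x => complex.Im (f x))).
Qed.

Section integration.
Context d (T : measurableType d) (mu : {measure set T -> \bar R}).
Implicit Types f g : T -> R[i].
Local Notation L1 := (inL1 mu).

Lemma L1norm_ge0 f : (0 <= L1norm mu f)%E.
Proof. by apply: integral_ge0 => x _; rewrite lee_fin normc_ge0. Qed.

Lemma inL1_integrable f : L1 f <->
  mu.-integrable setT (EFin \o (fun x => complex.Re (f x))) /\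
  mu.-integrable setT (EFin \o (fun x => complex.Im (f x))).
Proof.
split=> [[mf fi]|[/integrableP[mr fr] /integrableP[mi fi]]].
  have mn := measurable_EFin_normc mf; case: mf => mr mi.
  split; apply/integrableP; split; try exact/measurable_EFinP.
    apply: le_lt_trans fi; apply: ge0_le_integral => //.
      by apply: measurableT_comp => //; exact/measurable_EFinP.
    by move=> x _; rewrite abse_EFin lee_fin ler_Re_normc.
  apply: le_lt_trans fi; apply: ge0_le_integral => //.
    by apply: measurableT_comp => //; exact/measurable_EFinP.
  by move=> x _; rewrite abse_EFin lee_fin ler_Im_normc.
have mf : cmeasurable f by split; exact/measurable_EFinP.
split=> //; apply: le_lt_trans (lte_add_pinfty fr fi).
rewrite -ge0_integralD//.
- apply: ge0_le_integral => //.
  + by move=> x _; rewrite lee_fin normc_ge0.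
  + exact: measurable_EFin_normc.
  + by apply: emeasurable_funD; exact: measurableT_comp.
  + by move=> x _ /=; rewrite -EFinD lee_fin normc_le_ReIm.
- exact: measurableT_comp.
- exact: measurableT_comp.
Qed.

Lemma inL1_linear (a : R[i]) f g : L1 f -> L1 g -> L1 (fun x => a * f x + g x).
Proof.
move=> /inL1_integrable[fr fi] /inL1_integrable[gr gi].
apply/inL1_integrable; split.
  rewrite (_ : _ \o _ = (EFin \o (fun x => complex.Re a * complex.Re (f x) -
      complex.Im a * complex.Im (f x) + complex.Re (g x)))).
    have := integrableD measurableT (integrableB measurableT
      (integrableZl measurableT (complex.Re a) fr)
      (integrableZl measurableT (complex.Im a) fi)) gr.
    by apply: eq_integrable.
  by apply/funext => x /=; rewrite Re_add Re_mul.
rewrite (_ : _ \o _ = (EFin \o (fun x => complex.Re a * complex.Im (f x) +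
    complex.Im a * complex.Re (f x) + complex.Im (g x)))).
  have := integrableD measurableT (integrableD measurableT
    (integrableZl measurableT (complex.Re a) fi)
    (integrableZl measurableT (complex.Im a) fr)) gi.
  by apply: eq_integrable.
by apply/funext => x /=; rewrite Im_add Im_mul.
Qed.

Lemma cintegral_linear (a : R[i]) f g : L1 f -> L1 g ->
  cintegral mu (fun x => a * f x + g x) = a * cintegral mu f + cintegral mu g.
Proof.
move=> /inL1_integrable[fr fi] /inL1_integrable[gr gi].
have Zl (c : R) h : mu.-integrable setT (EFin \o h) ->
    mu.-integrable setT (EFin \o (fun x => c * h x)).
  by move=> ih; have := integrableZl measurableT c ih; exact: eq_integrable.
apply: eq_complexRI; rewrite /cintegral ?Re_add ?Im_add ?Re_mul ?Im_mul /=.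
  under eq_Rintegral do rewrite Re_add Re_mul.
  rewrite RintegralD//; last first.
    have := integrableB measurableT (Zl (complex.Re a) _ fr) (Zl (complex.Im a) _ fi).
    exact: eq_integrable.
  rewrite RintegralB//; [|exact: Zl|exact: Zl].
  by rewrite !RintegralZl.
under eq_Rintegral do rewrite Im_add Im_mul.
rewrite RintegralD//; last first.
  have := integrableD measurableT (Zl (complex.Re a) _ fi) (Zl (complex.Im a) _ fr).
  exact: eq_integrable.
rewrite RintegralD//; [|exact: Zl|exact: Zl].
by rewrite !RintegralZl.
Qed.

(* With [A + iB] the integral of [f], Cauchy-Schwarz bounds [A Re f + B Im f]
   by [|A + iB| |f|], and its integral is [|A + iB|^2]. *)
Lemma normc_cintegral_le f : cmeasurable f ->
  ((normc (cintegral mu f))%:E <= L1norm mu f)%E.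
Proof.
move=> mf; have [->|foo] := eqVneq (L1norm mu f) +oo%E; first by rewrite leey.
have Lf : L1 f by split => //; rewrite ltey.
have /inL1_integrable[fr fi] := Lf.
have Lfin : L1norm mu f \is a fin_num by rewrite ge0_fin_numE ?L1norm_ge0// ltey.
set z := cintegral mu f; set n := normc z.
have [n0|n0] := eqVneq n 0; first by rewrite n0 L1norm_ge0.
have npos : 0 < n by rewrite lt_neqAle eq_sym n0 normc_ge0.
pose A := complex.Re z; pose B := complex.Im z.
have n2 : n ^+ 2 = A ^+ 2 + B ^+ 2.
  exact: sqr_normcE.
have Zl (c : R) h : mu.-integrable setT (EFin \o h) ->
    mu.-integrable setT (EFin \o (fun x => c * h x)).
  by move=> ih; have := integrableZl measurableT c ih; exact: eq_integrable.
have iAB : mu.-integrable setT (EFin \o (fun x =>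
    A * complex.Re (f x) + B * complex.Im (f x))).
  have := integrableD measurableT (Zl A _ fr) (Zl B _ fi).
  exact: eq_integrable.
have E : n * n = \int[mu]_x (A * complex.Re (f x) + B * complex.Im (f x)).
  rewrite RintegralD//; [|exact: Zl|exact: Zl].
  by rewrite !RintegralZl// -expr2 n2 !expr2.
have inf : mu.-integrable setT (EFin \o (fun x => n * normc (f x))).
  apply: Zl; apply/integrableP; split; first exact: measurable_EFin_normc.
  under eq_integral do rewrite /= ger0_norm ?normc_ge0//.
  by case: Lf.
have : n * n <= n * fine (L1norm mu f).
  rewrite E; have -> : n * fine (L1norm mu f) = \int[mu]_x (n * normc (f x)).
    rewrite RintegralZl//; apply/integrableP; split; first exact: measurable_EFin_normc.
    under eq_integral do rewrite /= ger0_norm ?normc_ge0//.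
    by case: Lf.
  apply: le_Rintegral => // x _.
  apply: le_trans (ler_norm _) _.
  pose a := complex.Re (f x); pose b := complex.Im (f x).
  rewrite -ler_sqr ?nnegrE ?mulr_ge0 ?normc_ge0//.
  rewrite real_normK ?num_real// exprMn n2 sqr_normcE -/a -/b -subr_ge0.
  have -> : (A ^+ 2 + B ^+ 2) * (a ^+ 2 + b ^+ 2) - (A * a + B * b) ^+ 2 =
    (A * b - B * a) ^+ 2 by ring.
  exact: sqr_ge0.
by rewrite ler_pM2l// -lee_fin fineK.
Qed.

End integration.
End complex_functions.

Section parametric_integrals.
Context (R : realType) (X Y : ptopologicalType).
Variable mY : {measure set (borel Y) -> \bar R}.
Hypothesis rY : tau_sigma_finite mY.

(** The real integral is [fine] of a difference of two Borel functions, so it is Borel also at the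
    points where it takes a default value. *)
Lemma measurable_slice_Rintegral (F : X * Y -> R) :
  measurable_fun setT (F : borel (X * Y)%type -> R) ->
  measurable_fun setT (fun x : borel X => \int[mY]_y F (x, y)).
Proof.
move=> mF; have mE : measurable_fun setT ((EFin \o F) : borel (X * Y)%type -> \bar R).
  exact/measurable_EFinP.
apply: measurableT_comp => //.
rewrite (_ : (fun x => _) = fun x => (\int[mY]_y (EFin \o F)^\+ (x, y) -
    \int[mY]_y (EFin \o F)^\- (x, y))%E); last first.
  by apply/funext => x; rewrite integralE; congr (_ - _)%E;
    apply: eq_integral => y _; rewrite ?funeposE ?funenegE.
apply: emeasurable_funB; apply: (measurable_slice_integral rY) => //.
- exact: measurable_funepos.
- exact: measurable_funeneg.
Qed.

Lemma cmeasurable_slice_cintegral (F : X * Y -> R[i]) :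
  cmeasurable (F : borel (X * Y)%type -> R[i]) ->
  cmeasurable (fun x : borel X => cintegral mY (fun y => F (x, y))).
Proof.
move=> [mr mi]; split.
  exact: (measurable_slice_Rintegral (F := fun z => complex.Re (F z))).
exact: (measurable_slice_Rintegral (F := fun z => complex.Im (F z))).
Qed.

End parametric_integrals.

(** * Fubini's theorem on the semidirect product *)

Section semidirect_fubini.
Context (R : realType) (H K : lcGroupType) (tau : contHomAut H K).
Variables (mH : {measure set (borel H) -> \bar R}).
Variables (mK : {measure set (borel K) -> \bar R}) (delta : H -> R).
Variable mG : {measure set (borel (semidirect tau)) -> \bar R}.
Local Notation G := (semidirect tau).
Hypotheses (rH : tau_sigma_finite mH) (rK : tau_sigma_finite mK).
Hypothesis delta_gt0 : forall h, 0 < delta h.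
Hypothesis mdelta : measurable_fun setT (delta : borel H -> R).
Hypothesis mGE : forall F : G -> \bar R,
  measurable_fun setT (F : borel G -> \bar R) -> (forall x, 0 <= F x)%E ->
  (\int[mG]_x F x = \int[mH]_h ((delta h)%:E * \int[mK]_k F (h, k)))%E.

Let d0 h : (0 <= (delta h)%:E)%E.
Proof. by rewrite lee_fin ltW. Qed.

Let mdE : measurable_fun setT (fun h : borel H => (delta h)%:E).
Proof. exact/measurable_EFinP. Qed.

Lemma measurable_weighted_slice (F : G -> \bar R) :
  measurable_fun setT (F : borel G -> \bar R) -> (forall x, 0 <= F x)%E ->
  measurable_fun setT (fun h : borel H => ((delta h)%:E * \int[mK]_k F (h, k))%E).
Proof.
move=> mF F0; apply: emeasurable_funM => //.
exact: (measurable_slice_integral rK (measurable_id_pair mF) F0).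
Qed.

Lemma integrable_weighted_slice (F : G -> \bar R) :
  measurable_fun setT (F : borel G -> \bar R) -> (forall x, 0 <= F x)%E ->
  (\int[mG]_x F x < +oo)%E ->
  mH.-integrable setT (fun h => ((delta h)%:E * \int[mK]_k F (h, k))%E).
Proof.
move=> mF F0 Fi; apply/integrableP; split; first exact: measurable_weighted_slice.
under eq_integral do rewrite gee0_abs ?mule_ge0 ?integral_ge0//.
by rewrite -mGE.
Qed.

(** Since [delta h] is positive, an infinite slice integral would stay infinite after weighting, and
    the weighted one is finite almost everywhere. *)
Lemma ae_finite_slice (F : G -> \bar R) :
  measurable_fun setT (F : borel G -> \bar R) -> (forall x, 0 <= F x)%E ->
  (\int[mG]_x F x < +oo)%E ->
  {ae mH, forall h, (\int[mK]_k F (h, k) < +oo)%E}.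
Proof.
move=> mF F0 Fi.
apply: ae_imp (integrable_ae measurableT (integrable_weighted_slice mF F0 Fi)).
move=> h /(_ I) fin; rewrite ltey; apply/eqP => Foo.
by move: fin; rewrite Foo gt0_muley// lte_fin.
Qed.

(** The formula is known for the positive and negative parts. Where both slice integrals are finite,
    the real inner integral is their difference; elsewhere it may be a default value, but this
    happens on a null set. *)
Lemma semidirect_fubini_real (F : G -> R) :
  measurable_fun setT (F : borel G -> R) ->
  (\int[mG]_x `|(F x)%:E| < +oo)%E ->
  (\int[mH]_h ((\int[mK]_k F (h, k)) * delta h)%:E = \int[mG]_x (F x)%:E)%E.
Proof.
move=> mF Fi; have mE : measurable_fun setT ((EFin \o F) : borel G -> \bar R).
  exact/measurable_EFinP.
have mp := measurable_funepos mE; have mn := measurable_funeneg mE.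
have pi : (\int[mG]_x (EFin \o F)^\+ x < +oo)%E.
  apply: le_lt_trans Fi; apply: ge0_le_integral => //.
    exact: measurableT_comp.
  by move=> x _; rewrite funeposE ge_max lee_abs abse_ge0.
have ni : (\int[mG]_x (EFin \o F)^\- x < +oo)%E.
  apply: le_lt_trans Fi; apply: ge0_le_integral => //.
    exact: measurableT_comp.
  by move=> x _; rewrite funenegE ge_max -abseN lee_abs abse_ge0.
have p0 x : (0 <= (EFin \o F)^\+ x)%E by [].
have n0 x : (0 <= (EFin \o F)^\- x)%E by [].
rewrite [RHS]integralE mGE// mGE// -integralB//; last 2 first.
- exact: integrable_weighted_slice.
- exact: integrable_weighted_slice.
apply: ae_eq_integral => //.
- apply/measurable_EFinP; apply: measurable_funM => //.
  exact: (measurable_slice_Rintegral rK (measurable_id_pair mF)).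
- by apply: emeasurable_funB; exact: measurable_weighted_slice.
apply: ae_imp2 (ae_finite_slice mp p0 pi) (ae_finite_slice mn n0 ni).
move=> h ph nh _.
have pf : (\int[mK]_k (EFin \o F)^\+ (h, k))%E \is a fin_num.
  by rewrite ge0_fin_numE// integral_ge0.
have nf : (\int[mK]_k (EFin \o F)^\- (h, k))%E \is a fin_num.
  by rewrite ge0_fin_numE// integral_ge0.
have E : (\int[mK]_k (F (h, k))%:E = \int[mK]_k (EFin \o F)^\+ (h, k) -
    \int[mK]_k (EFin \o F)^\- (h, k))%E.
  by rewrite integralE; congr (_ - _)%E; apply: eq_integral => y _;
    rewrite ?funeposE ?funenegE.
rewrite /Rintegral E -(fineK pf) -(fineK nf) -!EFinM -!EFinB /=.
by congr EFin; ring.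
Qed.

(** When [F] is the integrand of a convolution at one point, the first two conclusions are
    [rtconv_defined] there and the third turns the iterated integral into an integral over [G]. *)
Lemma semidirect_fubini (F : G -> R[i]) : inL1 mG F ->
  let c := (fun h => cintegral mK (fun k => F (h, k)) * (delta h)%:C) : H -> R[i] in
  [/\ {ae mH, forall h, inL1 mK (fun k => F (h, k))}, inL1 mH c
    & cintegral mH c = cintegral mG F].
Proof.
move=> LF c; have [mF Fi] := LF.
have mn := measurable_EFin_normc mF.
have n0 x : (0 <= (Normc.normc (F x))%:E)%E by rewrite lee_fin normc_ge0.
have mF' : cmeasurable (F : borel (H * K)%type -> R[i]).
  by case: mF => mr mi; split; exact: (measurable_id_pair (tau := tau)).
have mslice h : cmeasurable (fun k : borel K => F (h, k)).
  case: mF' => mr mi; split.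
    exact: (@measurable_pairl H K _ _ (fun z => complex.Re (F z)) h mr).
  exact: (@measurable_pairl H K _ _ (fun z => complex.Im (F z)) h mi).
have /inL1_integrable[/integrableP[_ ri] /integrableP[_ ii]] := LF.
have mc : cmeasurable (c : borel H -> R[i]).
  apply: cmeasurableM; first exact: (cmeasurable_slice_cintegral rK).
  exact: cmeasurable_real.
split.
- by apply: ae_imp (ae_finite_slice mn n0 Fi) => h fin; split.
- split=> //; apply: le_lt_trans Fi; rewrite /L1norm mGE//.
  apply: ge0_le_integral => //.
  + by move=> h _; rewrite lee_fin normc_ge0.
  + exact: measurable_EFin_normc.
  + exact: (measurable_weighted_slice mn n0).
  + move=> h _; rewrite Normc.normcM normc_real gtr0_norm// mulrC EFinM.
    by rewrite lee_wpmul2l//; exact: normc_cintegral_le.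
- apply: eq_complexRI; rewrite /cintegral /Rintegral /=; congr fine.
    rewrite -(semidirect_fubini_real (F := fun x => complex.Re (F x)) mF.1 ri).
    by apply: eq_integral => h _; rewrite mulr0 subr0.
  rewrite -(semidirect_fubini_real (F := fun x => complex.Im (F x)) mF.2 ii).
  by apply: eq_integral => h _; rewrite mulr0 add0r.
Qed.

End semidirect_fubini.

(** * The convolution algebra *)

Section convolution_algebra.
Context (R : realType) (H K : lcGroupType) (tau : contHomAut H K).
Variables (mH : {measure set (borel H) -> \bar R}).
Variables (mK : {measure set (borel K) -> \bar R}) (delta : H -> R).
Variable mG : {measure set (borel (semidirect tau)) -> \bar R}.
Variable O : set K.
Local Notation G := (semidirect tau).
Local Notation normc := (@Normc.normc R).
Hypotheses (rH : tau_sigma_finite mH) (rK : tau_sigma_finite mK).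
Hypothesis rG : tau_sigma_finite mG.
Hypothesis delta_gt0 : forall h, 0 < delta h.
Hypothesis mdelta : measurable_fun setT (delta : borel H -> R).
Hypothesis mGE : forall F : G -> \bar R,
  measurable_fun setT (F : borel G -> \bar R) -> (forall x, 0 <= F x)%E ->
  (\int[mG]_x F x = \int[mH]_h ((delta h)%:E * \int[mK]_k F (h, k)))%E.
Hypothesis O_div : forall a b, O a -> O b -> O (a^-1 * b)%g.
Hypothesis inv : forall (a : K) (F : K -> \bar R), O a ->
  measurable_fun setT (F : borel K -> \bar R) -> (forall x, 0 <= F x)%E ->
  (\int[mK]_x F (a^-1 * x)%g = \int[mK]_x F x)%E.

Let d0 h : (0 <= (delta h)%:E)%E.
Proof. by rewrite lee_fin ltW. Qed.

Let mdE : measurable_fun setT (fun h : borel H => (delta h)%:E).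
Proof. exact/measurable_EFinP. Qed.

(* At [x = (h, k)] and [w = (t, y)] the integrand of the tau-convolution is
   [f (left_arg x w) * g (right_arg x w)] with respect to [delta t dt dy]. *)
Definition left_arg (x w : G) : G := (x.1, w.2).
Definition right_arg (x w : G) : G := (w.1, (w.2^-1 * x.2)%g).

Lemma continuous_left_arg : continuous (fun z : G * G => left_arg z.1 z.2).
Proof.
move=> z; apply: (@cvg_pair _ H K).
  apply: (continuous_comp (f := fst) (g := fun x : H * K => x.1)); exact: cvg_fst.
by apply: (continuous_comp (f := snd) (g := fun x : H * K => x.2)); exact: cvg_snd.
Qed.

Lemma continuous_right_arg : continuous (fun z : G * G => right_arg z.1 z.2).
Proof.
move=> z; apply: (@cvg_pair _ H K).
  apply: (continuous_comp (f := snd) (g := fun x : H * K => x.1)).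
    exact: cvg_snd.
  exact: cvg_fst.
apply: (continuous_comp (f := fun z : G * G => (z.2.2, z.1.2) : K * K)
  (g := fun p : K * K => (p.1^-1 * p.2)%g)); last exact: continuous_div.
apply: (@cvg_pair _ K K).
  by apply: (continuous_comp (f := snd) (g := fun x : H * K => x.2)); exact: cvg_snd.
apply: (continuous_comp (f := fst) (g := fun x : H * K => x.2)).
  exact: cvg_fst.
exact: cvg_snd.
Qed.

Lemma continuous_translate2 (a : K) : continuous (fun w : G => (w.1, (a^-1 * w.2)%g) : G).
Proof.
move=> w; apply: (@cvg_pair _ H K); first exact: (@cvg_fst H K).
apply: (continuous_comp (f := fun w : H * K => w.2) (g := fun y => (a^-1 * y)%g)).
  exact: cvg_snd.
exact: continuous_mulgl.
Qed.

(** If [y] and [y^-1 k] lie in the subgroup, so does their product [k]. *)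
Lemma args_notin x w : ~ O x.2 -> ~ O (left_arg x w).2 \/ ~ O (right_arg x w).2.
Proof.
move=> nOx; apply: contrapT => /not_orP[/contrapT Ow /contrapT Owx]; apply: nOx.
have O1 : O 1%g by rewrite -(mulVg w.2); exact: O_div.
have OV : O w.2^-1%g by rewrite -[_^-1%g]mulg1; exact: O_div.
by rewrite -(mulVKg w.2 x.2) -[X in (X * _)%g]invgK; exact: O_div.
Qed.

(** * Convolution of nonnegative functions *)

Section nonnegative.
Local Open Scope ereal_scope.
Implicit Types f g u : G -> \bar R.

(** Only the component in [K] is constrained, because the convolution translates in [K] and [inv]
    covers translations by elements of [O] alone. *)
Definition supported (T : Type) (zero : T) (f : G -> T) :=
  forall x : G, ~ O x.2 -> f x = zero.

Definition tauconv f g (x : G) : \bar R :=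
  \int[mG]_w (f (left_arg x w) * g (right_arg x w)).

Lemma measurable_args f g :
  measurable_fun setT (f : borel G -> \bar R) ->
  measurable_fun setT (g : borel G -> \bar R) ->
  measurable_fun setT ((fun z => f (left_arg z.1 z.2) * g (right_arg z.1 z.2))
    : borel (G * G)%type -> \bar R).
Proof.
move=> mf mg; apply: emeasurable_funM.
  exact: (measurable_borel_comp (Y := (G * G)%type) mf continuous_left_arg).
exact: (measurable_borel_comp (Y := (G * G)%type) mg continuous_right_arg).
Qed.

Lemma measurable_args1 f g x :
  measurable_fun setT (f : borel G -> \bar R) ->
  measurable_fun setT (g : borel G -> \bar R) ->
  measurable_fun setT ((fun w => f (left_arg x w) * g (right_arg x w))
    : borel G -> \bar R).
Proof. by move=> mf mg; have := measurable_pairl x (measurable_args mf mg). Qed.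

Lemma measurable_right_args g u x :
  measurable_fun setT (g : borel G -> \bar R) ->
  measurable_fun setT (u : borel G -> \bar R) ->
  measurable_fun setT ((fun z => g (right_arg z.1 z.2) * u (right_arg x z.1))
    : borel (G * G)%type -> \bar R).
Proof.
move=> mg mu; apply: emeasurable_funM.
  exact: (measurable_borel_comp (Y := (G * G)%type) mg continuous_right_arg).
have mux := measurable_pairl x
  (measurable_borel_comp (Y := (G * G)%type) mu continuous_right_arg).
apply: (@measurable_borel_comp G (G * G)%type _ _ _ fst mux) => z.
exact: cvg_fst.
Qed.

Lemma tauconv_ge0 f g x : (forall x, 0 <= f x) -> (forall x, 0 <= g x) ->
  0 <= tauconv f g x.
Proof. by move=> f0 g0; apply: integral_ge0 => w _; rewrite mule_ge0. Qed.

Lemma measurable_tauconv f g :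
  measurable_fun setT (f : borel G -> \bar R) ->
  measurable_fun setT (g : borel G -> \bar R) ->
  (forall x, 0 <= f x) -> (forall x, 0 <= g x) ->
  measurable_fun setT (tauconv f g : borel G -> \bar R).
Proof.
move=> mf mg f0 g0.
apply: (@measurable_slice_integral R G G mG _ rG (measurable_args mf mg)) => z.
by rewrite mule_ge0.
Qed.

Lemma supported_tauconv f g : supported 0 f -> supported 0 g -> supported 0 (tauconv f g).
Proof.
move=> sf sg x nOx; apply: integral0_eq => w _.
by case: (args_notin w nOx) => [/sf|/sg] ->; rewrite ?mul0e ?mule0.
Qed.

Lemma mG_invariant (a : K) f : O a ->
  measurable_fun setT (f : borel G -> \bar R) -> (forall x, 0 <= f x) ->
  \int[mG]_w f (w.1, (a^-1 * w.2)%g) = \int[mG]_w f w.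
Proof.
move=> Oa mf f0; rewrite mGE//; last first.
  exact: (measurable_borel_comp (Y := G) mf (@continuous_translate2 a)).
rewrite mGE//; apply: eq_integral => h _; congr (_ * _).
apply: (inv (F := fun k => f (h, k))) => //.
exact: (measurable_pairl h (measurable_id_pair mf)).
Qed.

(** Exchange the order and fix [w = (t, y)]. In the integral over (h, k) the factor [f (h, y)] does
    not involve [k], and invariance turns the integral of [g (t, y^-1 k)] over [k] into [N t]. What
    remains is [B y * N t], whose integral factors. *)
Lemma integral_tauconv f g : supported 0 f ->
  measurable_fun setT (f : borel G -> \bar R) ->
  measurable_fun setT (g : borel G -> \bar R) ->
  (forall x, 0 <= f x) -> (forall x, 0 <= g x) ->
  \int[mG]_x tauconv f g x = \int[mG]_x f x * \int[mG]_x g x.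
Proof.
move=> sf mf mg f0 g0.
have mf' := measurable_id_pair mf; have mg' := measurable_id_pair mg.
pose N (t : H) := \int[mK]_k g (t, k).
pose B (y : K) := \int[mH]_h ((delta h)%:E * f (h, y)).
have N0 t : 0 <= N t by exact: integral_ge0.
have B0 y : 0 <= B y by apply: integral_ge0 => h _; rewrite mule_ge0.
have mN : measurable_fun setT (N : borel H -> \bar R).
  exact: (measurable_slice_integral rK mg').
have mdf : measurable_fun setT ((fun z => (delta z.1)%:E * f z) : borel (H * K)%type -> \bar R).
  apply: emeasurable_funM => //.
  apply: (@measurable_borel_comp H (H * K)%type _ _ (fun h => (delta h)%:E)) => //.
  by move=> z; exact: cvg_fst.
have df0 (z : H * K) : 0 <= (delta z.1)%:E * f z by rewrite mule_ge0.
have mB : measurable_fun setT (B : borel K -> \bar R).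
  apply: (@measurable_slice_integral R K H mH (fun z => (delta z.2)%:E * f (z.2, z.1)) rH).
    exact: (measurable_borel_comp (X := (H * K)%type) (Y := (K * H)%type) mdf
      (@continuous_pair_swap K H)).
  by move=> z; rewrite mule_ge0.
have intB : \int[mK]_y B y = \int[mG]_x f x.
  rewrite mGE// -(tonelli rH rK mdf df0); apply: eq_integral => h _ /=.
  rewrite ge0_integralZl//; exact: (measurable_pairl h mf').
rewrite /tauconv (tonelli rG rG (measurable_args mf mg)); last first.
  by move=> z; rewrite mule_ge0.
transitivity (\int[mG]_w (B w.2 * N w.1)).
  apply: eq_integral => -[t y] _.
  rewrite (mGE (F := fun x => f (left_arg x (t, y)) * g (right_arg x (t, y)))); last 2 first.
  - exact: (measurable_pairr (t, y) (measurable_args mf mg)).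
  - by move=> x; rewrite mule_ge0.
  rewrite /B -ge0_integralZr//; last 2 first.
  - by apply: (@measurable_borel_comp (H * K)%type H _ _ _ (fun h => (h, y)) mdf);
      exact: continuous_pairr.
  - by move=> h _; rewrite mule_ge0.
  apply: eq_integral => h _; rewrite -muleA; congr (_ * _).
  rewrite /left_arg /right_arg /=.
  (* For [y] outside [O] translation by [y] may change [mK], but then [f (h, y)] is zero and both
     sides vanish. *)
  have [Oy|nOy] := pselect (O y); last first.
    by rewrite sf// mul0e integral0_eq// => k _; rewrite mul0e.
  rewrite ge0_integralZl//; last first.
    apply: (@measurable_borel_comp K K _ _ (fun k => g (t, k)) (fun k => y^-1 * k)%g).
      exact: (@measurable_pairl H K _ _ g t mg').
    exact: continuous_mulgl.
  congr (_ * _); apply: (inv (F := fun k => g (t, k))) => //.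
  exact: (@measurable_pairl H K _ _ g t mg').
rewrite mGE; last 2 first.
- apply: emeasurable_funM.
    apply: (@measurable_borel_comp K G _ _ B (fun w => w.2) mB) => w.
    exact: (@cvg_snd H K).
  apply: (@measurable_borel_comp H G _ _ N (fun w => w.1) mN) => w.
  exact: (@cvg_fst H K).
- by move=> w; rewrite mule_ge0.
have intB0 : 0 <= \int[mK]_y B y by exact: integral_ge0.
have mdN : measurable_fun setT (fun t : borel H => (delta t)%:E * N t).
  exact: emeasurable_funM.
have dN0 t : 0 <= (delta t)%:E * N t by rewrite mule_ge0.
rewrite -intB (mGE mg g0) -[RHS](ge0_integralZl mH measurableT mdN (fun t _ => dN0 t) intB0).
apply: eq_integral => t _ /=.
by rewrite ge0_integralZr// muleCA.
Qed.

(** Both sides are double integrals of [Phi]: Tonelli exchanges [w] and [v], then invariance under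
    translation by [v.2] replaces [w.2] by [v.2^-1 w.2]. Where [v.2] is outside [O] the factor [f]
    is zero. The identity holds at every [x], infinite values included. *)
Lemma tauconv_assoc f g u x : supported 0 f ->
  measurable_fun setT (f : borel G -> \bar R) ->
  measurable_fun setT (g : borel G -> \bar R) ->
  measurable_fun setT (u : borel G -> \bar R) ->
  (forall x, 0 <= f x) -> (forall x, 0 <= g x) -> (forall x, 0 <= u x) ->
  tauconv (tauconv f g) u x = tauconv f (tauconv g u) x.
Proof.
move=> sf mf mg mu f0 g0 u0.
pose Phi (z : G * G) : \bar R := f (left_arg x z.2) *
  (g (right_arg z.1 z.2) * u (right_arg x z.1)).
have Phi0 z : 0 <= Phi z by rewrite /Phi !mule_ge0.
have mPhi : measurable_fun setT (Phi : borel (G * G)%type -> \bar R).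
  apply: emeasurable_funM; last exact: measurable_right_args.
  have mfx := measurable_pairl x
    (measurable_borel_comp (Y := (G * G)%type) mf continuous_left_arg).
  apply: (@measurable_borel_comp G (G * G)%type _ _ _ snd mfx) => z.
  exact: cvg_snd.
transitivity (\int[mG]_w \int[mG]_v Phi (w, v)).
  apply: eq_integral => w _; rewrite /tauconv -ge0_integralZr//.
  - by apply: eq_integral => v _; rewrite /Phi /left_arg /right_arg /= muleA.
  - exact: measurable_args1.
  - by move=> v _; rewrite mule_ge0.
rewrite (tonelli rG rG mPhi Phi0); apply: eq_integral => v _.
have [Ov|nOv] := pselect (O v.2); last first.
  by rewrite sf//= mul0e integral0_eq// => w _; rewrite /Phi /= sf ?mul0e.
rewrite /Phi /=.
rewrite ge0_integralZl//.
- congr (_ * _).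
  rewrite /tauconv -(mG_invariant (f := fun w => g (left_arg (right_arg x v) w) *
    u (right_arg (right_arg x v) w)) Ov); last 2 first.
  + exact: measurable_args1.
  + by move=> w; rewrite mule_ge0.
  apply: eq_integral => w _; rewrite /left_arg /right_arg /=.
  by rewrite invgM invgK -mulgA mulVKg.
- exact: (measurable_pairr v (measurable_right_args x mg mu)).
- by move=> w _; rewrite mule_ge0.
Qed.

End nonnegative.

(** * Convolution of complex integrable functions *)

Section complex_valued.
Implicit Types f g u : G -> R[i].
Local Notation star := (@rtconv R H K tau mH mK delta).

Definition norm_fun f (x : G) : \bar R := (normc (f x))%:E.

Definition L1_supported f := inL1 mG f /\ supported (0 : R[i]) f.

Definition conv_at f g (x w : G) : R[i] := f (left_arg x w) * g (right_arg x w).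

Lemma norm_fun_ge0 f x : (0 <= norm_fun f x)%E.
Proof. by rewrite lee_fin normc_ge0. Qed.

Lemma measurable_norm_fun f : cmeasurable (f : borel G -> R[i]) ->
  measurable_fun setT (norm_fun f : borel G -> \bar R).
Proof. exact: measurable_EFin_normc. Qed.

Lemma supported_norm_fun f : supported (0 : R[i]) f -> supported 0%E (norm_fun f).
Proof. by move=> sf x Ox; rewrite /norm_fun sf// Normc.normc0. Qed.

Lemma cmeasurable_borel_comp (X Y : ptopologicalType) (f : X -> R[i]) (phi : Y -> X) :
  cmeasurable (f : borel X -> R[i]) -> continuous phi ->
  cmeasurable (fun y : borel Y => f (phi y)).
Proof.
by move=> mf cphi; apply: (cmeasurable_comp (phi := phi : borel Y -> borel X)) => //;
  exact: continuous_borel.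
Qed.

Lemma cmeasurable_conv_at f g x : cmeasurable (f : borel G -> R[i]) ->
  cmeasurable (g : borel G -> R[i]) -> cmeasurable (conv_at f g x : borel G -> R[i]).
Proof.
move=> mf mg; apply: cmeasurableM.
  apply: (cmeasurable_borel_comp (Y := G) mf) => w.
  apply: (continuous_comp (f := fun w => (x, w)) (g := fun z : G * G => left_arg z.1 z.2)).
    exact: continuous_pairl.
  exact: continuous_left_arg.
apply: (cmeasurable_borel_comp (Y := G) mg) => w.
apply: (continuous_comp (f := fun w => (x, w)) (g := fun z : G * G => right_arg z.1 z.2)).
  exact: continuous_pairl.
exact: continuous_right_arg.
Qed.

Lemma L1norm_conv_at f g x :
  L1norm mG (conv_at f g x) = tauconv (norm_fun f) (norm_fun g) x.
Proof. by apply: eq_integral => w _; rewrite /conv_at Normc.normcM EFinM. Qed.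

(** Finiteness of the convolution of the absolute values says that [conv_at f g x] is integrable
    over [G]; Fubini then gives convergence of both nested integrals and their value. *)
Lemma star_at f g x : cmeasurable (f : borel G -> R[i]) ->
  cmeasurable (g : borel G -> R[i]) ->
  (tauconv (norm_fun f) (norm_fun g) x < +oo)%E ->
  [/\ rtconv_defined mH mK delta f g x, inL1 mG (conv_at f g x)
    & star f g x = cintegral mG (conv_at f g x)].
Proof.
move=> mf mg fin.
have L : inL1 mG (conv_at f g x).
  by split; [exact: cmeasurable_conv_at|rewrite L1norm_conv_at].
by have [ae1 L1c cE] := semidirect_fubini rK delta_gt0 mdelta mGE L.
Qed.

(** Measurability is needed for the total function, default values included, whereas [star_at]
    describes it only at points of absolute convergence. Hence two successive parametric integrals,
    starting from a function on [G * H * K]. *)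
Lemma cmeasurable_star f g : cmeasurable (f : borel G -> R[i]) ->
  cmeasurable (g : borel G -> R[i]) -> cmeasurable (star f g : borel G -> R[i]).
Proof.
move=> mf mg.
pose F1 (z : G * H * K) : R[i] :=
  f (left_arg z.1.1 (z.1.2, z.2)) * g (right_arg z.1.1 (z.1.2, z.2)).
have c01 : continuous (fun z : G * H * K => z.1.1 : G).
  by move=> z; apply: (continuous_comp (f := fst : G * H * K -> G * H) (g := fst : G * H -> G));
    exact: cvg_fst.
have c02 : continuous (fun z : G * H * K => (z.1.2, z.2) : G).
  move=> z; apply: (@cvg_pair _ H K); last exact: cvg_snd.
  by apply: (continuous_comp (f := fst : G * H * K -> G * H) (g := snd : G * H -> H));
    [exact: cvg_fst|exact: cvg_snd].
have c0 : continuous (fun z : G * H * K => (z.1.1, (z.1.2, z.2)) : G * G).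
  by move=> z; exact: (cvg_pair (c01 z) (c02 z)).
have mF1 : cmeasurable (F1 : borel (G * H * K)%type -> R[i]).
  apply: cmeasurableM.
    apply: (cmeasurable_borel_comp (Y := (G * H * K)%type) mf) => z.
    apply: (continuous_comp (f := fun z : G * H * K => (z.1.1, (z.1.2, z.2)) : G * G)
      (g := fun z : G * G => left_arg z.1 z.2)); first exact: c0.
    exact: continuous_left_arg.
  apply: (cmeasurable_borel_comp (Y := (G * H * K)%type) mg) => z.
  apply: (continuous_comp (f := fun z : G * H * K => (z.1.1, (z.1.2, z.2)) : G * G)
    (g := fun z : G * G => right_arg z.1 z.2)); first exact: c0.
  exact: continuous_right_arg.
have mF2 := cmeasurable_slice_cintegral rK (X := (G * H)%type) mF1.
have mF3 : cmeasurable ((fun z => cintegral mK (fun y => F1 (z, y)) * (delta z.2)%:C)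
    : borel (G * H)%type -> R[i]).
  apply: cmeasurableM => //; apply: cmeasurable_real.
  apply: (@measurable_borel_comp H (G * H)%type _ _ delta snd mdelta) => z.
  exact: cvg_snd.
exact: (cmeasurable_slice_cintegral rH (X := G) mF3).
Qed.

Lemma normc_star_le f g x : cmeasurable (f : borel G -> R[i]) ->
  cmeasurable (g : borel G -> R[i]) ->
  ((normc (star f g x))%:E <= tauconv (norm_fun f) (norm_fun g) x)%E.
Proof.
move=> mf mg; have [->|fin] := eqVneq (tauconv (norm_fun f) (norm_fun g) x) +oo%E.
  by rewrite leey.
have [|_ L ->] := star_at mf mg (x := x); first by rewrite ltey.
by rewrite -L1norm_conv_at; apply: normc_cintegral_le; case: L.
Qed.

Lemma integral_tauconv_norm f g : L1_supported f -> L1_supported g ->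
  (\int[mG]_x tauconv (norm_fun f) (norm_fun g) x = L1norm mG f * L1norm mG g)%E.
Proof.
move=> [[mf _] sf] [[mg _] _]; rewrite integral_tauconv//.
- exact: supported_norm_fun.
- exact: measurable_norm_fun.
- exact: measurable_norm_fun.
- exact: norm_fun_ge0.
- exact: norm_fun_ge0.
Qed.

Lemma measurable_tauconv_norm f g : L1_supported f -> L1_supported g ->
  measurable_fun setT (tauconv (norm_fun f) (norm_fun g) : borel G -> \bar R).
Proof.
move=> [[mf _] sf] [[mg _] _]; apply: measurable_tauconv.
- exact: measurable_norm_fun.
- exact: measurable_norm_fun.
- exact: norm_fun_ge0.
- exact: norm_fun_ge0.
Qed.

Lemma L1norm_mul_fin f g : inL1 mG f -> inL1 mG g ->
  (L1norm mG f * L1norm mG g < +oo)%E.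
Proof.
by move=> [_ fi] [_ gi]; apply: lte_mul_pinfty => //;
  rewrite ?ge0_fin_numE// L1norm_ge0.
Qed.

Lemma ae_finite d (T : measurableType d) (mu : {measure set T -> \bar R})
    (F : T -> \bar R) : measurable_fun setT F -> (forall x, 0 <= F x)%E ->
  (\int[mu]_x F x < +oo)%E -> {ae mu, forall x, (F x < +oo)%E}.
Proof.
move=> mF F0 Fi.
have iF : mu.-integrable setT F.
  by apply/integrableP; split => //; under eq_integral do rewrite gee0_abs//.
by apply: ae_imp (integrable_ae measurableT iF) => x /(_ I); rewrite ge0_fin_numE.
Qed.

Lemma tauconv_norm_finite f g : L1_supported f -> L1_supported g ->
  {ae mG, forall x, (tauconv (norm_fun f) (norm_fun g) x < +oo)%E}.
Proof.
move=> Lf Lg; apply: ae_finite; first exact: measurable_tauconv_norm.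
  by move=> x; apply: tauconv_ge0; exact: norm_fun_ge0.
by rewrite integral_tauconv_norm//; apply: L1norm_mul_fin; [case: Lf|case: Lg].
Qed.

Lemma star_supported f g : supported (0 : R[i]) f -> supported (0 : R[i]) g ->
  supported (0 : R[i]) (star f g).
Proof.
move=> sf sg x nOx.
have c0 d (T : measurableType d) (mu : {measure set T -> \bar R}) :
    cintegral mu (fun=> 0) = 0.
  by apply: eq_complexRI; rewrite /cintegral /= /Rintegral integral0.
rewrite /rtconv (_ : rtconv_integrand _ _ _ _ _ = fun=> 0) ?c0//.
apply/funext => t.
rewrite /rtconv_integrand (_ : Defs.conv _ _ _ _ = 0) ?mul0r//.
rewrite -[RHS](c0 _ _ mK); congr (cintegral mK _).
apply/funext => y; rewrite /conv_integrand /slice.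
by case: (args_notin (t, y) nOx) => [/sf|/sg] /= ->; rewrite ?mul0r ?mulr0.
Qed.

Lemma L1norm_star_le f g : L1_supported f -> L1_supported g ->
  (L1norm mG (star f g) <= L1norm mG f * L1norm mG g)%E.
Proof.
move=> Lf Lg; rewrite -integral_tauconv_norm//.
have [[mf _] _] := Lf; have [[mg _] _] := Lg.
apply: ge0_le_integral => //.
- by move=> x _; exact: norm_fun_ge0.
- by apply: measurable_norm_fun; exact: cmeasurable_star.
- exact: measurable_tauconv_norm.
- by move=> x _; exact: normc_star_le.
Qed.

Lemma star_L1 f g : L1_supported f -> L1_supported g -> L1_supported (star f g).
Proof.
move=> Lf Lg; split; last by apply: star_supported; [case: Lf|case: Lg].
have [[mf _] _] := Lf; have [[mg _] _] := Lg.
split; first exact: cmeasurable_star.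
apply: le_lt_trans (L1norm_star_le Lf Lg) _.
by apply: L1norm_mul_fin; [case: Lf|case: Lg].
Qed.

Lemma star_defined f g : L1_supported f -> L1_supported g ->
  {ae mG, forall x, rtconv_defined mH mK delta f g x}.
Proof.
move=> Lf Lg; apply: ae_imp (tauconv_norm_finite Lf Lg) => x fin.
by have [] := star_at Lf.1.1 Lg.1.1 fin.
Qed.

Lemma L1_supported_linear a f g : L1_supported f -> L1_supported g ->
  L1_supported (fun x => a * f x + g x).
Proof.
move=> [Lf sf] [Lg sg]; split; first exact: inL1_linear.
by move=> x Ox; rewrite sf// sg// mulr0 addr0.
Qed.

(** At almost every point the three absolute convolutions are finite; there each product is one
    integral over [G], and linearity is that of the integral. *)
Lemma star_linearl a f g u : L1_supported f -> L1_supported g -> L1_supported u ->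
  aeq mG (star (fun x => a * f x + g x) u) (fun x => a * star f u x + star g u x).
Proof.
move=> Lf Lg Lu; have Lfg := L1_supported_linear a Lf Lg.
apply: ae_imp2 (tauconv_norm_finite Lfg Lu) _; last first.
  exact: ae_imp2 (fun x a b => conj a b)
    (tauconv_norm_finite Lf Lu) (tauconv_norm_finite Lg Lu).
move=> x fin [finf fing].
have [_ _ ->] := star_at Lfg.1.1 Lu.1.1 fin.
have [_ L1 ->] := star_at Lf.1.1 Lu.1.1 finf.
have [_ L2 ->] := star_at Lg.1.1 Lu.1.1 fing.
rewrite -cintegral_linear//; congr (cintegral _ _); apply/funext => w.
by rewrite /conv_at mulrDl mulrA.
Qed.

Lemma star_linearr a f g u : L1_supported f -> L1_supported g -> L1_supported u ->
  aeq mG (star u (fun x => a * f x + g x)) (fun x => a * star u f x + star u g x).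
Proof.
move=> Lf Lg Lu; have Lfg := L1_supported_linear a Lf Lg.
apply: ae_imp2 (tauconv_norm_finite Lu Lfg) _; last first.
  exact: ae_imp2 (fun x a b => conj a b)
    (tauconv_norm_finite Lu Lf) (tauconv_norm_finite Lu Lg).
move=> x fin [finf fing].
have [_ _ ->] := star_at Lu.1.1 Lfg.1.1 fin.
have [_ L1 ->] := star_at Lu.1.1 Lf.1.1 finf.
have [_ L2 ->] := star_at Lu.1.1 Lg.1.1 fing.
rewrite -cintegral_linear//; congr (cintegral _ _); apply/funext => w.
by rewrite /conv_at mulrDr mulrCA.
Qed.

Lemma L1norm_eq0 f : cmeasurable (f : borel G -> R[i]) ->
  L1norm mG f = 0%E <-> aeq mG f (fun=> 0).
Proof.
move=> mf; have := ae_eq_integral_abs mG measurableT (measurable_norm_fun mf).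
rewrite (_ : (\int[mG]_x `|norm_fun f x|)%E = L1norm mG f); last first.
  by apply: eq_integral => x _; rewrite gee0_abs// norm_fun_ge0.
move=> ->; split; apply: ae_imp => x.
  by move=> /(_ I)[] /Normc.eq0_normc.
by move=> fx _; rewrite /norm_fun fx Normc.normc0.
Qed.

Lemma aeq_sym f g : aeq mG f g -> aeq mG g f.
Proof. by apply: ae_imp => x ->. Qed.

Lemma aeq_trans f g u : aeq mG f g -> aeq mG g u -> aeq mG f u.
Proof. by apply: ae_imp2 => x -> ->. Qed.

(** The difference [e] has norm zero, so its product with [g] has norm zero by [L1norm_star_le], and
    linearity compares the two products. *)
Lemma star_aeql f f' g : L1_supported f -> L1_supported f' -> L1_supported g ->
  aeq mG f f' -> aeq mG (star f g) (star f' g).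
Proof.
move=> Lf Lf' Lg ff'; pose e x := -1 * f' x + f x.
have Le : L1_supported e by exact: L1_supported_linear.
have e0 : L1norm mG e = 0%E.
  by apply/(L1norm_eq0 Le.1.1); apply: ae_imp ff' => x fx; rewrite /e fx mulN1r addNr.
have : L1norm mG (star e g) = 0%E.
  apply/eqP; rewrite eq_le L1norm_ge0 andbT.
  by rewrite (le_trans (L1norm_star_le Le Lg))// e0 mul0e.
move/(L1norm_eq0 (star_L1 Le Lg).1.1) => se0.
apply: ae_imp2 se0 (star_linearl (-1) Lf' Lf Lg) => x -> /esym/eqP.
by rewrite mulN1r addrC subr_eq0 => /eqP.
Qed.

Lemma star_aeqr f g g' : L1_supported f -> L1_supported g -> L1_supported g' ->
  aeq mG g g' -> aeq mG (star f g) (star f g').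
Proof.
move=> Lf Lg Lg' gg'; pose e x := -1 * g' x + g x.
have Le : L1_supported e by exact: L1_supported_linear.
have e0 : L1norm mG e = 0%E.
  by apply/(L1norm_eq0 Le.1.1); apply: ae_imp gg' => x gx; rewrite /e gx mulN1r addNr.
have : L1norm mG (star f e) = 0%E.
  apply/eqP; rewrite eq_le L1norm_ge0 andbT.
  by rewrite (le_trans (L1norm_star_le Lf Le))// e0 mule0.
move/(L1norm_eq0 (star_L1 Lf Le).1.1) => se0.
apply: ae_imp2 se0 (star_linearr (-1) Lg' Lg Lf) => x -> /esym/eqP.
by rewrite mulN1r addrC subr_eq0 => /eqP.
Qed.

(** Writes [f] as ['i * (ip - im) + (rp - rn)] with the positive and negative parts of its real and
    imaginary parts. The closure condition has the shape in which linearity of the product is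
    stated. *)
Lemma L1_supported_ind (P : (G -> R[i]) -> Prop) :
  (forall a f g, L1_supported f -> L1_supported g -> P f -> P g ->
    P (fun x => a * f x + g x)) ->
  (forall r : G -> R, (forall x, 0 <= r x) -> L1_supported (fun x => (r x)%:C) ->
    P (fun x => (r x)%:C)) ->
  forall f, L1_supported f -> P f.
Proof.
move=> Plin Ppos f [[mf fi] sf].
(* Domination by [normc (f x)] yields integrability and the vanishing off the support at once. *)
have L (r : G -> R) : measurable_fun setT (r : borel G -> R) ->
    (forall x, 0 <= r x <= normc (f x)) -> L1_supported (fun x => (r x)%:C).
  move=> mr rf; split; [split|].
  - exact: cmeasurable_real.
  - apply: le_lt_trans fi; apply: ge0_le_integral => //.
    + by move=> x _; rewrite lee_fin normc_ge0.
    + by apply: (measurable_norm_fun (f := fun x => (r x)%:C)); exact: cmeasurable_real.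
    + exact: (measurable_norm_fun mf).
    + move=> x _; rewrite normc_real lee_fin.
      by have /andP[r0 rle] := rf x; rewrite ger0_norm.
  - move=> x /sf fx; have := rf x; rewrite fx Normc.normc0.
    by rewrite -eq_le => /eqP <-.
pose rp x := Num.max (complex.Re (f x)) 0; pose rn x := Num.max (- complex.Re (f x)) 0.
pose ip x := Num.max (complex.Im (f x)) 0; pose im x := Num.max (- complex.Im (f x)) 0.
have maxP (a : R) z : `|a| <= normc z -> 0 <= Num.max a 0 <= normc z.
  by move=> az; rewrite le_max lexx orbT ge_max normc_ge0 andbT (le_trans (ler_norm _)).
have [mr mi] := mf.
have m0 : measurable_fun setT ((fun=> 0) : borel G -> R) by exact: measurable_cst.
have Lrp : L1_supported (fun x => (rp x)%:C).
  by apply: L => [|x]; [exact: measurable_maxr|apply: maxP; exact: ler_Re_normc].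
have Lrn : L1_supported (fun x => (rn x)%:C).
  apply: L => [|x]; [apply: measurable_maxr => //; exact: measurableT_comp|].
  by apply: maxP; rewrite normrN; exact: ler_Re_normc.
have Lip : L1_supported (fun x => (ip x)%:C).
  by apply: L => [|x]; [exact: measurable_maxr|apply: maxP; exact: ler_Im_normc].
have Lim : L1_supported (fun x => (im x)%:C).
  apply: L => [|x]; [apply: measurable_maxr => //; exact: measurableT_comp|].
  by apply: maxP; rewrite normrN; exact: ler_Im_normc.
have max0 (a : R) : 0 <= Num.max a 0 by rewrite le_max lexx orbT.
have maxB (a : R) : - 1 * Num.max (- a) 0 + Num.max a 0 = a.
  have [a0|a0] := leP 0 a.
    by rewrite max_r ?oppr_le0// mulr0 add0r.
  by rewrite max_l ?oppr_ge0 1?ltW// mulN1r opprK addr0.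
have := Plin 'i%C _ _ (L1_supported_linear (-1) Lim Lip) (L1_supported_linear (-1) Lrn Lrp)
  (Plin (-1) _ _ Lim Lip (Ppos _ (fun x => max0 _) Lim) (Ppos _ (fun x => max0 _) Lip))
  (Plin (-1) _ _ Lrn Lrp (Ppos _ (fun x => max0 _) Lrn) (Ppos _ (fun x => max0 _) Lrp)).
congr P; apply/funext => x.
have E (a b : R) : -1 * a%:C + b%:C = (-1 * a + b)%:C by rewrite rmorphD rmorphM rmorphN1.
rewrite !E !maxB; case: (f x) => a b.
by apply: eq_complexRI; rewrite /= !(mul0r, mulr0, mul1r, addr0, add0r, subr0, sub0r, oppr0).
Qed.

Lemma star_nonneg (r s : G -> R) x : (forall x, 0 <= r x) -> (forall x, 0 <= s x) ->
  L1_supported (fun x => (r x)%:C) -> L1_supported (fun x => (s x)%:C) ->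
  (tauconv (EFin \o r) (EFin \o s) x < +oo)%E ->
  star (fun x => (r x)%:C) (fun x => (s x)%:C) x =
  (fine (tauconv (EFin \o r) (EFin \o s) x))%:C.
Proof.
move=> r0 s0 Lr Ls fin.
have nE (t : G -> R) : (forall x, 0 <= t x) -> norm_fun (fun x => (t x)%:C) = EFin \o t.
  by move=> t0; apply/funext => y; rewrite /norm_fun normc_real ger0_norm.
have [|_ _ ->] := star_at (x := x) Lr.1.1 Ls.1.1; first by rewrite !nE.
apply: eq_complexRI; rewrite /cintegral /conv_at /= /Rintegral; last first.
  rewrite (_ : (fun x0 => _) = fun=> 0%E) ?integral0//.
  by apply/funext => y; rewrite mulr0 mul0r addr0.
by congr fine; apply: eq_integral => y _; rewrite mulr0 subr0.
Qed.

Definition associative_triple f g u :=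
  aeq mG (star (star f g) u) (star f (star g u)).

Lemma mule_fine (a : \bar R) (b : R) : (0 <= a)%E -> (0 <= b) ->
  (a * b%:E < +oo)%E -> ((fine a)%:E * b%:E = a * b%:E)%E.
Proof.
case: a => [a| |]//= _; rewrite le_eqVlt => /predU1P[<-|b0]; first by rewrite !mule0.
by rewrite gt0_mulye ?lte_fin.
Qed.

(** [fine] sends infinite values of [a] to 0. A finite integral makes the product [a * b] finite
    almost everywhere, so [b] is zero at almost every place where [a] is infinite, and the integrand
    is unchanged there. *)
Lemma tauconv_finel (a : G -> \bar R) (b : G -> R) x :
  measurable_fun setT (a : borel G -> \bar R) -> (forall x, 0 <= a x)%E ->
  measurable_fun setT (EFin \o b : borel G -> \bar R) -> (forall x, 0 <= b x) ->
  (tauconv a (EFin \o b) x < +oo)%E ->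
  tauconv (EFin \o (fun y => fine (a y))) (EFin \o b) x = tauconv a (EFin \o b) x.
Proof.
move=> ma a0 mb b0 fin.
have mfa : measurable_fun setT (EFin \o (fun y => fine (a y)) : borel G -> \bar R).
  by apply/measurable_EFinP; exact: measurableT_comp.
have E0 y : (0 <= (EFin \o b) y)%E by rewrite lee_fin.
apply: ge0_ae_eq_integral => //.
- exact: measurable_args1.
- exact: measurable_args1.
- by move=> w _; rewrite mule_ge0// lee_fin fine_ge0.
- by move=> w _; rewrite mule_ge0.
apply: ae_imp (ae_finite (measurable_args1 x ma mb) _ fin) => w; last exact: mule_ge0.
by move=> h _; exact: mule_fine.
Qed.

Lemma tauconv_finer (a : G -> R) (b : G -> \bar R) x :
  measurable_fun setT (EFin \o a : borel G -> \bar R) -> (forall x, 0 <= a x) ->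
  measurable_fun setT (b : borel G -> \bar R) -> (forall x, 0 <= b x)%E ->
  (tauconv (EFin \o a) b x < +oo)%E ->
  tauconv (EFin \o a) (EFin \o (fun y => fine (b y))) x = tauconv (EFin \o a) b x.
Proof.
move=> ma a0 mb b0 fin.
have mfb : measurable_fun setT (EFin \o (fun y => fine (b y)) : borel G -> \bar R).
  by apply/measurable_EFinP; exact: measurableT_comp.
have E0 y : (0 <= (EFin \o a) y)%E by rewrite lee_fin.
apply: ge0_ae_eq_integral => //.
- exact: measurable_args1.
- exact: measurable_args1.
- by move=> w _; rewrite mule_ge0// lee_fin fine_ge0.
- by move=> w _; rewrite mule_ge0.
apply: ae_imp (ae_finite (measurable_args1 x ma mb) _ fin) => w; last exact: mule_ge0.
move=> h _; rewrite -[LHS]muleC -[RHS]muleC; apply: mule_fine => //.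
by rewrite muleC.
Qed.

(* [tauconv_assoc] is an identity in the extended reals; the convolutions below
   are finite only almost everywhere, but at a point where the outer convolution
   is finite the infinite values of the inner one meet zeros of the third factor. *)
Lemma star_assoc_nonneg (r s t : G -> R) :
  (forall x, 0 <= r x) -> (forall x, 0 <= s x) -> (forall x, 0 <= t x) ->
  L1_supported (fun x => (r x)%:C) -> L1_supported (fun x => (s x)%:C) ->
  L1_supported (fun x => (t x)%:C) ->
  associative_triple (fun x => (r x)%:C) (fun x => (s x)%:C) (fun x => (t x)%:C).
Proof.
move=> r0 s0 t0 Lr Ls Lt.
have nE (a : G -> R) : (forall x, 0 <= a x) -> norm_fun (fun x => (a x)%:C) = EFin \o a.
  by move=> a0; apply/funext => y; rewrite /norm_fun normc_real ger0_norm.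
have mE (a : G -> R) : L1_supported (fun x => (a x)%:C) ->
    measurable_fun setT (EFin \o a : borel G -> \bar R).
  by move=> [[[ma _] _] _]; apply/measurable_EFinP.
have sE (a : G -> R) : L1_supported (fun x => (a x)%:C) -> supported 0%E (EFin \o a).
  by move=> [_ sa] x /sa/= [->].
have E0 (a : G -> R) : (forall x, 0 <= a x) -> forall x, (0 <= (EFin \o a) x)%E.
  by move=> a0 x; rewrite lee_fin.
have fin (a b : G -> R) : (forall x, 0 <= a x) -> (forall x, 0 <= b x) ->
    L1_supported (fun x => (a x)%:C) -> L1_supported (fun x => (b x)%:C) ->
    {ae mG, forall x, (tauconv (EFin \o a) (EFin \o b) x < +oo)%E}.
  by move=> a0 b0 La Lb; rewrite -!nE//; exact: tauconv_norm_finite.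
(* A real nonnegative representative of the class of the product: it agrees with [star] wherever the
   extended convolution is finite. *)
pose F (a b : G -> R) x := fine (tauconv (EFin \o a) (EFin \o b) x).
have F0 a b : (forall x, 0 <= a x) -> (forall x, 0 <= b x) -> forall x, 0 <= F a b x.
  by move=> a0 b0 x; apply: fine_ge0; apply: tauconv_ge0; exact: E0.
have starF (a b : G -> R) : (forall x, 0 <= a x) -> (forall x, 0 <= b x) ->
    L1_supported (fun x => (a x)%:C) -> L1_supported (fun x => (b x)%:C) ->
    aeq mG (star (fun x => (a x)%:C) (fun x => (b x)%:C)) (fun x => (F a b x)%:C).
  by move=> a0 b0 La Lb; apply: ae_imp (fin a b a0 b0 La Lb) => x; exact: star_nonneg.
have LF (a b : G -> R) : (forall x, 0 <= a x) -> (forall x, 0 <= b x) ->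
    L1_supported (fun x => (a x)%:C) -> L1_supported (fun x => (b x)%:C) ->
    L1_supported (fun x => (F a b x)%:C).
  move=> a0 b0 La Lb; have Lab := star_L1 La Lb.
  have mS := measurable_tauconv (mE a La) (mE b Lb) (E0 a a0) (E0 b b0).
  have mF : cmeasurable ((fun x => (F a b x)%:C) : borel G -> R[i]).
    by apply: cmeasurable_real; exact: measurableT_comp.
  split; [split=> //|].
    case: Lab => -[_ Li] _; apply: le_lt_trans Li.
    rewrite le_eqVlt; apply/orP; left; apply/eqP.
    apply: ge0_ae_eq_integral => //.
    - exact: (measurable_norm_fun mF).
    - by apply: measurable_norm_fun; exact: cmeasurable_star La.1.1 Lb.1.1.
    - by move=> x _; rewrite lee_fin normc_ge0.
    - by move=> x _; rewrite lee_fin normc_ge0.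
    - by apply: ae_imp (starF a b a0 b0 La Lb) => x -> _.
  by move=> x Ox; rewrite /F supported_tauconv//; exact: sE.
have rs0 := F0 r s r0 s0; have st0 := F0 s t s0 t0.
have Lrs := LF r s r0 s0 Lr Ls; have Lst := LF s t s0 t0 Ls Lt.
have assoc x : tauconv (tauconv (EFin \o r) (EFin \o s)) (EFin \o t) x =
    tauconv (EFin \o r) (tauconv (EFin \o s) (EFin \o t)) x.
  by apply: tauconv_assoc => //; [exact: sE|exact: mE|exact: mE|exact: mE].
have mrs := measurable_tauconv (mE r Lr) (mE s Ls) (E0 r r0) (E0 s s0).
have mst := measurable_tauconv (mE s Ls) (mE t Lt) (E0 s s0) (E0 t t0).
have rs0' x : (0 <= tauconv (EFin \o r) (EFin \o s) x)%E := tauconv_ge0 x (E0 r r0) (E0 s s0).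
have st0' x : (0 <= tauconv (EFin \o s) (EFin \o t) x)%E := tauconv_ge0 x (E0 s s0) (E0 t t0).
have Sfin : {ae mG, forall x,
    (tauconv (tauconv (EFin \o r) (EFin \o s)) (EFin \o t) x < +oo)%E}.
  apply: (ae_finite (measurable_tauconv mrs (mE t Lt) rs0' (E0 t t0))).
    by move=> x; exact: tauconv_ge0 rs0' (E0 t t0).
  (* The integral of the triple convolution is the product of the three finite norms, so it is
     finite almost everywhere. *)
  rewrite (integral_tauconv (supported_tauconv (sE r Lr) (sE s Ls)) mrs (mE t Lt) rs0' (E0 t t0)).
  rewrite (integral_tauconv (sE r Lr) (mE r Lr) (mE s Ls) (E0 r r0) (E0 s s0)).
  have fE (a : G -> R) : (forall x, 0 <= a x) -> L1_supported (fun x => (a x)%:C) ->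
      (\int[mG]_x (EFin \o a) x)%E \is a fin_num.
    move=> a0 [[_ ai] _]; rewrite -nE// ge0_fin_numE//.
    exact: L1norm_ge0.
  by rewrite ltey_eq !fin_numM// fE.
have left : aeq mG (star (star (fun x => (r x)%:C) (fun x => (s x)%:C)) (fun x => (t x)%:C))
    (star (fun x => (F r s x)%:C) (fun x => (t x)%:C)).
  apply: star_aeql => //; first exact: star_L1.
  exact: starF.
have right : aeq mG (star (fun x => (r x)%:C) (star (fun x => (s x)%:C) (fun x => (t x)%:C)))
    (star (fun x => (r x)%:C) (fun x => (F s t x)%:C)).
  apply: star_aeqr => //; first exact: star_L1.
  exact: starF.
rewrite /associative_triple; apply: (aeq_trans left); apply: aeq_sym; apply: (aeq_trans right).
apply: aeq_trans (starF r (F s t) r0 st0 Lr Lst) _.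
apply: aeq_sym; apply: aeq_trans (starF (F r s) t rs0 t0 Lrs Lt) _.
apply: ae_imp Sfin => x Sx.
have Sx' := Sx; rewrite assoc in Sx'.
by rewrite /F (tauconv_finel mrs rs0' (mE t Lt) t0 Sx) assoc
  (tauconv_finer (mE r Lr) r0 mst st0' Sx').
Qed.

Lemma aeq_linear a f f' g g' : aeq mG f f' -> aeq mG g g' ->
  aeq mG (fun x => a * f x + g x) (fun x => a * f' x + g' x).
Proof. by apply: ae_imp2 => x -> ->. Qed.

(** Three nested reductions to nonnegative functions, one per argument, the later arguments staying
    general. Linearity is only an almost everywhere identity, so using it inside another product
    goes through [star_aeql] or [star_aeqr]. *)
Lemma star_assoc f g u : L1_supported f -> L1_supported g -> L1_supported u ->
  associative_triple f g u.
Proof.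
move=> Lf; move: g u.
pattern f; move: f Lf; apply: L1_supported_ind.
  move=> a f f' Lf Lf' IH IH' g u Lg Lu.
  have Lfg := star_L1 Lf Lg; have Lf'g := star_L1 Lf' Lg.
  have Lgu := star_L1 Lg Lu.
  have Lff' := L1_supported_linear a Lf Lf'.
  apply: aeq_trans (star_aeql (star_L1 Lff' Lg) (L1_supported_linear a Lfg Lf'g) Lu
    (star_linearl a Lf Lf' Lg)) _.
  apply: aeq_trans (star_linearl a Lfg Lf'g Lu) _.
  apply: aeq_sym; apply: aeq_trans (star_linearl a Lf Lf' Lgu) _.
  by apply: aeq_linear; apply: aeq_sym; [exact: IH|exact: IH'].
move=> r r0 Lr g u Lg; move: u.
pattern g; move: g Lg; apply: L1_supported_ind.
  move=> a g g' Lg Lg' IH IH' u Lu.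
  have Lrg := star_L1 Lr Lg; have Lrg' := star_L1 Lr Lg'.
  have Lgu := star_L1 Lg Lu; have Lg'u := star_L1 Lg' Lu.
  have Lgg' := L1_supported_linear a Lg Lg'.
  apply: aeq_trans (star_aeql (star_L1 Lr Lgg') (L1_supported_linear a Lrg Lrg') Lu
    (star_linearr a Lg Lg' Lr)) _.
  apply: aeq_trans (star_linearl a Lrg Lrg' Lu) _.
  apply: aeq_sym.
  apply: aeq_trans (star_aeqr Lr (star_L1 Lgg' Lu) (L1_supported_linear a Lgu Lg'u)
    (star_linearl a Lg Lg' Lu)) _.
  apply: aeq_trans (star_linearr a Lgu Lg'u Lr) _.
  by apply: aeq_linear; apply: aeq_sym; [exact: IH|exact: IH'].
move=> s s0 Ls u Lu.
pattern u; move: u Lu; apply: L1_supported_ind.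
  move=> a u u' Lu Lu' IH IH'.
  have Lrs := star_L1 Lr Ls.
  have Lsu := star_L1 Ls Lu; have Lsu' := star_L1 Ls Lu'.
  have Luu' := L1_supported_linear a Lu Lu'.
  apply: aeq_trans (star_linearr a Lu Lu' Lrs) _.
  apply: aeq_sym.
  apply: aeq_trans (star_aeqr Lr (star_L1 Ls Luu') (L1_supported_linear a Lsu Lsu')
    (star_linearr a Lu Lu' Ls)) _.
  apply: aeq_trans (star_linearr a Lsu Lsu' Lr) _.
  by apply: aeq_linear; apply: aeq_sym; [exact: IH|exact: IH'].
by move=> t t0 Lt; exact: star_assoc_nonneg.
Qed.

End complex_valued.

End convolution_algebra.

(** * Restriction to clopen subgroups *)

Section transfer.
Context (R : realType).

Lemma cintegral_mrestr d (T : measurableType d) (mu : {measure set T -> \bar R})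
    (O : set T) (mO : measurable O) (F : T -> R[i]) :
  (forall x, ~ O x -> F x = 0) -> cintegral (mrestr mu mO) F = cintegral mu F.
Proof.
move=> F0; apply: eq_complexRI; rewrite /cintegral /= /Rintegral integral_mrestr//;
  by move=> x Ox; rewrite F0.
Qed.

Lemma L1norm_mrestr d (T : measurableType d) (mu : {measure set T -> \bar R})
    (O : set T) (mO : measurable O) (F : T -> R[i]) :
  (forall x, ~ O x -> F x = 0) -> L1norm (mrestr mu mO) F = L1norm mu F.
Proof.
by move=> F0; rewrite /L1norm integral_mrestr// => x Ox; rewrite F0// Normc.normc0.
Qed.

Lemma inL1_mrestr d (T : measurableType d) (mu : {measure set T -> \bar R})
    (O : set T) (mO : measurable O) (F : T -> R[i]) :
  (forall x, ~ O x -> F x = 0) -> inL1 (mrestr mu mO) F <-> inL1 mu F.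
Proof. by move=> F0; rewrite /inL1 L1norm_mrestr. Qed.

Lemma inL1_zero d (T : measurableType d) (mu : {measure set T -> \bar R}) :
  inL1 mu (fun=> 0).
Proof.
split; first exact: cmeasurable_cst.
by rewrite /L1norm integral0_eq// => x _; rewrite Normc.normc0.
Qed.

Lemma cintegral_zero d (T : measurableType d) (mu : {measure set T -> \bar R}) :
  cintegral mu (fun=> 0) = 0.
Proof. by apply: eq_complexRI; rewrite /cintegral /= /Rintegral integral0. Qed.

Section restricted.
Context (H K : lcGroupType) (tau : contHomAut H K).
Variables (muH : {measure set (borel H) -> \bar R}).
Variables (muK : {measure set (borel K) -> \bar R}) (delta : H -> R).
Variable muG : {measure set (borel (semidirect tau)) -> \bar R}.
Hypotheses (haarH : left_haar muH) (haarK : left_haar muK).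
Hypothesis modulus : tau_modulus tau muK delta.
Hypothesis haarG : semidirect_haar muH muK delta muG.
Local Notation G := (semidirect tau).
Variables (OH : set H) (DH QH : nat -> set H) (OK : set K) (DK QK : nat -> set K).
Hypotheses (esH : exhausted_subgroup OH DH QH) (esK : exhausted_subgroup OK DK QK).

Let mH : {measure set (borel H) -> \bar R} := mrestr muH (borel_OH esH).
Let mK : {measure set (borel K) -> \bar R} := mrestr muK (borel_OK esK).
Let mG : {measure set (borel G) -> \bar R} := mrestr muG (borel_OG (tau := tau) esH esK).
Local Notation star := (@rtconv R H K tau muH muK delta).
Local Notation star' := (@rtconv R H K tau mH mK delta).

Definition supported_in (f : G -> R[i]) :=
  forall x : G, ~ (OH `*` OK) x -> f x = 0.

Let rH : tau_sigma_finite mH := haar_mrestr_tau_sigma_finite haarH esH (borel_OH esH).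
Let rK : tau_sigma_finite mK := haar_mrestr_tau_sigma_finite haarK esK (borel_OK esK).
Let rG : tau_sigma_finite mG := semidirect_tau_sigma_finite haarH haarK haarG esH esK.
Let d0 : forall h, 0 < delta h. Proof. by have [] := modulus. Qed.
Let md := borel_delta modulus.
Let mGE F mF F0 := @semidirect_integral R H K tau muH muK delta muG haarH haarK
  modulus haarG OH DH QH OK DK QK esH esK F mF F0.
Let O_div := es_div esK.
Let inv a F Oa mF F0 :=
  @haar_mrestr_invariant R K muK haarK OK DK QK esK (borel_OK esK) a F Oa mF F0.

Lemma supported_in_L1 (f : G -> R[i]) : supported_in f -> inL1 muG f ->
  L1_supported mG OK f.
Proof.
move=> sf Lf; split; first by apply/inL1_mrestr.
by move=> x nOx; apply: sf => -[].
Qed.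

(** The inner integrand contains [f (h, y)], zero for [y] outside [OK], and the outer one contains
    [g (t, .)], zero for [t] outside [OH]. The two products therefore agree at every point, default
    values included. *)
Lemma star_restricted f g : supported_in f -> supported_in g -> star f g = star' f g.
Proof.
move=> sf sg; apply/funext => x; rewrite /rtconv -(cintegral_mrestr muH (borel_OH esH)).
  congr (cintegral _ _); apply/funext => t; rewrite /rtconv_integrand /Defs.conv.
  rewrite (cintegral_mrestr muK (borel_OK esK))// => y nOy.
  by rewrite /conv_integrand /slice sf ?mul0r// => -[].
move=> t nOt; rewrite /rtconv_integrand /Defs.conv.
rewrite (_ : conv_integrand _ _ _ = fun=> 0) ?cintegral_zero ?mul0r//.
by apply/funext => y; rewrite /conv_integrand /slice sg ?mulr0// => -[].
Qed.

Lemma rtconv_defined_restricted f g x : supported_in f -> supported_in g ->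
  rtconv_defined mH mK delta f g x -> rtconv_defined muH muK delta f g x.
Proof.
move=> sf sg [ae1 L2].
have fz t y : ~ OK y -> conv_integrand (slice f x.1) (slice g t) x.2 y = 0.
  by move=> nOy; rewrite /conv_integrand /slice sf ?mul0r// => -[].
have gz t : ~ OH t -> conv_integrand (slice f x.1) (slice g t) x.2 = fun=> 0.
  by move=> nOt; apply/funext => y; rewrite /conv_integrand /slice sg ?mulr0// => -[].
have rE t : rtconv_integrand mK delta f g x t = rtconv_integrand muK delta f g x t.
  rewrite /rtconv_integrand /Defs.conv (cintegral_mrestr muK (borel_OK esK))//; exact: fz.
split.
  apply: (proj1 (ae_mrestr muH (borel_OH esH) _)).
    by move=> t /gz ->; exact: inL1_zero.
  by apply: ae_imp ae1 => t; rewrite inL1_mrestr//; exact: fz.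
have rz t : ~ OH t -> rtconv_integrand muK delta f g x t = 0.
  move=> /gz tz; rewrite /rtconv_integrand /Defs.conv tz cintegral_zero mul0r//.
by apply/(inL1_mrestr muH (borel_OH esH) rz); rewrite -(funext rE).
Qed.

(** A nonzero value would put [x.1] in [OH], and both [y] and [y^-1 x.2] in [OK], hence [x.2] in
    [OK] as well. *)
Lemma conv_integrand_out f g (x : G) t : supported_in f -> supported_in g ->
  ~ (OH `*` OK) x -> conv_integrand (slice f x.1) (slice g t) x.2 = fun=> 0.
Proof.
move=> sf sg nOx; apply/funext => y; rewrite /conv_integrand /slice.
have [Oxy|nOxy] := pselect ((OH `*` OK) (x.1, y)); last by rewrite sf ?mul0r.
rewrite [X in _ * X]sg ?mulr0// => -[/= _ Oyx]; apply: nOx.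
have [Ox Oy] := Oxy; split => //=.
have O1 : OK 1%g by rewrite -(mulVg y); exact: O_div.
rewrite -(mulKg (y^-1)%g x.2); apply: O_div => //.
by rewrite -[(y^-1)%g]mulg1; exact: O_div.
Qed.

Lemma rtconv_defined_out f g (x : G) : supported_in f -> supported_in g ->
  ~ (OH `*` OK) x -> rtconv_defined mH mK delta f g x.
Proof.
move=> sf sg nOx; split.
  apply: aeW => t; rewrite conv_integrand_out//; exact: inL1_zero.
rewrite (_ : rtconv_integrand _ _ _ _ _ = fun=> 0); first exact: inL1_zero.
apply/funext => t; rewrite /rtconv_integrand /Defs.conv conv_integrand_out//.
by rewrite cintegral_zero mul0r.
Qed.

Lemma supported_in_star f g : supported_in f -> supported_in g ->
  supported_in (star f g).
Proof.
move=> sf sg x nOx; rewrite star_restricted// /rtconv.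
rewrite (_ : rtconv_integrand _ _ _ _ _ = fun=> 0) ?cintegral_zero//.
apply/funext => t; rewrite /rtconv_integrand /Defs.conv conv_integrand_out//.
by rewrite cintegral_zero mul0r.
Qed.

Lemma aeq_restricted f g : supported_in f -> supported_in g ->
  aeq mG f g <-> aeq muG f g.
Proof. by move=> sf sg; apply: ae_mrestr => x nOx; rewrite sf// sg. Qed.

Lemma inL1_restricted f : supported_in f -> inL1 mG f <-> inL1 muG f.
Proof. by move=> sf; exact: inL1_mrestr. Qed.

Lemma L1norm_restricted f : supported_in f -> L1norm mG f = L1norm muG f.
Proof. by move=> sf; exact: L1norm_mrestr. Qed.

Lemma supported_in_linear (a : R[i]) f g : supported_in f -> supported_in g ->
  supported_in (fun x => a * f x + g x).
Proof. by move=> sf sg x nOx; rewrite sf// sg// mulr0 addr0. Qed.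

Section functions.
Variables f g u : G -> R[i].
Hypotheses (sf : supported_in f) (sg : supported_in g) (su : supported_in u).
Hypotheses (Lf : inL1 muG f) (Lg : inL1 muG g) (Lu : inL1 muG u).
Let Lf' := supported_in_L1 sf Lf.
Let Lg' := supported_in_L1 sg Lg.
Let Lu' := supported_in_L1 su Lu.
Let sfg := supported_in_star sf sg.

Lemma haar_star_defined : {ae muG, forall x, rtconv_defined muH muK delta f g x}.
Proof.
apply: (proj1 (ae_mrestr muG (borel_OG (tau := tau) esH esK) _)).
  move=> x nOx; apply: rtconv_defined_restricted => //.
  exact: rtconv_defined_out.
apply: ae_imp (star_defined rH rK rG d0 md mGE inv Lf' Lg') => x.
exact: rtconv_defined_restricted.
Qed.

Lemma haar_star_L1 : inL1 muG (star f g).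
Proof.
apply/(inL1_restricted sfg); rewrite star_restricted//.
exact: (star_L1 rH rK rG d0 md mGE O_div inv Lf' Lg').1.
Qed.

Lemma haar_star_norm : (L1norm muG (star f g) <= L1norm muG f * L1norm muG g)%E.
Proof.
rewrite -!L1norm_restricted// star_restricted//.
exact: (L1norm_star_le rH rK rG d0 md mGE inv Lf' Lg').
Qed.

Lemma haar_star_linearl a :
  aeq muG (star (fun x => a * f x + g x) u) (fun x => a * star f u x + star g u x).
Proof.
have slin := supported_in_linear a sf sg.
apply/aeq_restricted.
- exact: supported_in_star.
- by apply: supported_in_linear; exact: supported_in_star.
rewrite !star_restricted//.
exact: (star_linearl rH rK rG d0 md mGE inv a Lf' Lg' Lu').
Qed.

Lemma haar_star_linearr a :
  aeq muG (star u (fun x => a * f x + g x)) (fun x => a * star u f x + star u g x).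
Proof.
have slin := supported_in_linear a sf sg.
apply/aeq_restricted.
- exact: supported_in_star.
- by apply: supported_in_linear; exact: supported_in_star.
rewrite !star_restricted//.
exact: (star_linearr rH rK rG d0 md mGE inv a Lf' Lg' Lu').
Qed.

Lemma haar_star_aeql : aeq muG f g -> aeq muG (star f u) (star g u).
Proof.
move=> /(aeq_restricted sf sg) fg.
apply/aeq_restricted; [exact: supported_in_star|exact: supported_in_star|].
rewrite !star_restricted//.
exact: (star_aeql rH rK rG d0 md mGE O_div inv Lf' Lg' Lu' fg).
Qed.

Lemma haar_star_aeqr : aeq muG f g -> aeq muG (star u f) (star u g).
Proof.
move=> /(aeq_restricted sf sg) fg.
apply/aeq_restricted; [exact: supported_in_star|exact: supported_in_star|].
rewrite !star_restricted//.
exact: (star_aeqr rH rK rG d0 md mGE O_div inv Lu' Lf' Lg' fg).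
Qed.

Lemma haar_star_assoc : aeq muG (star (star f g) u) (star f (star g u)).
Proof.
have sgu := supported_in_star sg su.
apply/aeq_restricted; [exact: supported_in_star|exact: supported_in_star|].
rewrite (star_restricted sfg su) (star_restricted sf sgu) !star_restricted//.
exact: (star_assoc rH rK rG d0 md mGE O_div inv Lf' Lg' Lu').
Qed.

End functions.
End restricted.
End transfer.

(** * Common supports, and the theorem for the original Haar measures *)

Section common_support.
Context (R : realType) (H K : lcGroupType) (tau : contHomAut H K).
Variables (muH : {measure set (borel H) -> \bar R}).
Variables (muK : {measure set (borel K) -> \bar R}) (delta : H -> R).
Variable muG : {measure set (borel (semidirect tau)) -> \bar R}.
Hypothesis haarG : semidirect_haar muH muK delta muG.
Local Notation G := (semidirect tau).

Lemma inL1_sigma_compact_support (f : G -> R[i]) : inL1 muG f ->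
  exists2 C : nat -> set G, (forall n, compact (C n)) &
    forall x, f x != 0 -> (\bigcup_n C n) x.
Proof.
move=> [mf Lf].
have [C cC fC] := haar_integrable_support haarG.1 (measurable_norm_fun mf)
  (fun x => norm_fun_ge0 f x) Lf.
exists C => // x fx; apply: fC; apply: contra_neq fx.
by rewrite /norm_fun => -[] /Normc.eq0_normc.
Qed.

(** The projections to [H] and [K] of the compact sets carrying the functions are compact and
    generate the two subgroups. Four is the number of functions in the compatibility with almost
    everywhere equality; clauses with fewer repeat one. *)
Lemma common_support (f g u v : G -> R[i]) :
  inL1 muG f -> inL1 muG g -> inL1 muG u -> inL1 muG v ->
  exists OH DH QH OK DK QK, [/\ @exhausted_subgroup H OH DH QH,
    @exhausted_subgroup K OK DK QK & [/\ supported_in OH OK f,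
    supported_in OH OK g, supported_in OH OK u & supported_in OH OK v]].
Proof.
move=> /inL1_sigma_compact_support[C1 c1 s1] /inL1_sigma_compact_support[C2 c2 s2].
move=> /inL1_sigma_compact_support[C3 c3 s3] /inL1_sigma_compact_support[C4 c4 s4].
pose C n : set (H * K) := (C1 n `|` C2 n) `|` (C3 n `|` C4 n).
have cC n : compact (C n).
  by apply: compactU; apply: compactU; [exact: c1|exact: c2|exact: c3|exact: c4].
have [OH [DH [QH [esH PH]]]] := @exhausted_subgroup_exists H (fun n => fst @` C n)
  (fun n => continuous_compact (continuous_subspaceT (fun x => cvg_fst)) (cC n)).
have [OK [DK [QK [esK PK]]]] := @exhausted_subgroup_exists K (fun n => snd @` C n)
  (fun n => continuous_compact (continuous_subspaceT (fun x => cvg_snd)) (cC n)).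
have supp (F : G -> R[i]) (CF : nat -> set G) : (forall n, CF n `<=` C n) ->
    (forall x, F x != 0 -> (\bigcup_n CF n) x) -> supported_in OH OK F.
  move=> FC FS x nOx; apply/eqP; apply: contrapT => /negP /FS [n _ /FC Cx].
  by apply: nOx; split; [apply: (PH n)|apply: (PK n)]; exists x.
exists OH, DH, QH, OK, DK, QK; split => //; split.
- by apply: supp s1 => n x; left; left.
- by apply: supp s2 => n x; left; right.
- by apply: supp s3 => n x; right; left.
- by apply: supp s4 => n x; right; right.
Qed.

End common_support.

Theorem theorem3p1 (R : realType) (H K : lcGroupType) (tau : contHomAut H K)
    (muH : {measure set (borel H) -> \bar R})
    (muK : {measure set (borel K) -> \bar R})
    (delta : H -> R)
    (muG : {measure set (borel (semidirect tau)) -> \bar R}) :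
  left_haar muH -> left_haar muK ->
  tau_modulus tau muK delta ->
  semidirect_haar muH muK delta muG ->
  let L1 := inL1 muG in
  let star := @rtconv R H K tau muH muK delta in
  [/\ (* star is a well-defined operation on classes modulo a.e. equality *)
      [/\ forall f g : semidirect tau -> R[i], L1 f -> L1 g ->
            {ae muG, forall x, rtconv_defined muH muK delta f g x},
          forall f g : semidirect tau -> R[i], L1 f -> L1 g -> L1 (star f g)
        & forall f f' g g' : semidirect tau -> R[i],
            L1 f -> L1 f' -> L1 g -> L1 g' ->
            aeq muG f f' -> aeq muG g g' ->
            aeq muG (star f g) (star f' g')],
      (* bilinearity *)
      (forall (a : R[i]) (f g u : semidirect tau -> R[i]),
        L1 f -> L1 g -> L1 u ->
        aeq muG (star (fun x => a * f x + g x) u)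
                (fun x => a * star f u x + star g u x)) /\
      (forall (a : R[i]) (f g u : semidirect tau -> R[i]),
        L1 f -> L1 g -> L1 u ->
        aeq muG (star u (fun x => a * f x + g x))
                (fun x => a * star u f x + star u g x)),
      (* associativity *)
      forall f g u : semidirect tau -> R[i], L1 f -> L1 g -> L1 u ->
        aeq muG (star (star f g) u) (star f (star g u))
    & (* submultiplicativity of the norm *)
      forall f g : semidirect tau -> R[i], L1 f -> L1 g ->
        (L1norm muG (star f g) <= L1norm muG f * L1norm muG g)%E ].
Proof.
(* The restricted measures depend on the functions, so each clause chooses its own pair of
   subgroups; the conclusions mention only the original measures. *)
move=> haarH haarK modulus haarG L1 star; split.
- split.
  + move=> f g Lf Lg.
    have [OH [DH [QH [OK [DK [QK [esH esK [sf sg _ _]]]]]]]] :=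
      common_support haarG Lf Lg Lf Lg.
    exact: (haar_star_defined haarH haarK modulus haarG esH esK).
  + move=> f g Lf Lg.
    have [OH [DH [QH [OK [DK [QK [esH esK [sf sg _ _]]]]]]]] :=
      common_support haarG Lf Lg Lf Lg.
    exact: (haar_star_L1 haarH haarK modulus haarG esH esK).
  + move=> f f' g g' Lf Lf' Lg Lg' ff' gg'.
    have [OH [DH [QH [OK [DK [QK [esH esK [sf sf' sg sg']]]]]]]] :=
      common_support haarG Lf Lf' Lg Lg'.
    apply: (@aeq_trans _ _ _ _ _ _ (star f' g)).
      exact: (haar_star_aeql haarH haarK modulus haarG esH esK).
    exact: (haar_star_aeqr haarH haarK modulus haarG esH esK).
- split=> a f g u Lf Lg Lu.
    have [OH [DH [QH [OK [DK [QK [esH esK [sf sg su _]]]]]]]] :=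
      common_support haarG Lf Lg Lu Lu.
    exact: (haar_star_linearl haarH haarK modulus haarG esH esK).
  have [OH [DH [QH [OK [DK [QK [esH esK [sf sg su _]]]]]]]] :=
    common_support haarG Lf Lg Lu Lu.
  exact: (haar_star_linearr haarH haarK modulus haarG esH esK).
- move=> f g u Lf Lg Lu.
  have [OH [DH [QH [OK [DK [QK [esH esK [sf sg su _]]]]]]]] :=
    common_support haarG Lf Lg Lu Lu.
  exact: (haar_star_assoc haarH haarK modulus haarG esH esK).
- move=> f g Lf Lg.
  have [OH [DH [QH [OK [DK [QK [esH esK [sf sg _ _]]]]]]]] :=
    common_support haarG Lf Lg Lf Lg.
  exact: (haar_star_norm haarH haarK modulus haarG esH esK).
Qed.
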